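(* Let $A$ be a completely contractive Banach algebra and let $X$ be a completely contractive right operator $A$-module via $Q:X\times A\to X$, $(x,a)\mapsto x\cdot a$. Then the operator Fourier space with its Fourier operator space matrix norm, $(\mathcal F_Q(A^* ),\|\cdot\|_Q)$, is an operator left introverted homogeneous subspace of $A^*$.
   Context: A bilinear map $m:X\times Y\to Z$ of operator spaces is completely contractive (c.c.) if $\|[m(x_{ij},y_{kl})]\|_{M_{rs}(Z)}\le\|[x_{ij}]\|_{M_r(X)}\|[y_{kl}]\|_{M_s(Y)}$ for all $r,s$ and all matrices. Operator spaces are complete; $\widehat\otimes$ is the operator space projective tensor product. A c.c. Banach algebra is an associative algebra that is an operator space with c.c. multiplication; a c.c. right operator $A$-module is an operator space with a right module action that is a c.c. bilinear map. Right action on $A^*$: $\langle\phi\cdot a,b\rangle=\langle\phi,ab\rangle$. The operator Fourier space. For $x^*\in X^*$, $x\in X$ define $x^*\cdot x\in A^*$ by $\langle x^*\cdot x,a\rangle=\langle x^*,x\cdot a\rangle$. This induces a complete contraction $P:X^*\widehat\otimes X\to A^*$, $P(x^*\otimes x)=x^*\cdot x$. Put $\mathcal F_Q(A^* )=P(X^*\widehat\otimes X)$ with the quotient operator space structure of $(X^*\widehat\otimes X)/\ker P$: for $\phi\in M_n(\mathcal F_Q(A^* ))$, $\|\phi\|_Q=\inf\{\|\xi\|_\wedge:\xi\in M_n(X^*\widehat\otimes X),\ P_n(\xi)=\phi\}$. An operator left introverted homogeneous subspace of $A^*$ is a pair $(\mathcal S(A^* ),\|\cdot\|_{\mathcal S})$,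 with $\mathcal S(A^* )$ a linear subspace of $A^*$ and $\|\cdot\|_{\mathcal S}$ a complete operator space matrix norm on it, such that (i) $\mathcal S(A^* )\hookrightarrow A^*$ is a complete contraction; (ii) $\mathcal S(A^* )$ is a right $A$-submodule of $A^*$ and $(\phi,a)\mapsto\phi\cdot a$, $\mathcal S(A^* )\times A\to\mathcal S(A^* )$, is c.c. for $\|\cdot\|_{\mathcal S}$; (iii) for $\mu\in\mathcal S(A^* )^*$ (operator space dual for $\|\cdot\|_{\mathcal S}$) and $\phi\in\mathcal S(A^* )$, the functional $\mu\,\square\,\phi\in A^*$ given by $\langle\mu\,\square\,\phi,a\rangle=\langle\mu,\phi\cdot a\rangle$ lies in $\mathcal S(A^* )$, and $(\mu,\phi)\mapsto\mu\,\square\,\phi$, $\mathcal S(A^* )^*\times\mathcal S(A^* )\to\mathcal S(A^* )$, is c.c. with respect to $\|\cdot\|_{\mathcal S}$. *)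

(* Defs.v *)
From HB Require Import structures.
From mathcomp Require Import all_boot all_order all_algebra.
From mathcomp Require Import complex mxtens.
From mathcomp Require Import all_classical all_reals all_analysis.

Set Implicit Arguments.
Unset Strict Implicit.
Unset Printing Implicit Defensive.

Import Order.TTheory GRing.Theory Num.Theory.
Import numFieldNormedType.Exports.

Local Open Scope classical_set_scope.
Local Open Scope ring_scope.

(* Euclidean norm on R[i]^n and the operator norm of a complex matrix, i.e.
   the norm of M_{m,n} = B(C^n, C^m), over the complex field R[i]. *)
Definition l2norm (R : realType) n (v : 'cV[R[i]]_n) : R :=
  Num.sqrt (\sum_i Normc.normc (v i 0) ^+ 2).

Definition opnorm (R : realType) m n (a : 'M[R[i]]_(m, n)) : R :=
  sup [set l2norm (a *m v) | v in [set v | l2norm v <= 1]].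

(* The product of a scalar matrix, a vector-valued matrix and a scalar
   matrix. *)
Definition bimulmx (R : realType) (V : lmodType R[i]) m n p q
    (a : 'M[R[i]]_(m, n)) (x : 'M[V]_(n, p)) (b : 'M[R[i]]_(p, q)) :
    'M[V]_(m, q) :=
  \matrix_(i, j) \sum_k \sum_l (a i k * b l j) *: x k l.

(* The rs x rs matrix [m(x_ij, y_kl)], rows (i,k) and columns (j,l). *)
Definition amplify (U V W : Type) (m : U -> V -> W) r s
    (x : 'M[U]_r) (y : 'M[V]_s) : 'M[W]_(r * s) :=
  \matrix_(i, j) m (x (mxtens_unindex i).1 (mxtens_unindex j).1)
                   (y (mxtens_unindex i).2 (mxtens_unindex j).2).

(* Every operator space below is carried by a linear subspace D of an ambient
   vector space V (possibly D = setT).  Its matrix norm is a function on all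
   matrices over V, of which only the values on M_n(D) are meaningful. *)
Definition matrix_norm (R : realType) (V : Type) := forall n, 'M[V]_n -> R.

Definition Mn (V : Type) (D : set V) n : set 'M[V]_n :=
  [set x | forall i j, D (x i j)].

Definition linear_subspace (R : realType) (V : lmodType R[i]) (D : set V) :=
  D 0 /\ forall (c : R[i]) x y, D x -> D y -> D (c *: x + y).

Definition linear_on (R : realType) (V W : lmodType R[i]) (D : set V)
    (f : V -> W) :=
  forall (c : R[i]) x y, D x -> D y -> f (c *: x + y) = c *: f x + f y.

Definition bilinear_on (R : realType) (U V W : lmodType R[i])
    (D : set U) (E : set V) (m : U -> V -> W) :=
  (forall y, E y -> linear_on D (m ^~ y)) /\
  (forall x, D x -> linear_on E (m x)).

(* const_mx embeds V into M_1(V). *)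
Definition cauchy_in (R : realType) (V : lmodType R[i]) (D : set V)
    (N : matrix_norm R V) : set (nat -> V) :=
  [set u | (forall k, D (u k)) /\
    forall e, 0 < e -> exists k0, forall k l, (k0 <= k)%N -> (k0 <= l)%N ->
      N 1 (const_mx (u k - u l)) < e].

(* Complete abstract operator spaces: matrix norms satisfying Ruan's axioms. *)
Record operator_space (R : realType) (V : lmodType R[i]) (D : set V)
    (N : matrix_norm R V) : Prop := OperatorSpace {
  os_subspace : linear_subspace D;
  os_ge0 : forall n (x : 'M[V]_n), Mn D x -> 0 <= N n x;
  os_definite : forall n (x : 'M[V]_n), Mn D x -> N n x = 0 -> x = 0;
  os_homogeneous : forall n (c : R[i]) (x : 'M[V]_n), Mn D x ->
    N n (map_mx (fun v => c *: v) x) = Normc.normc c * N n x;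
  os_triangle : forall n (x y : 'M[V]_n), Mn D x -> Mn D y ->
    N n (x + y) <= N n x + N n y;
  os_direct_sum : forall m n (x : 'M[V]_m) (y : 'M[V]_n), Mn D x -> Mn D y ->
    N (m + n)%N (block_mx x 0 0 y) = Num.max (N m x) (N n y);
  os_bimodule : forall m n (a : 'M[R[i]]_(m, n)) (x : 'M[V]_n)
      (b : 'M[R[i]]_(n, m)), Mn D x ->
    N m (bimulmx a x b) <= opnorm a * N n x * opnorm b;
  os_complete : forall u, cauchy_in D N u ->
    exists2 l, D l & (fun k => N 1 (const_mx (u k - l))) @ \oo --> (0 : R) }.

Definition complete_contraction (R : realType) (U V : lmodType R[i])
    (D : set U) (ND : matrix_norm R U) (E : set V) (NE : matrix_norm R V)
    (f : U -> V) :=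
  [/\ forall x, D x -> E (f x), linear_on D f &
      forall n (x : 'M[U]_n), Mn D x -> NE n (map_mx f x) <= ND n x].

Definition cc_bilinear (R : realType) (U V W : lmodType R[i])
    (D : set U) (ND : matrix_norm R U) (E : set V) (NE : matrix_norm R V)
    (F : set W) (NF : matrix_norm R W) (m : U -> V -> W) :=
  [/\ forall x y, D x -> E y -> F (m x y), bilinear_on D E m &
      forall r s (x : 'M[U]_r) (y : 'M[V]_s), Mn D x -> Mn E y ->
        NF (r * s)%N (amplify m x y) <= ND r x * NE s y].

(* The dual of (D, N): bounded linear functionals on D.  A functional on D is
   represented by its extension by 0 to V, so that equality of functionals is
   equality of functions; for D = setT the last clause is void. *)
Definition dual (R : realType) (V : lmodType R[i]) (D : set V)
    (N : matrix_norm R V) : set (V -> R[i]^o) :=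
  [set f | [/\ linear_on D f,
    exists M : R, forall x, D x ->
      Normc.normc (f x) <= M * N 1 (const_mx x) &
    forall x, ~ D x -> f x = 0]].

(* M_n(D^* ) is normed as the completely bounded maps D -> M_n. *)
Definition dual_norm (R : realType) (V : lmodType R[i]) (D : set V)
    (N : matrix_norm R V) : matrix_norm R (V -> R[i]^o) := fun n f =>
  sup [set t | exists r (x : 'M[V]_r), [/\ Mn D x, N r x <= 1 &
    t = opnorm (amplify (fun (g : V -> R[i]^o) v => g v : R[i]) f x)]].

(* The algebraic tensor product of D and E, realized in the algebraic dual of
   the space of bilinear forms on D x E: the elementary tensor x (x) y is the
   evaluation B |-> B x y.  (Functions B which are not bilinear on D x E are
   ignored, i.e. sent to 0.) *)
Definition tensor_ambient (R : realType) (U V : lmodType R[i]) : lmodType R[i] :=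
  (U -> V -> R[i]^o) -> R[i]^o.

Definition elementary_tensor (R : realType) (U V : lmodType R[i])
    (D : set U) (E : set V) (x : U) (y : V) : tensor_ambient U V :=
  fun B => if `[< bilinear_on D E B >] then B x y else 0.

Definition alg_tensor (R : realType) (U V : lmodType R[i])
    (D : set U) (E : set V) : set (tensor_ambient U V) :=
  [set u | exists n (x : 'I_n -> U) (y : 'I_n -> V),
    [/\ forall i, D (x i), forall i, E (y i) &
        u = \sum_(i < n) elementary_tensor D E (x i) (y i)]].

(* The norm || . ||_wedge on M_n of the algebraic tensor product: the infimum
   of |a| |v| |w| |b| over the representations u = a (v (x) w) b. *)
Definition alg_proj_norm (R : realType) (U V : lmodType R[i])
    (D : set U) (ND : matrix_norm R U) (E : set V) (NE : matrix_norm R V) :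
    matrix_norm R (tensor_ambient U V) := fun n u =>
  inf [set t | exists p q (a : 'M[R[i]]_(n, p * q)) (v : 'M[U]_p)
      (w : 'M[V]_q) (b : 'M[R[i]]_(p * q, n)),
    [/\ Mn D v, Mn E w,
        u = bimulmx a (amplify (elementary_tensor D E) v w) b &
        t = opnorm a * ND p v * NE q w * opnorm b]].

(* The completion.  Its elements are given by Cauchy sequences, and the norm of
   a matrix of these is the limit of the norms.  Null sequences are not
   quotiented out: they have norm 0, and nothing below distinguishes Cauchy
   sequences with the same limit. *)
Definition proj_tensor (R : realType) (U V : lmodType R[i])
    (D : set U) (ND : matrix_norm R U) (E : set V) (NE : matrix_norm R V) :
    set (nat -> tensor_ambient U V) :=
  cauchy_in (alg_tensor D E) (alg_proj_norm D ND E NE).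

Definition proj_norm (R : realType) (U V : lmodType R[i])
    (D : set U) (ND : matrix_norm R U) (E : set V) (NE : matrix_norm R V) :
    matrix_norm R (nat -> tensor_ambient U V) := fun n xi =>
  lim ((fun k => alg_proj_norm D ND E NE
                   (map_mx (fun u : nat -> tensor_ambient U V => u k) xi))
       @ \oo).

Definition cc_banach_algebra (R : realType) (A : lmodType R[i])
    (NA : matrix_norm R A) (mul : A -> A -> A) :=
  [/\ operator_space setT NA, associative mul &
      cc_bilinear setT NA setT NA setT NA mul].

Definition cc_right_module (R : realType) (A X : lmodType R[i])
    (NA : matrix_norm R A) (mul : A -> A -> A)
    (NX : matrix_norm R X) (Q : X -> A -> X) :=
  [/\ operator_space setT NX, forall x a b, Q (Q x a) b = Q x (mul a b) &
      cc_bilinear setT NX setT NA setT NX Q].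

Definition fun_act (K A : Type) (mul : A -> A -> A) (phi : A -> K) (a : A) :
    A -> K :=
  fun b => phi (mul a b).

Definition intro_prod (K A : Type) (mul : A -> A -> A) (mu : (A -> K) -> K)
    (phi : A -> K) : A -> K :=
  fun a => mu (fun_act mul phi a).

Record left_introverted_homogeneous (R : realType) (A : lmodType R[i])
    (NA : matrix_norm R A) (mul : A -> A -> A)
    (S : set (A -> R[i]^o)) (NS : matrix_norm R (A -> R[i]^o)) : Prop :=
  LeftIntrovertedHomogeneous {
  lih_sub : S `<=` dual setT NA;
  lih_operator_space : operator_space S NS;
  lih_inclusion :
    complete_contraction S NS (dual setT NA) (dual_norm setT NA) id;
  lih_action : cc_bilinear S NS setT NA S NS (fun_act mul);
  lih_introverted :
    cc_bilinear (dual S NS) (dual_norm S NS) S NS S NS (intro_prod mul) }.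

(* P on the algebraic tensor product is evaluation at the bilinear form
   (x^*, x) |-> <x^*, x . a>, whence P(x^* (x) x) = x^* . x ; it is extended by
   continuity to the completion (limits in A^* being in particular pointwise). *)
Definition fourier_map (R : realType) (A X : lmodType R[i]) (Q : X -> A -> X)
    (xi : nat -> tensor_ambient (X -> R[i]^o) X) : A -> R[i]^o :=
  fun a => lim ((fun k => xi k (fun f x => f (Q x a))) @ \oo).

Definition fourier_space (R : realType) (A X : lmodType R[i])
    (NX : matrix_norm R X) (Q : X -> A -> X) : set (A -> R[i]^o) :=
  fourier_map Q @`
    proj_tensor (dual setT NX) (dual_norm setT NX) setT NX.

Definition fourier_norm (R : realType) (A X : lmodType R[i])
    (NX : matrix_norm R X) (Q : X -> A -> X) : matrix_norm R (A -> R[i]^o) :=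
  fun n phi =>
  let PT := proj_tensor (dual setT NX) (dual_norm setT NX) setT NX in
  let PN := proj_norm (dual setT NX) (dual_norm setT NX) setT NX in
  inf [set t | exists xi : 'M[nat -> tensor_ambient (X -> R[i]^o) X]_n,
    [/\ Mn PT xi, map_mx (fourier_map Q) xi = phi & t = PN n xi]].

(* Main.v *)
(* The norm of the projective tensor product X^* (x) X and of its completion
   satisfies the bimodule and direct sum inequalities of Ruan, and these pass to
   the quotient by ker P, so that F_Q(A^* ) is an operator space; it is complete
   because Cauchy sequences lift along absolutely convergent series.

   Both module structures lift to X^* (x) X: on elementary tensors
   (x^* . x) . a = x^* . (x . a) and mu [] (x^* . x) = (mu . x^* ) . x, where
   <mu . x^*, x> = <mu, x^* . x>.  Hence phi |-> phi . a and phi |-> mu [] phi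
   are induced by id (x) (- . a) and (mu . -) (x) id.  On a representation
   u = a (v (x) w) b these maps only replace w by [w_kl . a_ij], resp. v by
   [mu_ij . v_kl], whose norms are at most |w| |a|, resp. |mu| |v|, and tensor
   the scalar matrices a, b with an identity matrix; so they are c.c.  The
   inclusion in A^* is c.c. because <phi, a> is the trace of a lift of
   phi . a. *)
Require Import Defs.
From mathcomp Require Import all_boot all_order all_algebra.
From mathcomp Require Import complex mxtens ring lra.
From mathcomp Require Import all_classical all_reals all_analysis.

Set Implicit Arguments.
Unset Strict Implicit.
Unset Printing Implicit Defensive.

Import Order.TTheory GRing.Theory Num.Theory.
Import numFieldNormedType.Exports.

Local Open Scope classical_set_scope.
Local Open Scope ring_scope.

Local Notation normc := Normc.normc.

(** The obstacle is the direct sum inequality for the projective norm. The tensor product of two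
    block diagonal matrices also contains mixed blocks, and two given representations may distribute
    their norms differently over their factors. Hence representations are taken along a selected
    part of the Kronecker index set, with contractive vector factors and the weight split evenly
    between the two scalar matrices. To make such index sets cheap, scalar matrices are functions on
    finite types with an explicit bound in place of [opnorm]. Norms are infima and may vanish on
    nonzero elements before the quotient, so estimates are made with numbers strictly above the
    norms, which are positive and can be divided by, and then pass to the infimum. Definiteness
    appears only on the image, where evaluation at each point is bounded. A functional [mu] on the
    Fourier space is continuous for the Fourier norm only, while elements of that space are given as
    pointwise limits. Moving [mu] across the limit uses that images of algebraic tensors are dense
    for the Fourier norm. *)

Lemma sum_pair (V : nmodType) (I J : finType) (F : I * J -> V) :
  \sum_p F p = \sum_i \sum_j F (i, j).
Proof. by rewrite pair_bigA; apply: eq_bigr => -[]. Qed.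

(** * Operator norms of scalar matrices *)

Section ComplexModulus.
Variable R : realType.
Implicit Types (x y : R[i]) (s t : R).

Lemma normc_ge0 x : 0 <= normc x.
Proof. by case: x => a b; rewrite sqrtr_ge0. Qed.

Lemma normc_real s : normc s%:C%C = `|s|.
Proof. by rewrite /= expr0n /= addr0 sqrtr_sqr. Qed.

Lemma normc_conj x : normc (x^*)%C = normc x.
Proof. by case: x => a b; rewrite /= sqrrN. Qed.

Lemma mulC_conj x : (x^* * x)%C = ((normc x ^+ 2)%:C)%C.
Proof.
case: x => a b /=; rewrite sqr_sqrtr ?addr_ge0 ?sqr_ge0 //.
by simpc; congr (_ +i* _)%C; ring.
Qed.

Lemma normc_sum (I : Type) (r : seq I) (P : pred I) (F : I -> R[i]) :
  normc (\sum_(i <- r | P i) F i) <= \sum_(i <- r | P i) normc (F i).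
Proof.
apply: (big_ind2 (fun x s => normc x <= s)) => //; first by rewrite Normc.normc0.
by move=> x s y t xs yt; apply: le_trans (le_normcD _ _) (lerD xs yt).
Qed.

Lemma normcB x y : normc (x - y) = normc (y - x).
Proof. by rewrite -normcN opprB. Qed.

(* Weighted AM-GM: the cross term [2 s t |x||y|] is at most
   [t^2 |x|^2 + s^2 |y|^2]. *)
Lemma sqr_normcD x y s t : 0 < s -> 0 < t ->
  normc (x + y) ^+ 2 <=
    (s ^+ 2 + t ^+ 2) * (normc x ^+ 2 / s ^+ 2 + normc y ^+ 2 / t ^+ 2).
Proof.
move=> s0 t0; have s20 : 0 < s ^+ 2 by rewrite exprn_gt0.
have t20 : 0 < t ^+ 2 by rewrite exprn_gt0.
apply: (@le_trans _ _ ((normc x + normc y) ^+ 2)).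
  by rewrite ler_pXn2r ?nnegrE ?addr_ge0 ?normc_ge0 ?le_normcD.
rewrite -subr_ge0.
have -> : (s ^+ 2 + t ^+ 2) * (normc x ^+ 2 / s ^+ 2 + normc y ^+ 2 / t ^+ 2)
  - (normc x + normc y) ^+ 2 = (t / s * normc x - s / t * normc y) ^+ 2.
  by field; rewrite !gt_eqF.
exact: sqr_ge0.
Qed.

End ComplexModulus.

(** * Euclidean norms over finite index types *)

Section SquareNorm.
Variable R : realType.
Local Notation C := R[i].

(** Any finite index type is allowed, so that products and disjoint sums of index sets need no
    ordinal arithmetic; the square makes it additive over disjoint parts. *)
Definition sqnorm (J : finType) (v : J -> C) : R := \sum_j normc (v j) ^+ 2.

Lemma sqnorm_ge0 (J : finType) (v : J -> C) : 0 <= sqnorm v.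
Proof. by apply: sumr_ge0 => j _; rewrite sqr_ge0. Qed.

Lemma sqnormZ (J : finType) (c : C) (v : J -> C) :
  sqnorm (fun j => c * v j) = normc c ^+ 2 * sqnorm v.
Proof.
by rewrite mulr_sumr; apply: eq_bigr => j _; rewrite Normc.normcM exprMn.
Qed.

Lemma le_sqnorm (J : finType) (v : J -> C) j : normc (v j) ^+ 2 <= sqnorm v.
Proof.
by rewrite /sqnorm (bigD1 j) //= lerDl; apply: sumr_ge0 => k _; rewrite sqr_ge0.
Qed.

Lemma sqnorm_eq0 (J : finType) (v : J -> C) : sqnorm v = 0 -> v = fun=> 0.
Proof.
move=> v0; apply/funext => j; apply: Normc.eq0_normc; apply/eqP.
by rewrite -sqrf_eq0 eq_le sqr_ge0 -v0 le_sqnorm.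
Qed.

Lemma sqnorm_pair (I J : finType) (v : I * J -> C) :
  sqnorm v = \sum_j sqnorm (fun i => v (i, j)).
Proof.
by rewrite exchange_big pair_big; apply: eq_bigr => -[i j].
Qed.

Lemma sqnorm_split m n (v : 'I_(m + n) -> C) :
  sqnorm v = sqnorm (fun i => v (lshift n i)) + sqnorm (fun i => v (rshift m i)).
Proof. exact: big_split_ord. Qed.

(** The weights are those of the row operator [(s I, t I)]: for [v = s v'] and [w = t w'] the last
    factor becomes the squared norm of the pair [(v', w')]. *)
Lemma sqnormD (J : finType) (v w : J -> C) s t : 0 < s -> 0 < t ->
  sqnorm (fun j => v j + w j) <=
    (s ^+ 2 + t ^+ 2) * (sqnorm v / s ^+ 2 + sqnorm w / t ^+ 2).
Proof.
move=> s0 t0; rewrite !mulr_suml -big_split mulr_sumr.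
by apply: ler_sum => j _; exact: sqr_normcD.
Qed.

Lemma cauchy_schwarz (J : finType) (v w : J -> C) :
  normc (\sum_j v j * w j) ^+ 2 <= sqnorm v * sqnorm w.
Proof.
have [v0|] := eqVneq (sqnorm v) 0.
  rewrite v0 mul0r (sqnorm_eq0 v0) big1 => [|j _]; last by rewrite mul0r.
  by rewrite Normc.normc0 expr0n.
have [w0|] := eqVneq (sqnorm w) 0.
  rewrite w0 mulr0 (sqnorm_eq0 w0) big1 => [|j _]; last by rewrite mulr0.
  by rewrite Normc.normc0 expr0n.
rewrite !neq_lt !ltNge !sqnorm_ge0 /= -!ltNge => w0 v0.
set a := Num.sqrt (sqnorm v); set b := Num.sqrt (sqnorm w).
have a0 : 0 < a by rewrite sqrtr_gt0.
have b0 : 0 < b by rewrite sqrtr_gt0.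
have aE : sqnorm v = a ^+ 2 by rewrite sqr_sqrtr ?ltW.
have bE : sqnorm w = b ^+ 2 by rewrite sqr_sqrtr ?ltW.
rewrite aE bE -exprMn ler_pXn2r ?nnegrE ?normc_ge0 //; last first.
  by rewrite mulr_ge0 ?ltW.
apply: le_trans (normc_sum _ _ _) _.
(* AM-GM in each term; the weights [b / a] and [a / b] make each half sum to [a * b / 2]. *)
apply: (@le_trans _ _ (\sum_j (normc (v j) ^+ 2 * (b / a / 2)
   + normc (w j) ^+ 2 * (a / b / 2)))).
  apply: ler_sum => j _; rewrite Normc.normcM -subr_ge0.
  set x := normc _; set y := normc _.
  have -> : x ^+ 2 * (b / a / 2) + y ^+ 2 * (a / b / 2) - x * y =
    (b * x - a * y) ^+ 2 / (2 * a * b) by field; rewrite !gt_eqF.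
  by rewrite divr_ge0 ?sqr_ge0 // !mulr_ge0 ?ltW.
rewrite big_split /= -!mulr_suml -!/(sqnorm _) aE bE.
by rewrite le_eqVlt; apply/orP; left; apply/eqP; field; rewrite !gt_eqF.
Qed.

End SquareNorm.

(** * Bounds for scalar matrices *)

Section OperatorBound.
Variable R : realType.
Local Notation C := R[i].

(** For [c >= 0] this says that the operator norm of [a] is at most [c]. Only [c ^+ 2] occurs, so
    the sign of [c] has to be controlled separately. *)
Definition op_bound (I J : finType) (c : R) (a : I -> J -> C) :=
  forall v : J -> C, sqnorm (fun i => \sum_j a i j * v j) <= c ^+ 2 * sqnorm v.

Lemma op_bound_le (I J : finType) c d (a : I -> J -> C) :
  0 <= c -> c <= d -> op_bound c a -> op_bound d a.
Proof.
move=> c0 cd ca v; apply: le_trans (ca v) _.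
by rewrite ler_wpM2r ?sqnorm_ge0 ?ler_pXn2r ?nnegrE // (le_trans c0).
Qed.

Lemma op_bound_eq (I J : finType) c (a b : I -> J -> C) :
  a =2 b -> op_bound c a -> op_bound c b.
Proof.
move=> ab ca v; have -> : b = a by do 2!apply/funext => ?; rewrite ab.
exact: ca.
Qed.

(** The norms below are infima that need not be attained, so bounds are obtained for every larger
    constant and then closed up. *)
Lemma op_bound_inf (I J : finType) c (a : I -> J -> C) : 0 <= c ->
  (forall d, c < d -> op_bound d a) -> op_bound c a.
Proof.
move=> c0 ca v; set s := sqnorm _; set t := sqnorm v.
have t0 : 0 <= t by exact: sqnorm_ge0.
rewrite leNgt; apply/negP => ltcs.
(* Since [e <= 1], replacing [c] by [c + e] costs at most [e * (2 * c + 1) * t]; dividing by [t + 1]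
   keeps this strictly below the assumed gap, also when [t = 0]. *)
pose e := Num.min 1 ((s - c ^+ 2 * t) / ((2 * c + 1) * (t + 1))).
have e0 : 0 < e.
  rewrite lt_min ltr01 divr_gt0 ?subr_gt0 // mulr_gt0 //; lra.
have e1 : e <= 1 by rewrite ge_min lexx.
have : s <= (c + e) ^+ 2 * t by apply: ca; rewrite ltrDl.
have h : e * ((2 * c + 1) * (t + 1)) <= s - c ^+ 2 * t.
  rewrite -ler_pdivlMr ?ge_min ?lexx ?orbT // mulr_gt0 //; lra.
apply/negP; rewrite -ltNge.
have h2 : (c + e) ^+ 2 * t <= c ^+ 2 * t + e * (2 * c + 1) * t.
  rewrite -mulrDl ler_wpM2r // sqrrD; nra.
apply: le_lt_trans h2 _; have : 0 < e * (2 * c + 1) by rewrite mulr_gt0 //; lra.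
move: h; rewrite mulrA mulrDr mulr1; lra.
Qed.

Lemma op_bound_comp (I J K : finType) c d (a : I -> J -> C) (b : J -> K -> C) :
  op_bound c a -> op_bound d b ->
  op_bound (c * d) (fun i k => \sum_j a i j * b j k).
Proof.
move=> ca db v.
have -> : (fun i => \sum_k (\sum_j a i j * b j k) * v k) =
  (fun i => \sum_j a i j * \sum_k b j k * v k).
  apply/funext => i; under eq_bigr do rewrite mulr_suml.
  rewrite exchange_big; apply: eq_bigr => j _; rewrite mulr_sumr.
  by apply: eq_bigr => k _; rewrite mulrA.
apply: le_trans (ca _) _.
by rewrite exprMn -[leRHS]mulrA ler_wpM2l ?sqr_ge0 ?db.
Qed.

Lemma op_bound_scale (I J : finType) c (z : C) (a : I -> J -> C) :
  op_bound c a -> op_bound (normc z * c) (fun i j => z * a i j).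
Proof.
move=> ca v; under eq_fun do under eq_bigr do rewrite -mulrA.
under eq_fun do rewrite -mulr_sumr.
by rewrite sqnormZ exprMn -[leRHS]mulrA ler_wpM2l ?sqr_ge0 ?ca.
Qed.

(** This matrix is [a] tensored with the identity of [K]: it acts by [a] on each slice of [v] with
    fixed second index, and squared norms add up over the slices. *)
Lemma op_bound_tens1 (I J K : finType) c (a : I -> J -> C) : op_bound c a ->
  op_bound c (fun (i : I * K) (j : J * K) =>
    if i.2 == j.2 then a i.1 j.1 else 0).
Proof.
move=> ca v; rewrite !sqnorm_pair mulr_sumr; apply: ler_sum => k _.
suff -> : (fun i : I => \sum_j
    (if (i, k).2 == j.2 then a (i, k).1 j.1 else 0) * v j) =
  (fun i => \sum_j a i j * v (j, k)) by exact: ca.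
apply/funext => i /=.
transitivity (\sum_(j : J) \sum_(l : K) (if k == l then a i j else 0) * v (j, l)).
  by rewrite pair_bigA; apply: eq_bigr => -[].
apply: eq_bigr => j _; rewrite (bigD1 k) //= eqxx big1 ?addr0 // => l lk.
by rewrite eq_sym (negbTE lk) mul0r.
Qed.

Definition dsum_fun (I J K L : Type) (a : I -> K -> C) (b : J -> L -> C)
    (i : I + J) (k : K + L) : C :=
  match i, k with inl i, inl k => a i k | inr j, inr l => b j l | _, _ => 0 end.

Lemma op_bound_dsum (I J K L : finType) c (a : I -> K -> C) (b : J -> L -> C) :
  op_bound c a -> op_bound c b -> op_bound c (dsum_fun a b).
Proof.
have sqsum (P Q : finType) (v : P + Q -> C) :
    sqnorm v = sqnorm (v \o inl) + sqnorm (v \o inr) by exact: big_sumType.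
move=> ca cb v; rewrite !sqsum mulrDr; apply: lerD.
  apply: le_trans (ca _); rewrite le_eqVlt; apply/orP; left; apply/eqP.
  congr sqnorm; apply/funext => i /=; rewrite big_sumType /=.
  by rewrite [X in _ + X]big1 ?addr0 // => l _; rewrite mul0r.
apply: le_trans (cb _); rewrite le_eqVlt; apply/orP; left; apply/eqP.
congr sqnorm; apply/funext => i /=; rewrite big_sumType /=.
by rewrite big1 ?add0r // => l _; rewrite mul0r.
Qed.

(** The matrix of [v |-> v \o g]; an injective [g] picks each coordinate at most once. *)
Lemma op_bound_inj (I J : finType) (g : I -> J) : injective g ->
  op_bound 1 (fun i j => if g i == j then 1 else 0).
Proof.
move=> ig v; rewrite expr1n mul1r.
have -> : (fun i => \sum_j (if g i == j then 1 else 0) * v j) = v \o g.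
  apply/funext => i; rewrite (bigD1 (g i)) //= eqxx mul1r big1 ?addr0 // => j.
  by rewrite eq_sym => /negbTE ->; rewrite mul0r.
have -> : sqnorm (v \o g) = \sum_(j in codom g) normc (v j) ^+ 2.
  rewrite -big_uniq /=; last by rewrite map_inj_uniq ?enum_uniq.
  by rewrite big_image.
by rewrite [leRHS](bigID (mem (codom g))) /= lerDl sumr_ge0 // => j _; rewrite sqr_ge0.
Qed.

(** The transpose of the previous matrix: it extends [v] by zero outside the image of [g]. *)
Lemma op_bound_coinj (I J : finType) (g : I -> J) : injective g ->
  op_bound 1 (fun j i => if g i == j then 1 else 0).
Proof.
move=> ig v; rewrite expr1n mul1r; set w := fun j => _.
have wg i : w (g i) = v i.
  rewrite /w (bigD1 i) //= eqxx mul1r big1 ?addr0 // => k ki.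
  by rewrite (inj_eq ig) (negbTE ki) mul0r.
rewrite /sqnorm (bigID (mem (codom g))) /= [X in _ + X]big1 ?addr0.
  rewrite -big_uniq /=; last by rewrite map_inj_uniq ?enum_uniq.
  by rewrite big_image /=; apply: ler_sum => i _; rewrite wg.
move=> j jg; rewrite /w big1 ?Normc.normc0 ?expr0n // => i _.
by case: eqP => [e|_]; [rewrite -e codom_f in jg|rewrite mul0r].
Qed.

(** The reindexed matrix is [a] compressed by the 0/1 matrices of [f] and [g]; this covers
    submatrices as well as permutations of the indices. *)
Lemma op_bound_reindex (I J I' J' : finType) (f : I' -> I) (g : J' -> J) c
    (a : I -> J -> C) : injective f -> injective g -> op_bound c a ->
  op_bound c (fun i j => a (f i) (g j)).
Proof.
move=> jf jg ca; rewrite -[c]mulr1 -[c]mul1r.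
apply: op_bound_eq (op_bound_comp (op_bound_comp (op_bound_inj jf) ca)
  (op_bound_coinj jg)) => i j.
rewrite (bigD1 (g j)) //= eqxx mulr1 [X in _ + X]big1 ?addr0 => [|l lj].
  rewrite (bigD1 (f i)) //= eqxx mul1r big1 ?addr0 // => k kj.
  by rewrite eq_sym (negbTE kj) mul0r.
by rewrite eq_sym (negbTE lj) mulr0.
Qed.

Lemma op_bound_id (I : finType) :
  op_bound 1 (fun i j : I => if i == j then 1 else 0).
Proof.
move=> v; rewrite expr1n mul1r; under eq_fun => i.
  rewrite (bigD1 i) //= eqxx mul1r big1 ?addr0; first over.
  by move=> j ji; rewrite eq_sym (negbTE ji) mul0r.
exact: lexx.
Qed.

Lemma op_bound_normc_entry (I J : finType) c (a : I -> J -> C) i j :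
  0 <= c -> op_bound c a -> normc (a i j) <= c.
Proof.
move=> c0 /(_ (fun k => if k == j then 1 else 0)).
have -> : sqnorm (fun k => if k == j then 1 else 0 : C) = 1.
  rewrite /sqnorm (bigD1 j) //= eqxx Normc.normc1 expr1n big1 ?addr0 //.
  by move=> k /negbTE ->; rewrite Normc.normc0 expr0n.
rewrite mulr1 => h; rewrite -(@ler_pXn2r _ 2) ?nnegrE ?normc_ge0 //.
apply: le_trans h; apply: le_trans (le_sqnorm _ i).
rewrite (bigD1 j) //= eqxx mulr1 big1 ?addr0 // => k /negbTE ->.
by rewrite mulr0.
Qed.

(** With [w = a v], test against the normalized conjugate of [w] and against [v / |v|]: the bilinear
    form then takes the value [|w| / |v|]. The cases where a norm is 0 are split off first. *)
Lemma op_bound_rank1 (I J : finType) c (a : I -> J -> C) : 0 <= c ->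
  (forall (eta : I -> C) (v : J -> C), sqnorm eta <= 1 -> sqnorm v <= 1 ->
    normc (\sum_i \sum_j eta i * v j * a i j) <= c) -> op_bound c a.
Proof.
move=> c0 h v; set w := fun i => _.
have [->|] := eqVneq (sqnorm w) 0; first by rewrite mulr_ge0 ?sqr_ge0 ?sqnorm_ge0.
rewrite neq_lt ltNge sqnorm_ge0 /= => w0.
have [v0|] := eqVneq (sqnorm v) 0.
  move: w0; suff -> : w = fun=> 0.
    by rewrite /sqnorm big1 ?ltxx // => i _; rewrite Normc.normc0 expr0n.
  apply/funext => i; rewrite /w (sqnorm_eq0 v0) big1 // => j _.
  by rewrite mulr0.
rewrite neq_lt ltNge sqnorm_ge0 /= => v0.
pose s := Num.sqrt (sqnorm w); pose t := Num.sqrt (sqnorm v).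
have s0 : 0 < s by rewrite sqrtr_gt0.
have t0 : 0 < t by rewrite sqrtr_gt0.
have sE : sqnorm w = s ^+ 2 by rewrite sqr_sqrtr ?ltW.
have tE : sqnorm v = t ^+ 2 by rewrite sqr_sqrtr ?ltW.
have normV (r : R) : 0 < r -> normc (r^-1)%:C%C ^+ 2 * r ^+ 2 = 1.
  move=> r0; rewrite normc_real ger0_norm ?invr_ge0 ?ltW //.
  by rewrite -exprMn mulVf ?gt_eqF // expr1n.
have := h (fun i => (s^-1)%:C%C * (w i)^*%C) (fun j => (t^-1)%:C%C * v j).
rewrite !sqnormZ tE.
have -> : sqnorm (fun i => (w i)^*%C) = s ^+ 2.
  by rewrite -sE; apply: eq_bigr => i _; rewrite normc_conj.
rewrite !normV // => /(_ (lexx _) (lexx _)).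
have -> : \sum_i \sum_j (s^-1)%:C%C * (w i)^*%C * ((t^-1)%:C%C * v j) * a i j =
  (s / t)%:C%C.
  have -> : s / t = s^-1 * t^-1 * s ^+ 2 by field; rewrite !gt_eqF.
  transitivity ((s^-1)%:C%C * (t^-1)%:C%C * \sum_i (w i)^*%C * w i).
    rewrite mulr_sumr; apply: eq_bigr => i _; rewrite /w !mulr_sumr.
    by apply: eq_bigr => j _; ring.
  rewrite -sE /sqnorm !rmorphM /= rmorph_sum; congr (_ * _).
  by apply: eq_bigr => i _; exact: mulC_conj.
rewrite normc_real ger0_norm ?divr_ge0 ?(ltW s0) ?(ltW t0) //.
rewrite ler_pdivrMr // sE -exprMn => h'.
by rewrite ler_pXn2r ?nnegrE ?mulr_ge0 // ltW.
Qed.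

End OperatorBound.

(** * Comparison with [opnorm], and the scalar matrices used later *)

Section OperatorNorm.
Variable R : realType.
Local Notation C := R[i].

Lemma l2normE n (v : 'cV[C]_n) : l2norm v = Num.sqrt (sqnorm (v ^~ 0)).
Proof. by []. Qed.

Lemma l2norm_mul m n (a : 'M[C]_(m, n)) (v : 'cV[C]_n) :
  l2norm (a *m v) = Num.sqrt (sqnorm (fun i => \sum_j a i j * v j 0)).
Proof.
by rewrite l2normE; congr (Num.sqrt (sqnorm _)); apply/funext => i; rewrite mxE.
Qed.

(** The Hilbert-Schmidt norm works, by the Cauchy-Schwarz inequality in each row; this makes the
    supremum defining [opnorm] finite. *)
Lemma op_bound_exists (I J : finType) (a : I -> J -> C) :
  exists2 c, 0 <= c & op_bound c a.
Proof.
exists (Num.sqrt (\sum_i sqnorm (a i))); first exact: sqrtr_ge0.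
move=> v; rewrite sqr_sqrtr; last by apply: sumr_ge0 => i _; exact: sqnorm_ge0.
by rewrite mulr_suml; apply: ler_sum => i _; exact: cauchy_schwarz.
Qed.

Lemma op_bound_image m n (a : 'M[C]_(m, n)) c : 0 <= c -> op_bound c a ->
  ubound [set l2norm (a *m v) | v in [set v | l2norm v <= 1]] c.
Proof.
move=> c0 ca _ [v /= v1 <-]; rewrite l2norm_mul.
rewrite -(ger0_norm c0) -sqrtr_sqr ler_sqrt ?sqr_ge0 //.
apply: le_trans (ca _) _; rewrite ler_piMr ?sqr_ge0 //.
by rewrite -(@ler_sqrt _ _ 1) // sqrtr1.
Qed.

Lemma op_image_nonempty m n (a : 'M[C]_(m, n)) :
  [set l2norm (a *m v) | v in [set v | l2norm v <= 1]] 0.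
Proof.
have l20 k : l2norm (0 : 'cV[C]_k) = 0.
  rewrite l2normE /sqnorm big1 ?sqrtr0 // => i _.
  by rewrite mxE Normc.normc0 expr0n.
by exists 0; rewrite /= ?mulmx0 l20.
Qed.

Lemma opnorm_le m n (a : 'M[C]_(m, n)) c : 0 <= c -> op_bound c a ->
  opnorm a <= c.
Proof.
move=> c0 ca; apply: ge_sup; last exact: op_bound_image.
by exists 0; exact: op_image_nonempty.
Qed.

Lemma opnorm_has_sup m n (a : 'M[C]_(m, n)) :
  has_sup [set l2norm (a *m v) | v in [set v | l2norm v <= 1]].
Proof.
split; first by exists 0; exact: op_image_nonempty.
by have [c c0 ca] := op_bound_exists a; exists c; exact: op_bound_image.
Qed.

Lemma opnorm_ge0 m n (a : 'M[C]_(m, n)) : 0 <= opnorm a.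
Proof.
apply: ub_le_sup; first exact: (opnorm_has_sup a).2.
exact: op_image_nonempty.
Qed.

(** Rescaling to the unit ball. With [opnorm_le] this makes [opnorm a] the least nonnegative
    constant bounding [a], so estimates can be made with [op_bound] alone. *)
Lemma op_bound_opnorm m n (a : 'M[C]_(m, n)) : op_bound (opnorm a) a.
Proof.
move=> v; have [v0|] := eqVneq (sqnorm v) 0.
  rewrite v0 mulr0 (sqnorm_eq0 v0) /sqnorm big1 // => i _.
  by rewrite big1 ?Normc.normc0 ?expr0n // => j _; rewrite mulr0.
rewrite neq_lt ltNge sqnorm_ge0 /= => v0.
pose s := Num.sqrt (sqnorm v); have s0 : 0 < s by rewrite sqrtr_gt0.
have sE : sqnorm v = s ^+ 2 by rewrite sqr_sqrtr ?ltW.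
pose w : 'cV[C]_n := \col_j ((s^-1)%:C%C * v j).
have wE : (w ^~ 0) = (fun j => (s^-1)%:C%C * v j).
  by apply/funext => j; rewrite mxE.
have nV : normc (s^-1)%:C%C ^+ 2 = (s ^+ 2)^-1.
  by rewrite normc_real ger0_norm ?invr_ge0 ?exprVn // ltW.
have w1 : l2norm w <= 1.
  by rewrite l2normE wE sqnormZ nV sE mulVf ?sqrtr1 // gt_eqF // exprn_gt0.
have : l2norm (a *m w) <= opnorm a.
  by apply: ub_le_sup; [exact: (opnorm_has_sup a).2|exists w].
rewrite l2norm_mul.
have -> : (fun i => \sum_j a i j * w j 0) =
    (fun i => (s^-1)%:C%C * \sum_j a i j * v j).
  apply/funext => i; rewrite mulr_sumr; apply: eq_bigr => j _.
  by rewrite mxE mulrCA.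
rewrite sqnormZ nV => h; rewrite sE -ler_pdivrMr ?exprn_gt0 // mulrC.
rewrite -(@ler_pXn2r _ 2) ?nnegrE ?sqrtr_ge0 ?opnorm_ge0 // in h.
by rewrite sqr_sqrtr ?mulr_ge0 ?invr_ge0 ?sqr_ge0 ?sqnorm_ge0 in h.
Qed.

Lemma op_bound_scalar n (c : C) : op_bound (normc c) (c%:M : 'M[C]_n).
Proof.
rewrite -[normc c]mulr1.
apply: op_bound_eq (op_bound_scale c (@op_bound_id R 'I_n)).
by move=> i j; rewrite mxE; case: eqP => _; rewrite ?mulr1 ?mulr0 ?mulr1n.
Qed.

Lemma op_bound_delta m n i j : op_bound 1 (delta_mx i j : 'M[C]_(m, n)).
Proof.
move=> v; rewrite expr1n mul1r /sqnorm (bigD1 i) //= [X in _ + X]big1 ?addr0.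
  rewrite (bigD1 j) //= mxE !eqxx mul1r big1 ?addr0 ?le_sqnorm // => k kj.
  by rewrite mxE (negbTE kj) andbF mul0r.
move=> k ki; rewrite big1 ?Normc.normc0 ?expr0n // => l _.
by rewrite mxE (negbTE ki) mul0r.
Qed.

Lemma sum_scalar_mx n (s : C) (v : 'I_n -> C) i :
  \sum_j s%:M i j * v j = s * v i.
Proof.
rewrite (bigD1 i) //= mxE eqxx mulr1n big1 ?addr0 // => j ji.
by rewrite mxE eq_sym (negbTE ji) mul0r.
Qed.

(** Used with its column counterpart: a direct sum between this row and that column becomes a
    weighted sum of its two blocks. *)
Lemma op_bound_row_scalar n (s t : R) : 0 < s -> 0 < t ->
  op_bound (Num.sqrt (s ^+ 2 + t ^+ 2))
    (row_mx (s%:C%C)%:M (t%:C%C)%:M : 'M[C]_(n, n + n)).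
Proof.
move=> s0 t0 v; rewrite sqr_sqrtr ?addr_ge0 ?sqr_ge0 // sqnorm_split.
have -> : (fun i => \sum_j row_mx (s%:C%C)%:M (t%:C%C)%:M i j * v j) =
  (fun i => s%:C%C * v (lshift n i) + t%:C%C * v (rshift n i)).
  apply/funext => i; rewrite big_split_ord /=.
  under eq_bigr do rewrite row_mxEl.
  under [in X in _ + X]eq_bigr do rewrite row_mxEr.
  by rewrite !(sum_scalar_mx _ (fun j => v _)).
apply: le_trans (sqnormD _ _ s0 t0) _; rewrite !sqnormZ !normc_real.
rewrite !real_normK ?num_real // ![_ ^+ 2 * _]mulrC !mulfK ?sqrf_eq0 ?gt_eqF //.
Qed.

Lemma op_bound_col_scalar n (s t : R) :
  op_bound (Num.sqrt (s ^+ 2 + t ^+ 2))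
    (col_mx (s%:C%C)%:M (t%:C%C)%:M : 'M[C]_(n + n, n)).
Proof.
move=> v; rewrite sqr_sqrtr ?addr_ge0 ?sqr_ge0 // sqnorm_split mulrDl.
under [fun i => \sum_j col_mx _ _ (lshift _ _) _ * _]eq_fun do
  (under eq_bigr do rewrite col_mxEu; rewrite sum_scalar_mx).
under [fun i => \sum_j col_mx _ _ (rshift _ _) _ * _]eq_fun do
  (under eq_bigr do rewrite col_mxEd; rewrite sum_scalar_mx).
by rewrite !sqnormZ !normc_real !real_normK ?num_real.
Qed.

(** This matrix and the next three compress a direct sum to one of its diagonal blocks. *)
Lemma op_bound_row10 m n : op_bound 1 (row_mx 1%:M 0 : 'M[C]_(m, m + n)).
Proof.
move=> v; rewrite expr1n mul1r sqnorm_split.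
under eq_fun => i.
  rewrite big_split_ord /= [X in _ + X]big1 ?addr0.
    under eq_bigr do rewrite row_mxEl.
    rewrite (sum_scalar_mx 1 (fun j => v (lshift n j))) mul1r; over.
  by move=> j _; rewrite row_mxEr mxE mul0r.
by rewrite lerDl sqnorm_ge0.
Qed.

Lemma op_bound_row01 m n : op_bound 1 (row_mx 0 1%:M : 'M[C]_(n, m + n)).
Proof.
move=> v; rewrite expr1n mul1r sqnorm_split.
under eq_fun => i.
  rewrite big_split_ord /= big1 ?add0r.
    under eq_bigr do rewrite row_mxEr.
    rewrite (sum_scalar_mx 1 (fun j => v (rshift m j))) mul1r; over.
  by move=> j _; rewrite row_mxEl mxE mul0r.
by rewrite lerDr sqnorm_ge0.
Qed.

Lemma op_bound_col10 m n : op_bound 1 (col_mx 1%:M 0 : 'M[C]_(m + n, m)).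
Proof.
move=> v; rewrite expr1n mul1r sqnorm_split [X in _ + X]big1 ?addr0.
  under eq_fun => i.
    under eq_bigr do rewrite col_mxEu.
    rewrite sum_scalar_mx mul1r; over.
  exact: lexx.
move=> i _; rewrite big1 ?Normc.normc0 ?expr0n // => j _.
by rewrite col_mxEd mxE mul0r.
Qed.

Lemma op_bound_col01 m n : op_bound 1 (col_mx 0 1%:M : 'M[C]_(m + n, n)).
Proof.
move=> v; rewrite expr1n mul1r sqnorm_split [X in X + _]big1 ?add0r.
  under eq_fun => i.
    under eq_bigr do rewrite col_mxEd.
    rewrite sum_scalar_mx mul1r; over.
  exact: lexx.
move=> i _; rewrite big1 ?Normc.normc0 ?expr0n // => j _.
by rewrite col_mxEu mxE mul0r.
Qed.

End OperatorNorm.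

(** * Matrix seminorms *)

Section LinearSubspace.
Variables (R : realType) (V : lmodType R[i]) (D : set V).
Hypothesis subD : linear_subspace D.

Lemma subspaceZ c x : D x -> D (c *: x).
Proof. by move=> Dx; rewrite -[_ *: _]addr0; apply: subD.2 => //; exact: subD.1. Qed.

Lemma subspaceD x y : D x -> D y -> D (x + y).
Proof. by move=> Dx Dy; rewrite -[x]scale1r; exact: subD.2. Qed.

Lemma subspaceB x y : D x -> D y -> D (x - y).
Proof. by move=> Dx Dy; rewrite -scaleN1r; apply: subspaceD => //; exact: subspaceZ. Qed.

Lemma subspace_sum (I : Type) (r : seq I) (P : pred I) (F : I -> V) :
  (forall i, D (F i)) -> D (\sum_(i <- r | P i) F i).
Proof.
by move=> DF; apply: big_ind; [exact: subD.1|exact: subspaceD|].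
Qed.

Lemma Mn_bimulmx m n p q (a : 'M[R[i]]_(m, n)) (x : 'M[V]_(n, p))
    (b : 'M[R[i]]_(p, q)) i j :
  (forall k l, D (x k l)) -> D (bimulmx a x b i j).
Proof.
move=> Dx; rewrite mxE; apply: subspace_sum => k; apply: subspace_sum => l.
exact: subspaceZ.
Qed.

Lemma Mn_block m n (x : 'M[V]_m) (y : 'M[V]_n) : Mn D x -> Mn D y ->
  Mn D (block_mx x 0 0 y).
Proof.
move=> Dx Dy i j; case: (split_ordP i) => k ->; case: (split_ordP j) => l ->.
- by rewrite block_mxEul.
- by rewrite block_mxEur mxE; exact: subD.1.
- by rewrite block_mxEdl mxE; exact: subD.1.
- by rewrite block_mxEdr.
Qed.

Lemma Mn_add n (x y : 'M[V]_n) : Mn D x -> Mn D y -> Mn D (x + y).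
Proof. by move=> Dx Dy i j; rewrite mxE; exact: subspaceD. Qed.

Lemma Mn_sub n (x y : 'M[V]_n) : Mn D x -> Mn D y -> Mn D (x - y).
Proof. by move=> Dx Dy i j; rewrite !mxE; exact: subspaceB. Qed.

Lemma Mn_scale n c (x : 'M[V]_n) : Mn D x -> Mn D (map_mx (fun v => c *: v) x).
Proof. by move=> Dx i j; rewrite mxE; exact: subspaceZ. Qed.

Variables (W : lmodType R[i]) (f : V -> W).
Hypothesis linf : linear_on D f.

Lemma linear_onZ c x : D x -> f (c *: x) = c *: f x.
Proof.
move=> Dx; have f0 : f 0 = 0.
  have := linf 1 subD.1 subD.1; rewrite !scale1r addr0 => /eqP.
  by rewrite -subr_eq0 opprD addNKr oppr_eq0 => /eqP.
by rewrite -[c *: x]addr0 linf // ?f0 ?addr0 //; exact: subD.1.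
Qed.

Lemma linear_onD x y : D x -> D y -> f (x + y) = f x + f y.
Proof. by move=> Dx Dy; rewrite -[x]scale1r linf // !scale1r. Qed.

Lemma linear_onB x y : D x -> D y -> f (x - y) = f x - f y.
Proof.
move=> Dx Dy; rewrite -scaleN1r linear_onD ?linear_onZ ?scaleN1r //.
by rewrite -scaleN1r; exact: subspaceZ.
Qed.

Lemma linear_on0 : f 0 = 0.
Proof. by rewrite -(scale0r 0) linear_onZ ?scale0r //; exact: subD.1. Qed.

Lemma linear_on_sum (I : Type) (r : seq I) (P : pred I) (F : I -> V) :
  (forall i, D (F i)) ->
  f (\sum_(i <- r | P i) F i) = \sum_(i <- r | P i) f (F i).
Proof.
move=> DF; elim: r => [|i r IH]; first by rewrite !big_nil linear_on0.
rewrite !big_cons; case: ifP => // _; rewrite linear_onD ?IH //.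
exact: subspace_sum.
Qed.

Lemma linear_on_bimulmx m n p q (a : 'M[R[i]]_(m, n)) (x : 'M[V]_(n, p))
    (b : 'M[R[i]]_(p, q)) : (forall k l, D (x k l)) ->
  map_mx f (bimulmx a x b) = bimulmx a (map_mx f x) b.
Proof.
move=> Dx; apply/matrixP => i j; rewrite !mxE linear_on_sum; last first.
  by move=> k; apply: subspace_sum => l; exact: subspaceZ.
apply: eq_bigr => k _; rewrite linear_on_sum; last by move=> l; exact: subspaceZ.
by apply: eq_bigr => l _; rewrite linear_onZ // mxE.
Qed.

Lemma linear_on_block m n (x : 'M[V]_m) (y : 'M[V]_n) :
  map_mx f (block_mx x 0 0 y) = block_mx (map_mx f x) 0 0 (map_mx f y).
Proof.
by rewrite map_block_mx; congr block_mx; apply/matrixP => i j;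
  rewrite !mxE linear_on0.
Qed.

End LinearSubspace.

(** * Two-sided multiplication by scalar matrices *)

Section Bimodule.
Variables (R : realType) (V : lmodType R[i]).
Local Notation C := R[i].

(** The form of [bimulmx] that also admits the index sets of tensor representations, which are not
    ordinals. *)
Definition bimul (I K L J : finType) (a : I -> K -> C) (x : K -> L -> V)
    (b : L -> J -> C) (i : I) (j : J) : V :=
  \sum_k \sum_l (a i k * b l j) *: x k l.

Lemma bimulmxE m n p q (a : 'M[C]_(m, n)) (x : 'M[V]_(n, p)) (b : 'M[C]_(p, q)) :
  bimulmx a x b =2 bimul a x b.
Proof. by move=> i j; rewrite mxE. Qed.

Lemma bimul_comp (I J K L M N : finType) (a : I -> J -> C) (b : J -> K -> C)
    (x : K -> L -> V) (c : L -> M -> C) (d : M -> N -> C) :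
  bimul a (bimul b x c) d =2
  bimul (fun i k => \sum_j a i j * b j k) x (fun l n => \sum_m c l m * d m n).
Proof.
move=> i j; rewrite /bimul.
transitivity (\sum_k \sum_l \sum_k0 \sum_l0
    (a i k * d l j * (b k k0 * c l0 l)) *: x k0 l0).
  apply: eq_bigr => k _; apply: eq_bigr => l _; rewrite scaler_sumr.
  apply: eq_bigr => k0 _; rewrite scaler_sumr; apply: eq_bigr => l0 _.
  by rewrite scalerA.
under eq_bigr do rewrite exchange_big /=.
rewrite exchange_big /=; apply: eq_bigr => k0 _.
under eq_bigr do rewrite exchange_big /=.
rewrite exchange_big /=; apply: eq_bigr => l0 _.
under eq_bigr do rewrite -scaler_suml.
rewrite -scaler_suml big_distrlr /=; congr (_ *: _).
by apply: eq_bigr => k _; apply: eq_bigr => l _; ring.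
Qed.

Lemma bimulmx_scalar m n (c d : C) (x : 'M[V]_(m, n)) i j :
  bimulmx c%:M x d%:M i j = (c * d) *: x i j.
Proof.
rewrite mxE (bigD1 i) //= [X in _ + X]big1 ?addr0 => [|k ki]; last first.
  apply: big1 => l _.
  by rewrite mxE eq_sym (negbTE ki) mulr0n mul0r scale0r.
rewrite (bigD1 j) //= big1 ?addr0 => [|l lj]; last first.
  by rewrite [d%:M _ _]mxE (negbTE lj) mulr0n mulr0 scale0r.
by rewrite !mxE !eqxx !mulr1n.
Qed.

Lemma bimulmx_delta m n p q (x : 'M[V]_(n, p)) (i : 'I_m) k l (j : 'I_q) :
  bimulmx (delta_mx i k) x (delta_mx l j) =
  \matrix_(i', j') if (i' == i) && (j' == j) then x k l else 0.
Proof.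
apply/matrixP => i' j'; rewrite !mxE.
rewrite (bigD1 k) //= [X in _ + X]big1 ?addr0 => [|k' kk]; last first.
  by apply: big1 => l' _; rewrite mxE (negbTE kk) andbF mul0r scale0r.
rewrite (bigD1 l) //= big1 ?addr0 => [|l' ll]; last first.
  by rewrite [delta_mx l j _ _]mxE (negbTE ll) mulr0 scale0r.
rewrite !mxE !eqxx andbT /= -natrM mulnb.
by case: ifP => _; rewrite ?scale1r ?scale0r.
Qed.

(** Matrix units reduce statements about all matrices to matrices with a single entry. *)
Lemma mx_sum_delta n (x : 'M[V]_n) :
  x = \sum_i \sum_j bimulmx (delta_mx i 0) (const_mx (x i j) : 'M[V]_1)
                             (delta_mx 0 j).
Proof.
apply/matrixP => k l; rewrite summxE (bigD1 k) //= summxE (bigD1 l) //=.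
rewrite {1}bimulmx_delta !mxE !eqxx /= !big1 ?addr0 //.
  move=> i ik; rewrite summxE big1 // => j _.
  by rewrite bimulmx_delta mxE eq_sym (negbTE ik).
by move=> j jl; rewrite bimulmx_delta mxE [l == j]eq_sym (negbTE jl) andbF.
Qed.

Lemma bimulmx_rowcol m1 m2 n1 n2 m n (a1 : 'M[C]_(m, m1)) (a2 : 'M[C]_(m, m2))
    (x : 'M[V]_(m1, n1)) (y : 'M[V]_(m2, n2)) (b1 : 'M[C]_(n1, n)) (b2 : 'M[C]_(n2, n)) :
  bimulmx (row_mx a1 a2) (block_mx x 0 0 y) (col_mx b1 b2) =
  bimulmx a1 x b1 + bimulmx a2 y b2.
Proof.
apply/matrixP => i j; rewrite !mxE big_split_ord /=; congr (_ + _).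
  apply: eq_bigr => k _; rewrite big_split_ord /= [X in _ + X]big1 ?addr0.
    by apply: eq_bigr => l _; rewrite row_mxEl col_mxEu block_mxEul.
  by move=> l _; rewrite block_mxEur [X in _ *: X]mxE scaler0.
apply: eq_bigr => k _; rewrite big_split_ord /= big1 ?add0r.
  by apply: eq_bigr => l _; rewrite row_mxEr col_mxEd block_mxEdr.
by move=> l _; rewrite block_mxEdl [X in _ *: X]mxE scaler0.
Qed.

Lemma bimulmx_ulblock m n (x : 'M[V]_m) (y : 'M[V]_n) :
  bimulmx (row_mx 1%:M 0) (block_mx x 0 0 y) (col_mx 1%:M 0) = x.
Proof.
rewrite bimulmx_rowcol; apply/matrixP => i j.
rewrite mxE bimulmx_scalar mul1r scale1r mxE big1 ?addr0 // => k _.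
by apply: big1 => l _; rewrite mxE mul0r scale0r.
Qed.

Lemma bimulmx_drblock m n (x : 'M[V]_m) (y : 'M[V]_n) :
  bimulmx (row_mx 0 1%:M) (block_mx x 0 0 y) (col_mx 0 1%:M) = y.
Proof.
rewrite bimulmx_rowcol; apply/matrixP => i j.
rewrite mxE bimulmx_scalar mul1r scale1r mxE big1 ?add0r // => k _.
by apply: big1 => l _; rewrite mxE mul0r scale0r.
Qed.

End Bimodule.

(* Ruan's axioms for a matrix seminorm, in a minimal form: the bimodule and
   direct sum inequalities already force homogeneity and subadditivity. *)
Record ruan (R : realType) (V : lmodType R[i]) (D : set V)
    (N : matrix_norm R V) : Prop := Ruan {
  ruan_sub : linear_subspace D;
  ruan_ge0 : forall n (x : 'M[V]_n), Mn D x -> 0 <= N n x;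
  ruan_dsum_le : forall m n (x : 'M[V]_m) (y : 'M[V]_n), Mn D x -> Mn D y ->
    N (m + n)%N (block_mx x 0 0 y) <= Num.max (N m x) (N n y);
  ruan_bimod : forall m n (a : 'M[R[i]]_(m, n)) (x : 'M[V]_n)
      (b : 'M[R[i]]_(n, m)) c d, Mn D x -> 0 <= c -> 0 <= d ->
    op_bound c a -> op_bound d b -> N m (bimulmx a x b) <= c * N n x * d }.

(** * Consequences of Ruan's inequalities *)

Section RuanTheory.
Variables (R : realType) (V : lmodType R[i]) (D : set V) (N : matrix_norm R V).
Hypothesis rN : ruan D N.
Let subD := ruan_sub rN.

Lemma ruan_scale_le n c (x : 'M[V]_n) : Mn D x ->
  N (map_mx (fun v => c *: v) x) <= normc c * N x.
Proof.
move=> Dx; have -> : map_mx (fun v => c *: v) x = bimulmx c%:M x 1%:M.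
  by apply/matrixP => i j; rewrite bimulmx_scalar mulr1 mxE.
rewrite -[_ * _]mulr1; apply: (ruan_bimod rN) => //; first exact: normc_ge0.
  exact: op_bound_scalar.
by rewrite -(Normc.normc1 R); exact: op_bound_scalar.
Qed.

Lemma ruan_zero n : N (0 : 'M[V]_n) = 0.
Proof.
have D0 : Mn D (0 : 'M[V]_n) by move=> i j; rewrite mxE; exact: subD.1.
apply/eqP; rewrite eq_le (ruan_ge0 rN) // andbT.
have := ruan_scale_le 0 D0; rewrite Normc.normc0 mul0r; congr (N _ <= _).
by apply/matrixP => i j; rewrite !mxE scale0r.
Qed.

(** The reverse inequality is the direct one for [c^-1], applied to the scaled matrix. *)
Lemma ruan_scale n c (x : 'M[V]_n) : Mn D x ->
  N (map_mx (fun v => c *: v) x) = normc c * N x.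
Proof.
move=> Dx; apply/eqP; rewrite eq_le ruan_scale_le //=.
have [->|c0] := eqVneq c 0.
  rewrite Normc.normc0 mul0r (ruan_ge0 rN) //; exact: Mn_scale.
have nc0 : 0 < normc c.
  by rewrite lt_neqAle normc_ge0 andbT eq_sym; apply: contra c0 => /eqP/Normc.eq0_normc ->.
have := ruan_scale_le c^-1 (Mn_scale subD c Dx).
rewrite Normc.normcV -(ler_pM2l nc0) mulVKf ?gt_eqF //; congr (_ * N _ <= _).
by apply/matrixP => i j; rewrite !mxE scalerA mulVf // scale1r.
Qed.

(** For [s > N x] and [t > N y], factor [x + y] as the row [(a, b)] times the direct sum of [x / s]
    and [y / t] times the column [(a, b)], where [a ^+ 2 = s] and [b ^+ 2 = t]. The middle factor
    has norm at most 1 and the bounds of the outer ones multiply to [s + t]. *)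
Lemma ruan_triangle n (x y : 'M[V]_n) : Mn D x -> Mn D y ->
  N (x + y) <= N x + N y.
Proof.
move=> Dx Dy.
have key s t : N x < s -> N y < t -> N (x + y) <= s + t.
  move=> xs yt.
  have s0 : 0 < s by apply: le_lt_trans xs; exact: ruan_ge0 rN _ _ Dx.
  have t0 : 0 < t by apply: le_lt_trans yt; exact: ruan_ge0 rN _ _ Dy.
  pose a := Num.sqrt s; pose b := Num.sqrt t.
  have a0 : 0 < a by rewrite sqrtr_gt0.
  have b0 : 0 < b by rewrite sqrtr_gt0.
  have aE : a ^+ 2 = s by rewrite sqr_sqrtr ?ltW.
  have bE : b ^+ 2 = t by rewrite sqr_sqrtr ?ltW.
  pose x' := map_mx (fun v => (s^-1)%:C%C *: v) x.
  pose y' := map_mx (fun v => (t^-1)%:C%C *: v) y.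
  have Dx' : Mn D x' by exact: Mn_scale.
  have Dy' : Mn D y' by exact: Mn_scale.
  have -> : x + y = bimulmx (row_mx (a%:C%C)%:M (b%:C%C)%:M)
      (block_mx x' 0 0 y') (col_mx (a%:C%C)%:M (b%:C%C)%:M).
    rewrite bimulmx_rowcol; apply/matrixP => i j; rewrite [LHS]mxE [RHS]mxE.
    rewrite !bimulmx_scalar !mxE !scalerA -!rmorphM -!expr2 aE bE.
    by rewrite !mulfV ?gt_eqF // !scale1r.
  apply: (@le_trans _ _ (Num.sqrt (a ^+ 2 + b ^+ 2) * 1 *
      Num.sqrt (a ^+ 2 + b ^+ 2))); last first.
    by rewrite mulr1 -expr2 sqr_sqrtr aE bE // addr_ge0 // ltW.
  apply: (@le_trans _ _ (Num.sqrt (a ^+ 2 + b ^+ 2) * N (block_mx x' 0 0 y') *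
      Num.sqrt (a ^+ 2 + b ^+ 2))).
    apply: (ruan_bimod rN); rewrite ?sqrtr_ge0 //; first exact: Mn_block.
      exact: op_bound_row_scalar.
    exact: op_bound_col_scalar.
  rewrite ler_wpM2r ?sqrtr_ge0 // ler_wpM2l ?sqrtr_ge0 //.
  apply: le_trans (ruan_dsum_le rN Dx' Dy') _.
  rewrite ge_max !ruan_scale // !normc_real !ger0_norm ?invr_ge0 ?(ltW s0) ?(ltW t0) //.
  by rewrite ![_^-1 * _]mulrC !ler_pdivrMr // !mul1r !ltW.
apply/ler_addgt0Pr => e e0; have e20 : 0 < e / 2 by rewrite divr_gt0.
have := key (N x + e / 2) (N y + e / 2); rewrite !ltrDl => /(_ e20 e20).
by rewrite addrACA -splitr.
Qed.

Lemma ruan_sumr (I : Type) (r : seq I) (P : pred I) n (F : I -> 'M[V]_n) :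
  (forall i, Mn D (F i)) ->
  N (\sum_(i <- r | P i) F i) <= \sum_(i <- r | P i) N (F i).
Proof.
move=> DF; apply: (@proj2 (Mn D (\sum_(i <- r | P i) F i))).
apply: (big_ind2 (fun x s => Mn D x /\ N x <= s)) => //.
- split; last by rewrite ruan_zero.
  by move=> i j; rewrite mxE; exact: subD.1.
- move=> x s y t [Dx xs] [Dy yt]; split; first exact: Mn_add.
  by apply: le_trans (ruan_triangle Dx Dy) _; exact: lerD.
Qed.

Lemma ruan_subC n (x y : 'M[V]_n) : Mn D x -> Mn D y -> N (x - y) = N (y - x).
Proof.
move=> Dx Dy.
have -> : x - y = map_mx (fun v => (-1) *: v) (y - x).
  by apply/matrixP => i j; rewrite !mxE scaleN1r opprB.
rewrite ruan_scale; last exact: Mn_sub.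
by rewrite normcN Normc.normc1 mul1r.
Qed.

Lemma ruan_dist_le n (x y : 'M[V]_n) : Mn D x -> Mn D y ->
  `|N x - N y| <= N (x - y).
Proof.
have h (u v : 'M[V]_n) : Mn D u -> Mn D v -> N u - N v <= N (u - v).
  move=> Du Dv; rewrite lerBlDr -{1}[u](subrK v).
  by apply: ruan_triangle => //; exact: Mn_sub.
move=> Dx Dy; rewrite ler_norml h // andbT lerNl opprB.
by rewrite ruan_subC // h.
Qed.

(** Each diagonal block is a compression of the direct sum by contractions, which gives the missing
    inequality. *)
Lemma ruan_dsum m n (x : 'M[V]_m) (y : 'M[V]_n) : Mn D x -> Mn D y ->
  N (block_mx x 0 0 y) = Num.max (N x) (N y).
Proof.
move=> Dx Dy; apply/eqP; rewrite eq_le (ruan_dsum_le rN) //= ge_max.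
have Dxy := Mn_block subD Dx Dy.
rewrite -[N (block_mx _ _ _ _)]mulr1 -[N (block_mx _ _ _ _)]mul1r.
apply/andP; split.
  rewrite -{1}(bimulmx_ulblock x y); apply: (ruan_bimod rN) => //.
    exact: op_bound_row10.
  exact: op_bound_col10.
rewrite -{1}(bimulmx_drblock x y); apply: (ruan_bimod rN) => //.
  exact: op_bound_row01.
exact: op_bound_col01.
Qed.

Lemma ruan_entry_le n (x : 'M[V]_n) i j : Mn D x ->
  N (const_mx (x i j) : 'M[V]_1) <= N x.
Proof.
move=> Dx; have -> : const_mx (x i j) =
    bimulmx (delta_mx 0 i) x (delta_mx j 0) :> 'M[V]_1.
  by rewrite bimulmx_delta; apply/matrixP => k l; rewrite !mxE !ord1.
rewrite -[N x]mulr1 -[N x]mul1r; apply: (ruan_bimod rN) => //;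
  exact: op_bound_delta.
Qed.

(** Cauchy conditions are imposed on single elements only; this estimate carries them to matrices of
    every size. *)
Lemma ruan_le_sum_entries n (x : 'M[V]_n) : Mn D x ->
  N x <= \sum_i \sum_j N (const_mx (x i j) : 'M[V]_1).
Proof.
move=> Dx; pose y i j := const_mx (x i j) : 'M[V]_1.
have Dy i j : Mn D (y i j) by move=> k l; rewrite mxE.
have Dz i j : Mn D (bimulmx (delta_mx i 0) (y i j) (delta_mx 0 j) : 'M[V]_n).
  by move=> k l; apply: Mn_bimulmx => // *; exact: Dy.
rewrite {1}(mx_sum_delta x); apply: le_trans (ruan_sumr _ _ _) _ => [i k l|].
  by rewrite summxE; apply: subspace_sum => // j; exact: Dz.
apply: ler_sum => i _.
apply: le_trans (ruan_sumr _ _ _) _; first by move=> j; exact: Dz.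
apply: ler_sum => j _; rewrite -[leRHS]mul1r -[leRHS]mulr1.
by apply: (ruan_bimod rN (Dy i j)) => //; exact: op_bound_delta.
Qed.

Lemma ruan_operator_space :
  (forall n (x : 'M[V]_n), Mn D x -> N x = 0 -> x = 0) ->
  (forall u, cauchy_in D N u ->
    exists2 l, D l & (fun k => N (const_mx (u k - l) : 'M[V]_1)) @ \oo --> (0 : R)) ->
  operator_space D N.
Proof.
move=> dN cN; split => //.
- exact: ruan_ge0 rN.
- exact: ruan_scale.
- exact: ruan_triangle.
- exact: ruan_dsum.
- move=> m n a x b Dx; apply: (ruan_bimod rN) => //;
    by [exact: opnorm_ge0|exact: op_bound_opnorm].
Qed.

End RuanTheory.

Lemma operator_space_ruan (R : realType) (V : lmodType R[i]) (D : set V)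
  (N : matrix_norm R V) : operator_space D N -> ruan D N.
Proof.
case=> subD N0 _ _ _ ds bm _; split => //.
  by move=> m n x y Dx Dy; rewrite ds.
move=> m n a x b c d Dx c0 d0 ca db; apply: le_trans (bm _ _ a x b Dx) _.
apply: ler_pM; rewrite ?mulr_ge0 ?opnorm_ge0 ?N0 ?opnorm_le //.
by apply: ler_wpM2r; rewrite ?N0 ?opnorm_le.
Qed.

(** * Duals *)

(** Enlarges one factor of a strict estimate slightly. Norms replaced in this way become positive
    and can be divided by; the denominator [y + 1] covers [y = 0]. *)
Lemma exists_gt_mul_lt (R : realFieldType) (x y t : R) : 0 <= y -> x * y < t ->
  exists2 x', x < x' & x' * y < t.
Proof.
move=> y0 xyt; have y1 : 0 < y + 1 by rewrite ltr_wpDl.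
exists (x + (t - x * y) / (y + 1)); first by rewrite ltrDl divr_gt0 ?subr_gt0.
rewrite mulrDl -ltrBrDl mulrAC ltr_pdivrMr //.
by rewrite ltr_pM2l ?subr_gt0 // ltrDl.
Qed.

Section Amplification.
Variable R : realType.
Local Notation C := R[i].

Lemma sum_tens1l (I K : finType) (a : I -> C) k (F : I * K -> C) :
  \sum_i (if k == i.2 then a i.1 else 0) * F i = \sum_i a i * F (i, k).
Proof.
rewrite sum_pair; apply: eq_bigr => i _; rewrite (bigD1 k) //= eqxx big1 ?addr0 // => l lk.
by rewrite eq_sym (negbTE lk) mul0r.
Qed.

Lemma sum_tens1r (I K : finType) (a : I -> C) k (F : I * K -> C) :
  \sum_i F i * (if i.2 == k then a i.1 else 0) = \sum_i F (i, k) * a i.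
Proof.
under eq_bigr do rewrite mulrC eq_sym.
by rewrite sum_tens1l; apply: eq_bigr => i _; rewrite mulrC.
Qed.

Lemma mxtens_index_inj m n : injective (@mxtens_index m n).
Proof. exact: can_inj (@mxtens_indexK m n). Qed.

Lemma mxtens_unindex_inj m n : injective (@mxtens_unindex m n).
Proof. exact: can_inj (@mxtens_unindexK m n). Qed.

Lemma op_bound_amplify (U V : Type) (m : U -> V -> C) r s (x : 'M[U]_r)
    (y : 'M[V]_s) c :
  op_bound c (fun i j : 'I_r * 'I_s => m (x i.1 j.1) (y i.2 j.2)) <->
  op_bound c (amplify m x y).
Proof.
split=> h.
  have := op_bound_reindex (@mxtens_unindex_inj r s) (@mxtens_unindex_inj r s) h.
  by apply: op_bound_eq => i j; rewrite mxE.
have := op_bound_reindex (@mxtens_index_inj r s) (@mxtens_index_inj r s) h.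
by apply: op_bound_eq => i j; rewrite mxE !mxtens_indexK.
Qed.

Lemma op_bound_rowvec r (eta : 'I_r -> C) : sqnorm eta <= 1 ->
  op_bound 1 (\row_k eta k).
Proof.
move=> e1 v; rewrite expr1n mul1r {1}/sqnorm big_ord1.
under eq_bigr do rewrite mxE.
apply: le_trans (cauchy_schwarz _ _) _.
by rewrite -[leRHS]mul1r ler_wpM2r ?sqnorm_ge0.
Qed.

Lemma op_bound_colvec r (eta : 'I_r -> C) : sqnorm eta <= 1 ->
  op_bound 1 (\col_k eta k).
Proof.
move=> e1 v; rewrite expr1n mul1r.
under eq_fun do rewrite big_ord1 mxE mulrC.
rewrite sqnormZ -[leRHS]mulr1; apply: ler_pM; rewrite ?sqr_ge0 ?sqnorm_ge0 //.
by rewrite /sqnorm big_ord1.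
Qed.

End Amplification.

Section Dual.
Variables (R : realType) (V : lmodType R[i]) (D : set V) (N : matrix_norm R V).
Hypothesis rN : ruan D N.
Local Notation C := R[i].
Let subD := ruan_sub rN.

(* [dual_bound c f] says that the cb-norm of [f : D -> M_n] is at most [c]. *)
Definition dual_bound n (c : R) (f : 'M[V -> C^o]_n) :=
  forall r (x : 'M[V]_r), Mn D x ->
  op_bound (c * N x) (fun i j : 'I_n * 'I_r => f i.1 j.1 (x i.2 j.2) : C).

Let dual_values n (f : 'M[V -> C^o]_n) := [set t | exists r (x : 'M[V]_r),
  [/\ Mn D x, N x <= 1 &
      t = opnorm (amplify (fun (g : V -> C^o) v => g v : C) f x)]].

Lemma dual_bound_ub n c (f : 'M[V -> C^o]_n) : 0 <= c -> dual_bound c f ->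
  ubound (dual_values f) c.
Proof.
move=> c0 cf _ [r [x [Dx x1 ->]]]; apply: opnorm_le => //.
apply/op_bound_amplify; apply: op_bound_le (cf _ _ Dx).
  by rewrite mulr_ge0 // (ruan_ge0 rN).
by rewrite ler_piMr.
Qed.

Lemma dual_values_nonempty n (f : 'M[V -> C^o]_n) : dual_values f !=set0.
Proof.
(* The empty matrix always qualifies, its norm being 0. *)
have D0 : Mn D (0 : 'M[V]_0) by move=> [].
by eexists; exists 0, 0; split; rewrite ?(ruan_zero rN).
Qed.

Lemma dual_norm_le n c (f : 'M[V -> C^o]_n) : 0 <= c -> dual_bound c f ->
  dual_norm D N f <= c.
Proof.
move=> c0 cf; apply: ge_sup; first exact: dual_values_nonempty.
exact: dual_bound_ub.
Qed.

(* A bounded functional is completely bounded with the same norm, since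
   [eta^* f(x) v = f (eta^* x v)]. *)
Lemma dual_bound_exists n (f : 'M[V -> C^o]_n) : Mn (dual D N) f ->
  exists2 c, 0 <= c & dual_bound c f.
Proof.
move=> Df; have M i j : exists M : R, 0 <= M /\
    forall x, D x -> normc (f i j x) <= M * N (const_mx x : 'M[V]_1).
  have [_ [M fM] _] := Df i j; exists `|M|; split=> // x Dx.
  apply: le_trans (fM _ Dx) _; rewrite ler_wpM2r ?ler_norm //.
  by apply: (ruan_ge0 rN) => k l; rewrite mxE.
pose m i j := xget 0 [set M : R | 0 <= M /\
    forall x, D x -> normc (f i j x) <= M * N (const_mx x : 'M[V]_1)].
have mP i j : 0 <= m i j /\
    forall x, D x -> normc (f i j x) <= m i j * N (const_mx x : 'M[V]_1).
  by rewrite /m; case: xgetP => [? -> //|]; have [M' h] := M i j => /(_ M').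
(* A crude bound: only its existence matters, to make the supremum finite. *)
exists (\sum_i \sum_j m i j).
  by apply: sumr_ge0 => i _; apply: sumr_ge0 => j _; exact: (mP i j).1.
move=> r x Dx; have Nx0 : 0 <= N x by exact: ruan_ge0 rN _ _ Dx.
apply: op_bound_rank1.
  rewrite mulr_ge0 //; apply: sumr_ge0 => i _; apply: sumr_ge0 => j _.
  exact: (mP i j).1.
move=> eta v eta1 v1.
have sub1 (w : 'I_n * 'I_r -> C) i : sqnorm w <= 1 ->
    sqnorm (fun k => w (i, k)) <= 1.
  apply: le_trans; rewrite {2}/sqnorm.
  rewrite sum_pair [leRHS](bigD1 i) //= lerDl; apply: sumr_ge0 => j _.
  exact: sqnorm_ge0.
have entry (i j : 'I_n) : exists2 y : V, D y /\ N (const_mx y : 'M[V]_1) <= N x &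
    f i j y = \sum_k \sum_l eta (i, k) * v (j, l) * f i j (x k l).
  pose z := bimulmx (\row_k eta (i, k)) x (\col_l v (j, l)) : 'M[V]_1.
  exists (z 0 0).
    split; first exact: Mn_bimulmx.
    have -> : const_mx (z 0 0) = z.
      by apply/matrixP => k l; rewrite mxE !ord1.
    rewrite -[leRHS]mul1r -[leRHS]mulr1; apply: (ruan_bimod rN) => //.
      by apply: op_bound_rowvec; exact: sub1.
    by apply: op_bound_colvec; exact: sub1.
  have [lf _ _] := Df i j.
  rewrite mxE (linear_on_sum subD lf); last first.
    by move=> k; apply: subspace_sum => // l; exact: subspaceZ.
  apply: eq_bigr => k _; rewrite (linear_on_sum subD lf); last first.
    by move=> l; exact: subspaceZ.
  by apply: eq_bigr => l _; rewrite (linear_onZ subD lf) // !mxE.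
have -> : \sum_i \sum_j eta i * v j * f i.1 j.1 (x i.2 j.2) =
    \sum_i \sum_j \sum_k \sum_l eta (i, k) * v (j, l) * f i j (x k l).
  rewrite sum_pair; apply: eq_bigr => i _.
  by rewrite [RHS]exchange_big; apply: eq_bigr => k _; rewrite sum_pair.
rewrite mulr_suml; apply: le_trans (normc_sum _ _ _) _.
apply: ler_sum => i _; rewrite mulr_suml; apply: le_trans (normc_sum _ _ _) _.
apply: ler_sum => j _; have [y [Dy yx] <-] := entry i j.
apply: le_trans ((mP i j).2 _ Dy) _; rewrite ler_wpM2l //; exact: (mP i j).1.
Qed.

Lemma dual_values_ub n (f : 'M[V -> C^o]_n) : Mn (dual D N) f ->
  has_ubound (dual_values f).
Proof.
by move=> /dual_bound_exists[c c0 cf]; exists c; exact: dual_bound_ub.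
Qed.

Lemma dual_norm_ge0 n (f : 'M[V -> C^o]_n) : Mn (dual D N) f ->
  0 <= dual_norm D N f.
Proof.
move=> Df; have [t ft] := dual_values_nonempty f.
apply: (@le_trans _ _ t); last by apply: ub_le_sup => //; exact: dual_values_ub.
by case: ft => r [x [_ _ ->]]; exact: opnorm_ge0.
Qed.

(** The supremum sees only matrices of norm at most 1. A general [x] is divided by some [s > N x],
    as [N x] itself may be 0, and [s] then decreases to [N x]. *)
Lemma dual_norm_bound n (f : 'M[V -> C^o]_n) : Mn (dual D N) f ->
  dual_bound (dual_norm D N f) f.
Proof.
move=> Df r x Dx; have c0 := dual_norm_ge0 Df; set c := dual_norm D N f in c0 *.
have Nx0 : 0 <= N x by exact: ruan_ge0 rN _ _ Dx.
apply: op_bound_inf => [|d]; first by rewrite mulr_ge0.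
rewrite mulrC => /(exists_gt_mul_lt c0)[s xs sd].
have s0 : 0 < s by exact: le_lt_trans xs.
pose y := map_mx (fun v => (s^-1)%:C%C *: v) x.
have Dy : Mn D y by exact: Mn_scale.
have y1 : N y <= 1.
  rewrite (ruan_scale rN) // normc_real ger0_norm ?invr_ge0 ?(ltW s0) //.
  by rewrite mulrC ler_pdivrMr // mul1r ltW.
have : op_bound c (fun i j : 'I_n * 'I_r => f i.1 j.1 (y i.2 j.2) : C).
  apply: (op_bound_amplify (fun (g : V -> C^o) v => g v : C) f y c).2.
  apply: op_bound_le (op_bound_opnorm _); first exact: opnorm_ge0.
  by apply: ub_le_sup; [exact: dual_values_ub|exists r, y].
move=> /(op_bound_scale s%:C%C); rewrite normc_real (gtr0_norm s0) => h.
apply: op_bound_le (ltW sd) _; first by rewrite mulr_ge0 // ltW.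
apply: op_bound_eq h => i j; have [lf _ _] := Df i.1 j.1.
rewrite mxE (linear_onZ subD lf) // /GRing.scale /= mulrA -rmorphM /=.
by rewrite mulfV ?gt_eqF // mul1r.
Qed.

Lemma dual_subspace : linear_subspace (dual D N).
Proof.
split.
  split=> [c x y _ _|| x _] //; first by rewrite scaler0 addr0.
  by exists 0 => x _; rewrite mul0r -[X in normc X]/(0 : C) Normc.normc0.
move=> c f g [lf [Mf fM] f0] [lg [Mg gM] g0]; split.
- move=> d x y Dx Dy; rewrite /= !fctE lf // lg // !scalerDr !scalerA mulrC.
  by rewrite addrACA.
- exists (normc c * Mf + Mg) => x Dx; rewrite !fctE mulrDl.
  apply: le_trans (le_normcD _ _) _; apply: lerD; last exact: gM.
  by rewrite /GRing.scale /= Normc.normcM -mulrA ler_wpM2l ?normc_ge0 ?fM.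
- by move=> x Dx; rewrite !fctE f0 // g0 // scaler0 addr0.
Qed.

Lemma dual_ruan : ruan (dual D N) (dual_norm D N).
Proof.
split; [exact: dual_subspace|exact: dual_norm_ge0| |].
  move=> m n f g Df Dg; set c := Num.max _ _.
  have c0 : 0 <= c by rewrite le_max dual_norm_ge0.
  apply: dual_norm_le => // r x Dx; have Nx0 := ruan_ge0 rN Dx.
  (* [h] sorts the indices of the amplified matrix by the block of their first component, which
     makes that matrix block diagonal. *)
  pose h (i : 'I_(m + n) * 'I_r) : 'I_m * 'I_r + 'I_n * 'I_r :=
    match fintype.split i.1 with inl j => inl (j, i.2) | inr j => inr (j, i.2) end.
  have ih : injective h.
    move=> [i k] [j l]; rewrite /h /=.
    by case: (split_ordP i) => i' ->; case: (split_ordP j) => j' -> // -[-> ->].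
  have ge : dual_norm D N f * N x <= c * N x.
    by rewrite ler_wpM2r // le_max lexx.
  have ge' : dual_norm D N g * N x <= c * N x.
    by rewrite ler_wpM2r // le_max lexx orbT.
  have bf := op_bound_le (mulr_ge0 (dual_norm_ge0 Df) Nx0) ge
    (dual_norm_bound Df Dx).
  have bg := op_bound_le (mulr_ge0 (dual_norm_ge0 Dg) Nx0) ge'
    (dual_norm_bound Dg Dx).
  apply: op_bound_eq (op_bound_reindex ih ih (op_bound_dsum bf bg)).
  move=> [i k] [j l]; rewrite /h /=.
  case: (split_ordP i) => i' ->; case: (split_ordP j) => j' -> /=.
  - by rewrite block_mxEul.
  - by rewrite block_mxEur mxE.
  - by rewrite block_mxEdl mxE.
  - by rewrite block_mxEdr.
move=> m n a f b c d Df c0 d0 ca db.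
apply: dual_norm_le => [|r x Dx]; first by rewrite !mulr_ge0 ?dual_norm_ge0.
(* Evaluating [a f b] at [x] gives the amplified matrix of [f] and [x] between [a] and [b], each
   tensored with the identity of size [r]. *)
have := op_bound_comp (op_bound_comp (op_bound_tens1 (K := 'I_r) ca)
  (dual_norm_bound Df Dx)) (op_bound_tens1 (K := 'I_r) db).
have -> : c * (dual_norm D N f * N x) * d = c * dual_norm D N f * d * N x.
  by ring.
apply: op_bound_eq => -[i k] [j l] /=; rewrite mxE fct_sumE.
under [RHS]eq_bigr do rewrite fct_sumE.
rewrite (sum_tens1r (fun j0 => b j0 j)) exchange_big /=; apply: eq_bigr => j0 _.
rewrite (sum_tens1l (a i) k (fun j1 => f j1.1 j0 (x j1.2 l))) mulr_suml.
by apply: eq_bigr => i0 _; rewrite mulrAC.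
Qed.

End Dual.

(** * The projective norm on the algebraic tensor product *)

Section AlgebraicTensor.
Variables (R : realType) (U V : lmodType R[i]).
Variables (D : set U) (ND : matrix_norm R U) (E : set V) (NE : matrix_norm R V).
Hypotheses (rD : ruan D ND) (rE : ruan E NE).
Local Notation C := R[i].
Local Notation T := (tensor_ambient U V).
Local Notation elt := (elementary_tensor D E).
Local Notation "''N' u" := (alg_proj_norm D ND E NE u) (at level 10).
Let subD := ruan_sub rD.
Let subE := ruan_sub rE.

Lemma elementary_tensor_linearl y : E y -> linear_on D (fun x => elt x y).
Proof.
move=> Ey c x x' Dx Dx'; apply/funext => B.
rewrite !fctE /elementary_tensor; case: asboolP => [[hB _]|_].
  by rewrite (hB _ Ey).
by rewrite scaler0 addr0.
Qed.

Lemma elementary_tensor_linearr x : D x -> linear_on E (elt x).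
Proof.
move=> Dx c y y' Ey Ey'; apply/funext => B.
rewrite !fctE /elementary_tensor; case: asboolP => [[_ hB]|_].
  by rewrite (hB _ Dx).
by rewrite scaler0 addr0.
Qed.

Lemma alg_tensor_elementary x y : D x -> E y -> alg_tensor D E (elt x y).
Proof. by move=> Dx Ey; exists 1, (fun=> x), (fun=> y); rewrite big_ord1. Qed.

Lemma alg_tensor_subspace : linear_subspace (alg_tensor D E).
Proof.
split.
  exists 0, (fun=> 0), (fun=> 0); rewrite big_ord0.
  by split=> // -[].
move=> c _ _ [m [x [y [Dx Ey ->]]]] [n [x' [y' [Dx' Ey' ->]]]].
pose X i := match fintype.split i with inl j => c *: x j | inr j => x' j end.
pose Y i := match fintype.split i with inl j => y j | inr j => y' j end.
exists (m + n)%N, X, Y; split.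
- by move=> i; rewrite /X; case: fintype.split => // j; exact: subspaceZ.
- by move=> i; rewrite /Y; case: fintype.split.
rewrite big_split_ord scaler_sumr /=; congr (_ + _).
  apply: eq_bigr => i _; rewrite /X /Y (unsplitK (inl i)).
  by rewrite (linear_onZ subD (elementary_tensor_linearl (Ey i))).
by apply: eq_bigr => i _; rewrite /X /Y (unsplitK (inr i)).
Qed.

Lemma Mn_amplify_elementary p q (v : 'M[U]_p) (w : 'M[V]_q) :
  Mn D v -> Mn E w -> Mn (alg_tensor D E) (amplify elt v w).
Proof. by move=> Dv Ew i j; rewrite mxE; exact: alg_tensor_elementary. Qed.

Let values n (u : 'M[T]_n) := [set t | exists p q (a : 'M[C]_(n, p * q)) (v : 'M[U]_p)
      (w : 'M[V]_q) (b : 'M[C]_(p * q, n)),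
    [/\ Mn D v, Mn E w,
        u = bimulmx a (amplify elt v w) b &
        t = opnorm a * ND v * NE w * opnorm b]].

Lemma alg_proj_norm_lbound n (u : 'M[T]_n) : lbound (values u) 0.
Proof.
move=> _ [p [q [a [v [w [b [Dv Ew _ ->]]]]]]].
by rewrite !mulr_ge0 ?opnorm_ge0 ?(ruan_ge0 rD) ?(ruan_ge0 rE).
Qed.

(* The index set [K] may be any part [g] of the [p x q] index set of the
   Kronecker product, which avoids padding [a] and [b] with zeros. *)
Lemma bimul_amplifyE n (u : 'M[T]_n) (K : finType) p q
    (g : K -> 'I_p * 'I_q) (v : 'M[U]_p) (w : 'M[V]_q)
    (a : 'I_n -> K -> C) (b : K -> 'I_n -> C) c d :
  injective g -> op_bound c a -> op_bound d b ->
  u =2 bimul a (fun k l => elt (v (g k).1 (g l).1) (w (g k).2 (g l).2)) b ->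
  exists (a' : 'M[C]_(n, p * q)) (b' : 'M[C]_(p * q, n)),
    [/\ op_bound c a', op_bound d b' & u = bimulmx a' (amplify elt v w) b'].
Proof.
move=> ig ca db uE.
have iu := @mxtens_unindex_inj p q.
have inj1 := op_bound_reindex (@inj_id K) iu (@op_bound_inj R _ _ _ ig).
have inj2 := op_bound_reindex iu (@inj_id K) (@op_bound_coinj R _ _ _ ig).
exists (\matrix_(i, x) \sum_k a i k *
  (if g k == mxtens_unindex x then 1 else 0)).
exists (\matrix_(x, j) \sum_k
  (if g k == mxtens_unindex x then 1 else 0) * b k j).
split.
- rewrite -[c]mulr1; apply: op_bound_eq (op_bound_comp ca inj1) => i j.
  by rewrite mxE.
- rewrite -[d]mul1r; apply: op_bound_eq (op_bound_comp inj2 db) => i j.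
  by rewrite mxE.
apply/matrixP => i j; rewrite bimulmxE uE.
pose X := amplify elt v w.
(* The family over [K] is the compression of the whole Kronecker product along [g]; the 0/1 matrices
   are then absorbed into [a] and [b]. *)
transitivity (bimul a (bimul (fun k x => if g k == mxtens_unindex x then 1 else 0)
    X (fun x k => if g k == mxtens_unindex x then 1 else 0)) b i j).
  apply: eq_bigr => k _; apply: eq_bigr => l _; congr (_ *: _).
  rewrite /bimul (bigD1 (mxtens_index (g k))) //= [X in _ + X]big1 ?addr0.
    rewrite (bigD1 (mxtens_index (g l))) //= big1 ?addr0.
      by rewrite !mxtens_indexK !eqxx mulr1 scale1r mxE !mxtens_indexK.
    move=> x xl; case: (g l =P _) => [gl|_]; last by rewrite mulr0 scale0r.
    by rewrite gl mxtens_unindexK eqxx in xl.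
  move=> x xk; case: (g k =P _) => [gk|_].
    by rewrite gk mxtens_unindexK eqxx in xk.
  by apply: big1 => y _; rewrite mul0r scale0r.
rewrite bimul_comp; apply: eq_bigr => k _; apply: eq_bigr => l _.
by rewrite !mxE.
Qed.

Lemma alg_proj_norm_le n (u : 'M[T]_n) (K : finType) p q
    (g : K -> 'I_p * 'I_q) (v : 'M[U]_p) (w : 'M[V]_q)
    (a : 'I_n -> K -> C) (b : K -> 'I_n -> C) c d :
  Mn D v -> Mn E w -> injective g -> 0 <= c -> 0 <= d ->
  op_bound c a -> op_bound d b ->
  u =2 bimul a (fun k l => elt (v (g k).1 (g l).1) (w (g k).2 (g l).2)) b ->
  'N u <= c * ND v * NE w * d.
Proof.
move=> Dv Ew ig c0 d0 ca db uE.
have [a' [b' [ca' db' uE']]] := bimul_amplifyE ig ca db uE.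
apply: (@le_trans _ _ (opnorm a' * ND v * NE w * opnorm b')); last first.
  have v0 := ruan_ge0 rD Dv; have w0 := ruan_ge0 rE Ew.
  apply: ler_pM; rewrite ?mulr_ge0 ?opnorm_ge0 ?opnorm_le //.
  by do 2?apply: ler_wpM2r; rewrite ?opnorm_le.
apply: ge_inf; first by exists 0; exact: alg_proj_norm_lbound.
by exists p, q, a', v, w, b'.
Qed.

(** A normalized representation: contractive [v] and [w], the weight split evenly between [a] and
    [b], and a part [g] of the Kronecker index set. In this form two representations with the same
    [t] have a direct sum with that same [t]. *)
Definition tensor_repr n (u : 'M[T]_n) (t : R) := 0 < t /\
  exists (K : finType) p q (g : K -> 'I_p * 'I_q) (v : 'M[U]_p) (w : 'M[V]_q)
    (a : 'I_n -> K -> C) (b : K -> 'I_n -> C),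
  [/\ Mn D v, Mn E w, ND v <= 1, NE w <= 1 & injective g] /\
  [/\ op_bound (Num.sqrt t) a, op_bound (Num.sqrt t) b &
    u =2 bimul a (fun k l => elt (v (g k).1 (g l).1) (w (g k).2 (g l).2)) b].

Lemma tensor_repr_le n (u : 'M[T]_n) t : tensor_repr u t -> 'N u <= t.
Proof.
case=> t0 [K [p [q [g [v [w [a [b [[Dv Ew v1 w1 ig] [ca cb uE]]]]]]]]]].
have s0 := sqrtr_ge0 t.
apply: le_trans (alg_proj_norm_le Dv Ew ig s0 s0 ca cb uE) _.
rewrite -[leRHS](sqr_sqrtr (ltW t0)) expr2 ler_wpM2r //.
have v0 := ruan_ge0 rD Dv; have w0 := ruan_ge0 rE Ew.
by rewrite -mulrA ler_piMr // mulr_ile1.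
Qed.

Lemma tensor_repr_mono n (u : 'M[T]_n) s t :
  s <= t -> tensor_repr u s -> tensor_repr u t.
Proof.
move=> st [s0 [K [p [q [g [v [w [a [b [h [ca cb uE]]]]]]]]]]].
split; first exact: lt_le_trans st.
have h' : Num.sqrt s <= Num.sqrt t by rewrite ler_sqrt // (le_trans (ltW s0)).
exists K, p, q, g, v, w, a, b; split=> //; split=> //;
  exact: op_bound_le (sqrtr_ge0 _) h' _.
Qed.

(** All factors are added blockwise. The tensor product of the block diagonal factors also has mixed
    indices; [G] selects only the pairs whose two components come from the same summand. *)
Lemma tensor_repr_dsum m n (u : 'M[T]_m) (u' : 'M[T]_n) t :
  tensor_repr u t -> tensor_repr u' t -> tensor_repr (block_mx u 0 0 u') t.
Proof.
move=> [t0 [K [p [q [g [v [w [a [b [[Dv Ew v1 w1 ig] [ca cb uE]]]]]]]]]]].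
move=> [_ [K' [p' [q' [g' [v' [w' [a' [b'
  [[Dv' Ew' v1' w1' ig'] [ca' cb' uE']]]]]]]]]]].
split=> //.
pose G (k : K + K') : 'I_(p + p') * 'I_(q + q') := match k with
  | inl k => (lshift p' (g k).1, lshift q' (g k).2)
  | inr k => (rshift p (g' k).1, rshift q (g' k).2) end.
have is_ k l : injective (@fintype.split k l) by exact: can_inj (@splitK k l).
exists (K + K')%type, (p + p')%N, (q + q')%N, G, (block_mx v 0 0 v'),
  (block_mx w 0 0 w'), (fun i k => dsum_fun a a' (fintype.split i) k),
  (fun k i => dsum_fun b b' k (fintype.split i)).
split.
  split; try exact: Mn_block.
  - by apply: le_trans (ruan_dsum_le rD Dv Dv') _; rewrite ge_max v1.
  - by apply: le_trans (ruan_dsum_le rE Ew Ew') _; rewrite ge_max w1.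
  move=> [k|k] [l|l] //= [].
  - move=> /ord_inj e1 /ord_inj e2; congr inl; apply: ig.
    by rewrite [g k]surjective_pairing e1 e2 -surjective_pairing.
  - by move=> e; have := ltn_ord (g k).1; rewrite e ltnNge leq_addr.
  - by move=> e; have := ltn_ord (g l).1; rewrite -e ltnNge leq_addr.
  - move=> /addnI/ord_inj e1 /addnI/ord_inj e2; congr inr; apply: ig'.
    by rewrite [g' k]surjective_pairing e1 e2 -surjective_pairing.
split.
- exact: (op_bound_reindex (@is_ m n) (@inj_id _) (op_bound_dsum ca ca')).
- exact: (op_bound_reindex (@inj_id _) (@is_ m n) (op_bound_dsum cb cb')).
move=> i j; rewrite /bimul.
(* In an off-diagonal block the surviving scalars pair an index of [K] with one of [K'], where the
   direct sum of [v] and [v'] vanishes. *)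
have elt0 y : E y -> elt 0 y = 0.
  by move=> Ey; rewrite (linear_on0 subD (elementary_tensor_linearl Ey)).
rewrite big_sumType /=.
under eq_bigr do rewrite big_sumType /=.
under [X in _ + X]eq_bigr do rewrite big_sumType /=.
case: (split_ordP i) => i' ->; case: (split_ordP j) => j' -> /=.
- rewrite block_mxEul uE /bimul [X in _ + X]big1 ?addr0 => [|k _]; last first.
    by rewrite !big1 ?addr0 // => l _; rewrite mul0r scale0r.
  apply: eq_bigr => k _; rewrite [X in _ = _ + X]big1 ?addr0 => [|l _].
    by apply: eq_bigr => l _; rewrite !block_mxEul.
  by rewrite mulr0 scale0r.
- rewrite block_mxEur mxE !big1 ?addr0 // => k _; rewrite !big1 ?addr0 // => l _;
    rewrite ?(mulr0, mul0r, scale0r) // block_mxEur [const_mx _ _ _]mxE.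
  by rewrite elt0 ?scaler0 //; exact: Mn_block.
- rewrite block_mxEdl mxE !big1 ?addr0 // => k _; rewrite !big1 ?addr0 // => l _;
    rewrite ?(mulr0, mul0r, scale0r) // block_mxEdl [const_mx _ _ _]mxE.
  by rewrite elt0 ?scaler0 //; exact: Mn_block.
- rewrite block_mxEdr uE' /bimul [X in _ = X + _]big1 ?add0r => [|k _]; last first.
    by rewrite !big1 ?addr0 // => l _; rewrite mul0r scale0r.
  apply: eq_bigr => k _; rewrite [X in _ = X + _]big1 ?add0r => [|l _].
    by apply: eq_bigr => l _; rewrite !block_mxEdr.
  by rewrite mulr0 scale0r.
Qed.

Lemma tensor_repr_bimod m n (a0 : 'M[C]_(m, n)) (u : 'M[T]_n)
    (b0 : 'M[C]_(n, m)) c d t : 0 < c -> 0 < d ->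
  op_bound c a0 -> op_bound d b0 -> tensor_repr u t ->
  tensor_repr (bimulmx a0 u b0) (c * t * d).
Proof.
move=> c0 d0 ca0 db0 [t0 [K [p [q [g [v [w [a [b [h [ca cb uE]]]]]]]]]]].
split; first by rewrite !mulr_gt0.
pose x := Num.sqrt c; pose y := Num.sqrt d; pose z := Num.sqrt t.
have x0 : 0 < x by rewrite sqrtr_gt0.
have y0 : 0 < y by rewrite sqrtr_gt0.
have cE : c = x ^+ 2 by rewrite sqr_sqrtr // ltW.
have dE : d = y ^+ 2 by rewrite sqr_sqrtr // ltW.
have sE : Num.sqrt (c * t * d) = x * z * y.
  by rewrite !sqrtrM ?mulr_ge0 // ltW.
(* [a0 a] is bounded by [x ^+ 2 * z] and [b b0] by [z * y ^+ 2]; the reciprocal factors [y / x] and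
   [x / y] bring both to [x * z * y], the square root of the new weight. *)
exists K, p, q, g, v, w,
  (fun i k => (y / x)%:C%C * \sum_j a0 i j * a j k),
  (fun k i => (x / y)%:C%C * \sum_j b k j * b0 j i); split=> //.
have nq (r s : R) : 0 < r -> 0 < s -> normc (r / s)%:C%C = r / s.
  by move=> r0 s0; rewrite normc_real gtr0_norm // divr_gt0.
split.
- have -> : Num.sqrt (c * t * d) = normc (y / x)%:C%C * (c * z).
    by rewrite nq // sE cE; field; rewrite gt_eqF.
  exact: op_bound_scale (op_bound_comp ca0 ca).
- have -> : Num.sqrt (c * t * d) = normc (x / y)%:C%C * (z * d).
    by rewrite nq // sE dE; field; rewrite gt_eqF.
  exact: op_bound_scale (op_bound_comp cb db0).
move=> i j; rewrite bimulmxE.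
transitivity (bimul a0 (bimul a (fun k l => elt (v (g k).1 (g l).1)
    (w (g k).2 (g l).2)) b) b0 i j).
  by apply: eq_bigr => k _; apply: eq_bigr => l _; rewrite uE.
rewrite bimul_comp; apply: eq_bigr => k _; apply: eq_bigr => l _.
congr (_ *: _); rewrite mulrACA -rmorphM /=.
have -> : y / x * (x / y) = 1 by field; rewrite !gt_eqF.
by rewrite mul1r.
Qed.

(** Only the existence of some weight matters here; the sharp triangle inequality comes later from
    [ruan_triangle]. *)
Lemma tensor_repr_add n (u u' : 'M[T]_n) t t' : tensor_repr u t ->
  tensor_repr u' t' -> exists s, tensor_repr (u + u') s.
Proof.
move=> ut ut'; set s := Num.max t t'.
have us : tensor_repr u s by apply: tensor_repr_mono ut; rewrite le_max lexx.
have us' : tensor_repr u' s.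
  by apply: tensor_repr_mono ut'; rewrite le_max lexx orbT.
have -> : u + u' = bimulmx (row_mx 1%:M 1%:M) (block_mx u 0 0 u')
    (col_mx 1%:M 1%:M).
  rewrite bimulmx_rowcol; apply/matrixP => i j.
  by rewrite [LHS]mxE [RHS]mxE !bimulmx_scalar mulr1 !scale1r.
exists (Num.sqrt (1 ^+ 2 + 1 ^+ 2) * s * Num.sqrt (1 ^+ 2 + 1 ^+ 2)).
have s0 : 0 < Num.sqrt (1 ^+ 2 + 1 ^+ 2) :> R.
  by rewrite sqrtr_gt0 addr_gt0 ?exprn_gt0.
apply: tensor_repr_bimod => //; last exact: tensor_repr_dsum.
  exact: op_bound_row_scalar.
exact: op_bound_col_scalar.
Qed.

Lemma tensor_repr0 n : tensor_repr (0 : 'M[T]_n) 1.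
Proof.
split=> //; exists 'I_0, 0, 0, (fun k => (k, k)), 0, 0, (fun _ _ => 0),
  (fun _ _ => 0); split.
  split; rewrite ?(ruan_zero rD) ?(ruan_zero rE) //; last by move=> [].
  - by move=> [].
  - by move=> [].
have b0 (I J : finType) c : op_bound c (fun (_ : I) (_ : J) => 0 : C).
  move=> v; rewrite /sqnorm big1 => [|i _].
    by rewrite mulr_ge0 ?sqr_ge0 ?sqnorm_ge0.
  by rewrite big1 ?Normc.normc0 ?expr0n // => j _; rewrite mul0r.
by split=> // i j; rewrite mxE /bimul big_ord0.
Qed.

Lemma tensor_repr_elementary x y : D x -> E y ->
  exists t, tensor_repr (const_mx (elt x y) : 'M[T]_1) t.
Proof.
move=> Dx Ey.
have Dx' : Mn D (const_mx x : 'M[U]_1) by move=> i j; rewrite mxE.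
have Ey' : Mn E (const_mx y : 'M[V]_1) by move=> i j; rewrite mxE.
(* Adding 1 keeps the scaling factors positive when a norm is 0. *)
pose s := ND (const_mx x : 'M[U]_1) + 1.
pose t := NE (const_mx y : 'M[V]_1) + 1.
have s0 : 0 < s by rewrite ltr_wpDl // (ruan_ge0 rD).
have t0 : 0 < t by rewrite ltr_wpDl // (ruan_ge0 rE).
exists (s * t); split; first by rewrite mulr_gt0.
exists 'I_1, 1, 1, (fun=> (ord0, ord0)),
  (map_mx (fun v => (s^-1)%:C%C *: v) (const_mx x)),
  (map_mx (fun v => (t^-1)%:C%C *: v) (const_mx y)),
  (fun _ _ => (Num.sqrt (s * t))%:C%C), (fun _ _ => (Num.sqrt (s * t))%:C%C).
have st0 : 0 <= Num.sqrt (s * t) by exact: sqrtr_ge0.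
have bd : op_bound (Num.sqrt (s * t))
    (fun (_ _ : 'I_1) => (Num.sqrt (s * t))%:C%C).
  have := @op_bound_scalar R 1 (Num.sqrt (s * t))%:C%C.
  rewrite normc_real ger0_norm //; apply: op_bound_eq => i j.
  by rewrite mxE !ord1 eqxx.
have nV (r : R) : 0 < r -> normc (r^-1)%:C%C = r^-1.
  by move=> r0; rewrite normc_real gtr0_norm // invr_gt0.
split.
  split; try exact: Mn_scale.
  - rewrite (ruan_scale rD) // nV // mulrC ler_pdivrMr // mul1r /s.
    by rewrite lerDl.
  - rewrite (ruan_scale rE) // nV // mulrC ler_pdivrMr // mul1r /t.
    by rewrite lerDl.
  - by move=> i j _; rewrite !ord1.
split=> // i j; rewrite /bimul !big_ord1 !mxE.
rewrite (linear_onZ subD (elementary_tensor_linearl (subspaceZ subE _ Ey))) //.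
rewrite (linear_onZ subE (elementary_tensor_linearr Dx)) // !scalerA.
rewrite -!rmorphM /= -expr2 sqr_sqrtr ?mulr_ge0 ?(ltW s0) ?(ltW t0) //.
set c := (X in X%:C%C *: _); have -> : c = 1 by rewrite /c; field; rewrite !gt_eqF.
by rewrite scale1r.
Qed.

(** Guarantees that the infimum defining the projective norm is over a nonempty set. Matrix units
    and finite sums reduce the claim to elementary tensors. *)
Lemma tensor_repr_exists n (u : 'M[T]_n) :
  Mn (alg_tensor D E) u -> exists t, tensor_repr u t.
Proof.
move=> Tu.
have reprD k (F G : 'M[T]_k) : (exists t, tensor_repr F t) ->
    (exists t, tensor_repr G t) -> exists t, tensor_repr (F + G) t.
  by move=> [t Ft] [t' Gt']; exact: tensor_repr_add Ft Gt'.
rewrite (mx_sum_delta u).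
apply: (big_ind (fun x : 'M[T]_n => exists t, tensor_repr x t));
  [by exists 1; exact: tensor_repr0|exact: reprD|move=> i _].
apply: (big_ind (fun x : 'M[T]_n => exists t, tensor_repr x t));
  [by exists 1; exact: tensor_repr0|exact: reprD|move=> j _].
suff [t ut] : exists t, tensor_repr (const_mx (u i j) : 'M[T]_1) t.
  by exists (1 * t * 1); apply: tensor_repr_bimod => //; exact: op_bound_delta.
have [k [x [y [Dx Ey ->]]]] := Tu i j.
have -> : const_mx (\sum_l elt (x l) (y l)) =
    \sum_l const_mx (elt (x l) (y l)) :> 'M[T]_1.
  by apply/matrixP => a b; rewrite summxE mxE; apply: eq_bigr => l _; rewrite mxE.
apply: (big_ind (fun x : 'M[T]_1 => exists t, tensor_repr x t));
  [by exists 1; exact: tensor_repr0|exact: reprD|move=> l _].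
exact: tensor_repr_elementary.
Qed.

Lemma alg_proj_nonempty n (u : 'M[T]_n) :
  Mn (alg_tensor D E) u -> values u !=set0.
Proof.
move=> /tensor_repr_exists[t [_ [K [p [q [g [v [w [a [b
  [[Dv Ew _ _ ig] [ca cb uE]]]]]]]]]]]].
have [a' [b' [_ _ uE']]] := bimul_amplifyE ig ca cb uE.
by eexists; exists p, q, a', v, w, b'; split.
Qed.

Lemma alg_proj_norm_lt n (u : 'M[T]_n) t : Mn (alg_tensor D E) u ->
  'N u < t -> tensor_repr u t.
Proof.
move=> Tu ut; have [_ [p [q [a [v [w [b [Dv Ew uE ->]]]]]]]] := inf_lt (alg_proj_nonempty Tu) ut.
have v0 := ruan_ge0 rD Dv; have w0 := ruan_ge0 rE Ew.
have a0 := opnorm_ge0 a; have b0 := opnorm_ge0 b.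
(* One after the other, the norms of [b], [a], [v] and [w] are replaced by larger numbers [z], [r],
   [x] and [y] whose product is still below [t]. *)
rewrite mulrC => /exists_gt_mul_lt[]; first by rewrite !mulr_ge0.
move=> z bz; have z0 := le_lt_trans b0 bz.
rewrite mulrC -!mulrA => /exists_gt_mul_lt[]; first by rewrite !mulr_ge0 // ltW.
move=> r ar; have r0 := le_lt_trans a0 ar.
rewrite mulrCA => /exists_gt_mul_lt[]; first by rewrite !mulr_ge0 // ltW.
move=> x vx; have x0 := le_lt_trans v0 vx.
have -> : x * (r * (NE w * z)) = NE w * (x * r * z) by ring.
move=> /exists_gt_mul_lt[]; first by rewrite !mulr_ge0 // ltW.
move=> y wy; have y0 := le_lt_trans w0 wy.
move=> ht; have t0 : 0 < t by apply: lt_trans ht; rewrite !mulr_gt0.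
have ca := op_bound_le a0 (ltW ar) (op_bound_opnorm a).
have cb := op_bound_le b0 (ltW bz) (op_bound_opnorm b).
(* With this [s] the left matrix is bounded by exactly [Num.sqrt t]; the slack in
   [x * y * r * z < t] goes to the right one. *)
split=> //; pose s := Num.sqrt t / r.
have st0 : 0 < Num.sqrt t by rewrite sqrtr_gt0.
have s0 : 0 < s by rewrite divr_gt0.
exists ('I_(p * q)), p, q, (@mxtens_unindex p q),
  (map_mx (fun v => (x^-1)%:C%C *: v) v),
  (map_mx (fun v => (y^-1)%:C%C *: v) w),
  (fun i k => s%:C%C * a i k), (fun k i => (x * y / s)%:C%C * b k i).
have nq (k : R) : 0 < k -> normc k%:C%C = k.
  by move=> k0; rewrite normc_real gtr0_norm.
have xyr : x * y / s * z <= Num.sqrt t.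
  have -> : x * y / s * z = y * (x * r * z) / Num.sqrt t.
    by rewrite /s; field; rewrite !gt_eqF.
  by rewrite ler_pdivrMr // -expr2 sqr_sqrtr ?(ltW ht) // ltW.
split.
  split; try exact: Mn_scale.
  - rewrite (ruan_scale rD) // nq ?invr_gt0 // mulrC ler_pdivrMr // mul1r.
    exact: ltW.
  - rewrite (ruan_scale rE) // nq ?invr_gt0 // mulrC ler_pdivrMr // mul1r.
    exact: ltW.
  - exact: @mxtens_unindex_inj p q.
split.
- have -> : Num.sqrt t = normc s%:C%C * r by rewrite nq // /s divfK ?gt_eqF.
  exact: op_bound_scale.
- apply: op_bound_le xyr _; first by rewrite !mulr_ge0 ?invr_ge0 // ltW.
  rewrite -{1}(nq (x * y / s)) ?divr_gt0 ?mulr_gt0 //; exact: op_bound_scale.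
move=> i j; rewrite uE bimulmxE; apply: eq_bigr => k _; apply: eq_bigr => l _.
rewrite !mxE (linear_onZ subD (elementary_tensor_linearl (subspaceZ subE _ (Ew _ _)))) //.
rewrite (linear_onZ subE (elementary_tensor_linearr (Dv _ _))) // !scalerA.
congr (_ *: _).
transitivity ((s * (x * y / s) * x^-1 * y^-1)%:C%C * (a i k * b l j)).
  rewrite (_ : s * _ * _ * _ = 1) ?mul1r //.
  by field; rewrite !gt_eqF.
by rewrite !rmorphM /=; ring.
Qed.

Lemma alg_proj_norm_ge0 n (u : 'M[T]_n) : Mn (alg_tensor D E) u -> 0 <= 'N u.
Proof.
by move=> /alg_proj_nonempty u0; exact: lb_le_inf u0 (@alg_proj_norm_lbound n u).
Qed.

Lemma alg_proj_ruan : ruan (alg_tensor D E) (alg_proj_norm D ND E NE).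
Proof.
split; [exact: alg_tensor_subspace|exact: alg_proj_norm_ge0| |].
  (* A failure would leave a midpoint [t] strictly between the maximum and the norm of the direct
     sum, but both summands have representations of weight [t]. *)
  move=> m n u u' Tu Tu'; rewrite leNgt; apply/negP => /midf_lt.
  set t := _ / 2 => -[]; rewrite gt_max => /andP[ut u't].
  apply/negP; rewrite -leNgt; apply: tensor_repr_le.
  by apply: tensor_repr_dsum; exact: alg_proj_norm_lt.
move=> m n a u b c d Tu c0 d0 ca db; rewrite leNgt; apply/negP.
have u0 := alg_proj_norm_ge0 Tu.
(* The constants for [a], [u] and [b] are enlarged in turn, because [tensor_repr_bimod] takes
   positive ones. *)
rewrite -mulrA => /exists_gt_mul_lt[]; first by rewrite mulr_ge0.
move=> c' cc'; have c'0 := le_lt_trans c0 cc'.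
rewrite mulrCA => /exists_gt_mul_lt[]; first by rewrite mulr_ge0 // ltW.
move=> t ut; rewrite mulrA mulrC => /exists_gt_mul_lt[].
  by rewrite mulr_ge0 // ltW // (le_lt_trans u0).
move=> d' dd'; have d'0 := le_lt_trans d0 dd'; apply/negP; rewrite -leNgt.
rewrite mulrC [t * _]mulrC; apply: tensor_repr_le; apply: tensor_repr_bimod => //.
- exact: op_bound_le c0 (ltW cc') ca.
- exact: op_bound_le d0 (ltW dd') db.
- exact: alg_proj_norm_lt.
Qed.

(** Identity matrices serve as [a] and [b]. This bounds the elements [x^* . x] of the Fourier space,
    and through them the functionals [mu . x^*]. *)
Lemma alg_proj_norm_amplify p q (v : 'M[U]_p) (w : 'M[V]_q) :
  Mn D v -> Mn E w -> 'N (amplify elt v w) <= ND v * NE w.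
Proof.
move=> Dv Ew; rewrite -[leRHS]mulr1 -[ND v]mul1r.
apply: (alg_proj_norm_le Dv Ew (@mxtens_unindex_inj p q) ler01 ler01
  (@op_bound_id R _) (@op_bound_id R _)) => i j.
rewrite mxE /bimul (bigD1 i) //= [X in _ + X]big1 ?addr0 => [|k ki].
  rewrite (bigD1 j) //= !eqxx mulr1 scale1r big1 ?addr0 // => l lj.
  by rewrite (negbTE lj) mulr0 scale0r.
by apply: big1 => l _; rewrite eq_sym (negbTE ki) mul0r scale0r.
Qed.

End AlgebraicTensor.

(** * Limits of complex sequences *)

Lemma real_cauchy_cvg (R : realType) (u : nat -> R) :
  (forall e, 0 < e -> exists K, forall k l, (K <= k)%N -> (K <= l)%N ->
    `|u k - u l| < e) -> cvg (u @ \oo).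
Proof.
move=> hu; apply/cauchy_cvgP/cauchy_exP => e e0; have [K h] := hu _ e0.
by exists (u K), K => // k /= Kk; rewrite /ball /=; apply: h.
Qed.

Lemma nneg_cvg0P (R : realType) (u : nat -> R) : (forall k, 0 <= u k) ->
  u @ \oo --> (0 : R) <->
  forall e, 0 < e -> exists K, forall k, (K <= k)%N -> u k < e.
Proof.
move=> u0; split=> [/cvgrPdist_lt hu e e0|hu].
  have [K _ h] := hu _ e0; exists K => k /h; rewrite /= sub0r normrN.
  by rewrite ger0_norm.
apply/cvgrPdist_lt => e e0; have [K h] := hu _ e0.
by exists K => // k /h; rewrite /= sub0r normrN ger0_norm.
Qed.

Lemma cvg_sumr (K : numFieldType) (V : normedModType K) (I : Type) (r : seq I)
    (F : I -> nat -> V) (l : I -> V) :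
  (forall i, F i @ \oo --> l i) ->
  (fun k => \sum_(i <- r) F i k) @ \oo --> \sum_(i <- r) l i.
Proof.
move=> Fl; elim: r => [|i r IH].
  under eq_cvg do rewrite big_nil; rewrite big_nil; exact: cvg_cst.
under eq_cvg do rewrite big_cons; rewrite big_cons; exact: cvgD.
Qed.

Section ComplexLimits.
Variable R : realType.
Local Notation C := R[i].

Lemma normr_normc (x : C) : `|x| = (normc x)%:C%C.
Proof. by case: x. Qed.

Lemma complex_cvgP (u : nat -> C^o) (l : C^o) : u @ \oo --> l <->
  forall e : R, 0 < e -> exists K, forall k, (K <= k)%N -> normc (u k - l) < e.
Proof.
split=> [/cvgrPdist_lt hu e e0|hu].
  have [|K _ h] := hu e%:C%C; first by rewrite (@ltcR R 0).
  by exists K => k /h /=; rewrite normr_normc ltcR normcB.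
apply/cvgrPdist_lt => e e0.
(* A positive element of [R[i]] is real, so real radii suffice. *)
have eE : e = (complex.Re e)%:C%C by case: e e0 => a b; rewrite ltcE /= => /andP[/eqP -> _].
have e0' : 0 < complex.Re e by move: e0; rewrite {1}eE (@ltcR R 0).
have [K h] := hu _ e0'; exists K => // k /h /=.
by rewrite eE normr_normc ltcR normcB.
Qed.

Lemma normc_Re (x : C) : `|complex.Re x| <= normc x.
Proof.
case: x => a b /=; rewrite -sqrtr_sqr ler_sqrt ?addr_ge0 ?sqr_ge0 //.
by rewrite lerDl sqr_ge0.
Qed.

Lemma normc_Im (x : C) : `|complex.Im x| <= normc x.
Proof.
case: x => a b /=; rewrite -sqrtr_sqr ler_sqrt ?addr_ge0 ?sqr_ge0 //.
by rewrite lerDr sqr_ge0.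
Qed.

Lemma normc_le_ReIm (x : C) : normc x <= `|complex.Re x| + `|complex.Im x|.
Proof.
case: x => a b /=; rewrite -[leRHS]ger0_norm ?addr_ge0 // -sqrtr_sqr.
rewrite ler_sqrt ?sqr_ge0 // sqrrD !real_normK ?num_real //.
by rewrite addrAC lerDl mulrn_wge0 // mulr_ge0.
Qed.

Lemma complex_cauchy_cvg (u : nat -> C^o) :
  (forall e : R, 0 < e -> exists K, forall k l, (K <= k)%N -> (K <= l)%N ->
    normc (u k - u l) < e) -> cvg (u @ \oo).
Proof.
move=> hu.
have /cvg_ex[/= x /cvgrPdist_lt hx] : cvg ((fun k => complex.Re (u k)) @ \oo).
  apply: real_cauchy_cvg => e /hu[K h]; exists K => k l Kk Kl.
  apply: le_lt_trans (h _ _ Kk Kl); rewrite -(raddfB (@complex.Re R)).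
  exact: normc_Re.
have /cvg_ex[/= y /cvgrPdist_lt hy] : cvg ((fun k => complex.Im (u k)) @ \oo).
  apply: real_cauchy_cvg => e /hu[K h]; exists K => k l Kk Kl.
  apply: le_lt_trans (h _ _ Kk Kl); rewrite -(raddfB (@complex.Im R)).
  exact: normc_Im.
apply/cvg_ex; exists (x +i* y)%C; apply/complex_cvgP => e e0.
have e20 : 0 < e / 2 by rewrite divr_gt0.
have [K _ hK] := hx _ e20; have [L _ hL] := hy _ e20.
exists (maxn K L) => k; rewrite geq_max => /andP[/hK /= hKk /hL /= hLk].
apply: le_lt_trans (normc_le_ReIm _) _; rewrite [e]splitr !raddfB /=.
by rewrite ltrD // distrC.
Qed.

Lemma complex_cvg_normc (u : nat -> C^o) (l : C^o) : u @ \oo --> l ->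
  (fun k => normc (u k)) @ \oo --> normc l.
Proof.
move=> /complex_cvgP hu; apply/cvgrPdist_lt => e /hu[K h].
exists K => // k /h; apply: le_lt_trans; rewrite /= ler_norml; apply/andP; split.
  rewrite lerNl opprB lerBlDr -{1}[u k](subrK l); exact: le_normcD.
by rewrite normcB lerBlDr -{1}[l](subrK (u k)); exact: le_normcD.
Qed.

(** Both sides of the defining inequality are continuous in finitely many entries. This carries
    pairing estimates from algebraic tensors to the completion. *)
Lemma complex_cvg_op_bound (I J : finType) (c : nat -> R) (d : R)
    (a : nat -> I -> J -> C) (b : I -> J -> C) :
  c @ \oo --> d -> (forall i j, (fun k => a k i j : C^o) @ \oo --> (b i j : C^o)) ->
  (forall k, op_bound (c k) (a k)) -> op_bound d b.
Proof.
move=> cd ab ca v.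
have sqb : (fun k => sqnorm (fun i => \sum_j a k i j * v j)) @ \oo -->
    sqnorm (fun i => \sum_j b i j * v j).
  apply: (@cvg_sumr R R^o _ _ (fun i k => normc (\sum_j a k i j * v j) ^+ 2)) => i.
  have h : (fun k => normc (\sum_j a k i j * v j)) @ \oo -->
      normc (\sum_j b i j * v j).
    apply: (@complex_cvg_normc (fun k => \sum_j a k i j * v j)).
    apply: (@cvg_sumr C C^o _ _ (fun j k => a k i j * v j)) => j.
    apply: (@cvgM C); [exact: ab|exact: cvg_cst].
  rewrite expr2; exact: (cvgM h h).
have sqd : (fun k => c k ^+ 2 * sqnorm v) @ \oo --> d ^+ 2 * sqnorm v.
  by apply: cvgM; [rewrite expr2; exact: (cvgM cd cd)|exact: cvg_cst].
apply: ler_cvg_to sqb sqd _; near=> k; exact: ca.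
Unshelve. all: by end_near. Qed.

End ComplexLimits.

(** * Completions *)

Section Completion.
Variables (R : realType) (T : lmodType R[i]) (T0 : set T) (N0 : matrix_norm R T).
Hypothesis r0 : ruan T0 N0.
Let subT := ruan_sub r0.

(** Stated for any matrix seminorm; for the projective norm it unfolds to [proj_norm]. *)
Definition completion_norm : matrix_norm R (nat -> T) := fun n xi =>
  lim ((fun k => N0 (map_mx (fun u : nat -> T => u k) xi)) @ \oo).

Local Notation PT := (cauchy_in T0 N0).
Local Notation PN := completion_norm.
Local Notation row_at xi k := (map_mx (fun u : nat -> T => u k) xi).

Lemma Mn_const (V : Type) (D : set V) n (x : V) :
  D x -> Mn D (const_mx x : 'M[V]_n).
Proof. by move=> Dx i j; rewrite mxE. Qed.

Lemma Mn_at n (xi : 'M[nat -> T]_n) k : Mn PT xi -> Mn T0 (row_at xi k).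
Proof. by move=> h i j; rewrite mxE; exact: (h i j).1. Qed.

Lemma cauchy_mx n (xi : 'M[nat -> T]_n) : Mn PT xi -> forall e : R, 0 < e ->
  exists K, forall k l, (K <= k)%N -> (K <= l)%N ->
    N0 (row_at xi k - row_at xi l) < e.
Proof.
(* Each of the [n * n] entries contributes at most [e']; the added 1 covers [n = 0] and makes the
   total strictly less than [e]. *)
move=> h e e0; pose e' := e / ((n * n)%:R + 1).
have n1 : 0 < (n * n)%:R + 1 :> R by rewrite ltr_wpDl.
have e'0 : 0 < e' by rewrite divr_gt0.
have /choice[K hK] : forall ij : 'I_n * 'I_n, exists K, forall k l,
    (K <= k)%N -> (K <= l)%N ->
    N0 (const_mx (xi ij.1 ij.2 k - xi ij.1 ij.2 l) : 'M[T]_1) < e'.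
  by move=> ij; exact: (h ij.1 ij.2).2.
exists (\max_ij K ij) => k l Kk Kl.
have Dkl : Mn T0 (row_at xi k - row_at xi l) by apply: Mn_sub => //; exact: Mn_at.
apply: le_lt_trans (ruan_le_sum_entries r0 Dkl) _.
apply: (@le_lt_trans _ _ (\sum_(i < n) \sum_(j < n) e')).
  apply: ler_sum => i _; apply: ler_sum => j _; rewrite !mxE; apply: ltW.
  by apply: (hK (i, j)); [apply: leq_trans Kk|apply: leq_trans Kl];
    exact: (leq_bigmax (i, j)).
rewrite !sumr_const !card_ord -mulrnA -mulr_natr /e' mulrAC ltr_pdivrMr //.
by rewrite ltr_pM2l // ltrDl.
Qed.

Lemma completion_norm_cvg n (xi : 'M[nat -> T]_n) : Mn PT xi ->
  (fun k => N0 (row_at xi k)) @ \oo --> PN xi.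
Proof.
move=> h; apply: real_cauchy_cvg => e /(cauchy_mx h)[K hK].
exists K => k l Kk Kl; apply: le_lt_trans (hK _ _ Kk Kl).
by apply: (ruan_dist_le r0); exact: Mn_at.
Qed.

Lemma completion_norm_le n (xi : 'M[nat -> T]_n) c K : Mn PT xi ->
  (forall k, (K <= k)%N -> N0 (row_at xi k) <= c) -> PN xi <= c.
Proof.
move=> /completion_norm_cvg h hK; apply: (cvgr_to_le h).
by exists K => // k; exact: hK.
Qed.

Lemma cauchy_subspace : linear_subspace PT.
Proof.
  split.
    split=> [k|e e0]; first exact: subT.1.
    exists 0 => k l _ _; rewrite subrr; have -> : const_mx 0 = 0 :> 'M[T]_1.
      by apply/matrixP => i j; rewrite !mxE.
    by rewrite (ruan_zero r0).
  move=> c x y [Tx hx] [Ty hy]; split=> [k|e e0]; first exact: subT.2.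
  have nc0 : 0 < normc c + 1 by rewrite ltr_wpDl // normc_ge0.
  have [|K hK] := hx (e / 2 / (normc c + 1)); first by rewrite !divr_gt0.
  have [|L hL] := hy (e / 2); first by rewrite divr_gt0.
  exists (maxn K L) => k l; rewrite !geq_max => /andP[Kk Lk] /andP[Kl Ll].
  have -> : const_mx ((c *: x + y) k - (c *: x + y) l) =
      map_mx (fun v => c *: v) (const_mx (x k - x l)) + const_mx (y k - y l)
      :> 'M[T]_1.
    apply/matrixP => i j; rewrite !mxE !fctE scalerBr opprD.
    by rewrite addrACA.
  have Tx' : Mn T0 (const_mx (x k - x l) : 'M[T]_1).
    by apply: Mn_const; exact: subspaceB.
  have Ty' : Mn T0 (const_mx (y k - y l) : 'M[T]_1).
    by apply: Mn_const; exact: subspaceB.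
  apply: le_lt_trans (ruan_triangle r0 (Mn_scale subT c Tx') Ty') _.
  rewrite (ruan_scale r0) // [e]splitr ltr_leD //; last exact/ltW/hL.
  apply: (@le_lt_trans _ _ ((normc c + 1) * N0 (const_mx (x k - x l) : 'M[T]_1))).
    by rewrite ler_wpM2r ?(ruan_ge0 r0) // lerDl.
  by rewrite mulrC -ltr_pdivlMr // hK.
Qed.

(** The inequalities for [N0] pass to the limit. Null sequences get norm 0, which [ruan], describing
    seminorms, permits. *)
Lemma completion_ruan : ruan PT PN.
Proof.
split; first exact: cauchy_subspace.
- move=> n x hx; apply: (cvgr_to_ge (completion_norm_cvg hx) _).
  by exists 0 => // k _; apply: (ruan_ge0 r0); exact: Mn_at.
- move=> m n x y hx hy; rewrite leNgt; apply/negP => /midf_lt.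
  set t := _ / 2 => -[]; rewrite gt_max => /andP[xt yt].
  apply/negP; rewrite -leNgt.
  have hxy := Mn_block cauchy_subspace hx hy.
  apply: (cvgr_to_le (completion_norm_cvg hxy) _).
  have [K _ hK] := cvgr_lt _ (completion_norm_cvg hx) _ xt.
  have [L _ hL] := cvgr_lt _ (completion_norm_cvg hy) _ yt.
  exists (maxn K L) => // k /=; rewrite geq_max => /andP[/hK /= xkt /hL /= ykt].
  rewrite (linear_on_block cauchy_subspace) //.
  apply: le_trans (ruan_dsum_le r0 (Mn_at k hx) (Mn_at k hy)) _.
  by rewrite ge_max !ltW.
- move=> m n a x b c d hx c0 d0 ca db.
  have hb : Mn PT (bimulmx a x b).
    by move=> i j; apply: Mn_bimulmx; [exact: cauchy_subspace|exact: hx].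
  have lim : (fun k => c * N0 (row_at x k) * d) @ \oo --> c * PN x * d.
    apply: cvgM; last exact: cvg_cst.
    by apply: cvgM; [exact: cvg_cst|exact: completion_norm_cvg].
  apply: (ler_cvg_to (completion_norm_cvg hb) lim).
  exists 0 => // k _; rewrite (linear_on_bimulmx cauchy_subspace) //.
  exact: ruan_bimod r0 _ _ _ _ _ _ _ (Mn_at k hx) c0 d0 ca db.
Qed.

Lemma cauchy_cst (x : T) : T0 x -> PT (fun=> x).
Proof.
move=> Tx; split=> // e e0; exists 0 => k l _ _; rewrite subrr.
have -> : const_mx 0 = 0 :> 'M[T]_1 by apply/matrixP => i j; rewrite !mxE.
by rewrite (ruan_zero r0).
Qed.

Lemma completion_norm_cst n (x : 'M[T]_n) : Mn T0 x ->
  PN (map_mx (fun u _ => u) x) = N0 x.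
Proof.
move=> Tx; apply: cvg_lim => //; apply: cvg_near_cst; exists 0 => // k _.
by congr N0; apply/matrixP => i j; rewrite !mxE.
Qed.

(** Density of the constant sequences, the embedded copy of [T0]: a Cauchy sequence is approximated
    by its own terms. *)
Lemma completion_norm_tail (x : nat -> T) e : PT x -> 0 < e -> exists K,
  forall k, (K <= k)%N ->
  PN (const_mx ((fun=> x k) - x) : 'M[nat -> T]_1) <= e.
Proof.
move=> hx e0; have [K hK] := hx.2 _ e0; exists K => k Kk.
apply: (@completion_norm_le _ _ _ K) => [|l Kl].
  apply: Mn_const; apply: (subspaceB cauchy_subspace) => //.
  by apply: cauchy_cst; exact: hx.1.
rewrite map_const_mx; apply: ltW; exact: hK.
Qed.

End Completion.

Definition norm_complete (R : realType) (V : lmodType R[i]) (D : set V)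
    (N : matrix_norm R V) := forall u, cauchy_in D N u ->
  exists2 l, D l & (fun k => N 1 (const_mx (u k - l))) @ \oo --> (0 : R).

(** A diagonal argument: [s k] is a term of [xi k] so far out that its constant sequence is within
    [1 / (k + 1)] of [xi k]. Then [s] is Cauchy by a three-term estimate and is a limit of [xi]. *)
Lemma completion_complete (R : realType) (T : lmodType R[i]) (T0 : set T)
    (N0 : matrix_norm R T) : ruan T0 N0 ->
  norm_complete (cauchy_in T0 N0) (completion_norm N0).
Proof.
move=> r0 xi [hxi cxi].
pose PT := cauchy_in T0 N0.
have rP := completion_ruan r0; have subP : linear_subspace PT := ruan_sub rP.
have subT := ruan_sub r0.
pose nm (z : nat -> T) := completion_norm N0 (const_mx z : 'M[nat -> T]_1).
have nmD x y : PT x -> PT y -> nm (x + y) <= nm x + nm y.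
  move=> hx hy; have := ruan_triangle rP (@Mn_const _ _ 1 _ hx) (@Mn_const _ _ 1 _ hy).
  apply: le_trans; rewrite le_eqVlt; apply/orP; left; apply/eqP.
  by congr (completion_norm _ _); apply/matrixP => i j; rewrite !mxE.
have nmC x y : PT x -> PT y -> nm (x - y) = nm (y - x).
  move=> hx hy; have := ruan_subC rP (@Mn_const _ _ 1 _ hx) (@Mn_const _ _ 1 _ hy).
  have e (a b : nat -> T) : const_mx a - const_mx b = const_mx (a - b) :> 'M[nat -> T]_1.
    by apply/matrixP => i j; rewrite !mxE.
  by rewrite !e.
have /choice[K hK] : forall k, exists K, forall m, (K <= m)%N ->
    nm ((fun=> xi k m) - xi k) <= (k.+1%:R)^-1.
  move=> k; have k0 : 0 < (k.+1%:R)^-1 :> R by rewrite invr_gt0.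
  have h := completion_norm_tail r0 (hxi k) k0; exact: h.
pose s k := xi k (K k).
have hs k : PT (fun=> s k) by apply: cauchy_cst => //; exact: (hxi k).1.
have sxi k : nm ((fun=> s k) - xi k) <= (k.+1%:R)^-1 by exact: hK.
have small (e : R) : 0 < e -> exists M, forall k, (M <= k)%N -> (k.+1%:R)^-1 < e.
  move=> e0; have [M _ hM] := near_infty_natSinv_lt (PosNum e0).
  by exists M => k; exact: hM.
have B x y : PT x -> PT y -> PT (x - y) by exact: subspaceB.
have A x y : PT x -> PT y -> PT (x + y) by exact: subspaceD.
have cs : PT s.
  split=> [k|e e0]; first exact: (hxi k).1.
  have e30 : 0 < e / 3 by rewrite divr_gt0.
  have [M hM] := small _ e30; have [L hL] := cxi _ e30.
  exists (maxn M L) => k l; rewrite !geq_max => /andP[Mk Lk] /andP[Ml Ll].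
  have -> : N0 1 (const_mx (s k - s l)) = nm ((fun=> s k) - (fun=> s l)).
    rewrite -(@completion_norm_cst _ _ T0); last first.
      by apply: Mn_const; apply: subspaceB => //; exact: (hxi _).1.
    by congr (completion_norm _ _); apply/matrixP => i j; rewrite !mxE.
  have -> : (fun=> s k) - (fun=> s l) = ((fun=> s k) - xi k) +
      ((xi k - xi l) + (xi l - (fun=> s l))).
    by rewrite addrA subrKA addrA subrK.
  apply: le_lt_trans (nmD _ _ (B _ _ (hs k) (hxi k)) _) _.
    exact: A _ _ (B _ _ (hxi k) (hxi l)) (B _ _ (hxi l) (hs l)).
  have {1}-> : e = e / 3 + (e / 3 + e / 3) by field.
  apply: ler_ltD; first by apply: le_trans (sxi k) _; exact/ltW/hM.
  apply: le_lt_trans (nmD _ _ (B _ _ (hxi k) (hxi l)) (B _ _ (hxi l) (hs l))) _.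
  apply: ltrD; first exact: hL.
  rewrite (nmC _ _ (hxi l) (hs l)).
  by apply: le_lt_trans (sxi l) _; exact: hM.
exists s => //; apply/nneg_cvg0P => [k|e e0].
  by apply: (ruan_ge0 rP); apply: Mn_const; exact: subspaceB.
have e20 : 0 < e / 2 by rewrite divr_gt0.
have [M hM] := small _ e20.
have [L hL] := completion_norm_tail r0 cs e20.
exists (maxn M L) => k; rewrite geq_max => /andP[Mk Lk].
have -> : xi k - s = (xi k - (fun=> s k)) + ((fun=> s k) - s).
  by rewrite addrA subrK.
apply: le_lt_trans (nmD _ _ (B _ _ (hxi k) (hs k)) (B _ _ (hs k) cs)) _.
rewrite [e]splitr (nmC _ _ (hxi k) (hs k)); apply: ltr_leD; last exact: hL.
by apply: le_lt_trans (sxi k) _; exact: hM.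
Qed.

(** * Quotients *)

Section QuotientNorm.
Variables (R : realType) (V W : lmodType R[i]).
Variables (D : set V) (N : matrix_norm R V) (P : V -> W).
Hypotheses (rN : ruan D N) (linP : linear_on D P).
Let subD := ruan_sub rN.

(** The quotient of [D] by the kernel of [P], realized on the image of [D] in [W]. *)
Definition quotient_norm : matrix_norm R W := fun n phi =>
  inf [set t | exists xi : 'M[V]_n,
    [/\ Mn D xi, map_mx P xi = phi & t = N xi]].

Local Notation NQ := quotient_norm.

Lemma quotient_lift n (phi : 'M[W]_n) : Mn (P @` D) phi ->
  exists2 xi, Mn D xi & map_mx P xi = phi.
Proof.
move=> h; have /choice[x hx] : forall ij : 'I_n * 'I_n, exists x,
    D x /\ P x = phi ij.1 ij.2.
  by move=> ij; have [x Dx xE] := h ij.1 ij.2; exists x.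
exists (\matrix_(i, j) x (i, j)).
  by move=> i j; rewrite mxE; exact: (hx (i, j)).1.
by apply/matrixP => i j; rewrite !mxE; exact: (hx (i, j)).2.
Qed.

Let lb0 n (phi : 'M[W]_n) : lbound [set t | exists xi : 'M[V]_n,
  [/\ Mn D xi, map_mx P xi = phi & t = N xi]] 0.
Proof. by move=> _ [xi [h _ ->]]; exact: ruan_ge0 rN _ _ h. Qed.

Lemma quotient_norm_le n (xi : 'M[V]_n) : Mn D xi -> NQ (map_mx P xi) <= N xi.
Proof.
by move=> h; apply: ge_inf; [exists 0; exact: lb0|exists xi].
Qed.

Let nonempty n (phi : 'M[W]_n) : Mn (P @` D) phi -> [set t | exists xi : 'M[V]_n,
  [/\ Mn D xi, map_mx P xi = phi & t = N xi]] !=set0.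
Proof. by move=> /quotient_lift[xi h xiE]; exists (N xi), xi. Qed.

Lemma quotient_norm_ge0 n (phi : 'M[W]_n) : Mn (P @` D) phi -> 0 <= NQ phi.
Proof. by move=> /nonempty h; exact: lb_le_inf h (@lb0 n phi). Qed.

Lemma quotient_norm_lt n (phi : 'M[W]_n) t : Mn (P @` D) phi -> NQ phi < t ->
  exists xi, [/\ Mn D xi, map_mx P xi = phi & N xi < t].
Proof. by move=> /nonempty h /(inf_lt h)[_ [xi [? ? ->]] ?]; exists xi. Qed.

Lemma image_subspace : linear_subspace (P @` D).
Proof.
split; first by exists 0; [exact: subD.1|exact: (linear_on0 subD linP)].
move=> c _ _ [x Dx <-] [y Dy <-]; exists (c *: x + y); first exact: subD.2.
exact: linP.
Qed.

(** Each inequality is lifted to representatives of norm slightly above the quotient norm. For a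
    general [P] the result is only a seminorm; definiteness is a separate matter. *)
Lemma quotient_ruan : ruan (P @` D) NQ.
Proof.
split; [exact: image_subspace|exact: quotient_norm_ge0| |].
  move=> m n x y hx hy; rewrite leNgt; apply/negP => /midf_lt.
  set t := _ / 2 => -[]; rewrite gt_max => /andP[xt yt].
  apply/negP; rewrite -leNgt.
  have [xi [Dxi <- xit]] := quotient_norm_lt hx xt.
  have [eta [Deta <- etat]] := quotient_norm_lt hy yt.
  rewrite -(linear_on_block subD linP).
  apply: le_trans (quotient_norm_le (Mn_block subD Dxi Deta)) _.
  apply: le_trans (ruan_dsum_le rN Dxi Deta) _.
  by rewrite ge_max !ltW.
move=> m n a x b c d hx c0 d0 ca db; rewrite mulrAC leNgt; apply/negP.
rewrite mulrC => /exists_gt_mul_lt[]; first by rewrite mulr_ge0.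
move=> t xt; apply/negP; rewrite -leNgt.
have [xi [Dxi <- xit]] := quotient_norm_lt hx xt.
rewrite -(linear_on_bimulmx subD linP) //.
have Dax : Mn D (bimulmx a xi b).
  by move=> i j; apply: Mn_bimulmx => //; exact: Dxi.
apply: le_trans (quotient_norm_le Dax) _.
apply: le_trans (ruan_bimod rN Dxi c0 d0 ca db) _.
by rewrite [leRHS]mulrC mulrAC ler_wpM2l ?mulr_ge0 // ltW.
Qed.

(* An absolutely convergent lift: along a subsequence with increments below
   [2^-k], lift the increments and sum them. *)
Lemma quotient_complete : norm_complete D N -> norm_complete (P @` D) NQ.
Proof.
move=> cD u [hu cu].
have rQ := quotient_ruan; have subQ := image_subspace.
have pow0 k : 0 < (2^-1 : R) ^+ k by rewrite exprn_gt0 ?invr_gt0.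
have /choice[f hf] : forall j, exists m, forall k l, (m <= k)%N -> (m <= l)%N ->
    NQ (const_mx (u k - u l) : 'M[W]_1) < 2^-1 ^+ j.
  by move=> j; exact: cu.
(* Partial sums make [g] nondecreasing with [f j <= g j], so that the increment from [g j] to
   [g j.+1] has norm below [2^-1 ^+ j]. *)
pose g j := (\sum_(i < j.+1) f i)%N.
have fg j : (f j <= g j)%N by rewrite /g big_ord_recr leq_addl.
have gS j : (g j <= g j.+1)%N by rewrite /g [in leqRHS]big_ord_recr leq_addr.
have cstE (x y : V) : const_mx x + const_mx y = const_mx (x + y) :> 'M[V]_1.
  by apply/matrixP => i j; rewrite !mxE.
have /choice[z hz] : forall j, exists z, [/\ D z, P z = u (g j.+1) - u (g j) &
    N (const_mx z : 'M[V]_1) < 2^-1 ^+ j].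
  move=> j; have hj : Mn (P @` D) (const_mx (u (g j.+1) - u (g j)) : 'M[W]_1).
    by apply: Mn_const; exact: subspaceB.
  have [|xi [Dxi xiE xij]] := quotient_norm_lt hj (t := 2^-1 ^+ j).
    by apply: hf => //; exact: leq_trans (gS j).
  exists (xi 0 0); split=> //; first by have := congr1 (fun M : 'M[W]_1 => M 0 0) xiE; rewrite !mxE.
  apply: le_lt_trans xij; rewrite le_eqVlt; apply/orP; left; apply/eqP.
  by congr N; apply/matrixP => i k; rewrite mxE !ord1.
have [z0 Dz0 Pz0] := hu (g 0).
pose s k := z0 + \sum_(j < k) z j.
have Ds k : D (s k).
  by apply: subspaceD => //; apply: subspace_sum => // j; have [] := hz j.
have sS k : s k.+1 = s k + z k by rewrite /s big_ord_recr addrA.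
have Ps k : P (s k) = u (g k).
  elim: k => [|k IH]; first by rewrite /s big_ord0 addr0.
  have [Dz Pz _] := hz k.
  by rewrite sS (linear_onD linP (Ds k) Dz) IH Pz addrC subrK.
(* The sum of [2^-1 ^+ j] over [m <= j < m + d], in closed form. *)
have tail m d : N (const_mx (s (m + d)%N - s m) : 'M[V]_1) <=
    2 * 2^-1 ^+ m - 2 * 2^-1 ^+ (m + d).
  elim: d => [|d IH].
    have c0 : const_mx 0 = 0 :> 'M[V]_1 by apply/matrixP => i j; rewrite !mxE.
    by rewrite addn0 !subrr c0 (ruan_zero rN).
  have [Dz _ zd] := hz (m + d)%N.
  have -> : s (m + d.+1)%N - s m = (s (m + d)%N - s m) + z (m + d)%N.
    by rewrite addnS sS addrAC.
  rewrite -cstE; apply: le_trans (ruan_triangle rN _ _) _.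
  - by apply: Mn_const; exact: subspaceB.
  - exact: Mn_const.
  apply: le_trans (lerD IH (ltW zd)) _.
  by rewrite addnS exprS; lra.
have tail2 m k : (m <= k)%N ->
    N (const_mx (s k - s m) : 'M[V]_1) <= 2 * 2^-1 ^+ m.
  move=> mk; rewrite -(subnKC mk); apply: le_trans (tail _ _) _.
  by rewrite gerBl mulr_ge0 // ltW.
have small (e : R) : 0 < e -> exists M, forall k, (M <= k)%N -> 2^-1 ^+ k < e.
  move=> e0; have /cvgrPdist_lt/(_ _ e0)[M _ hM] : 2^-1 ^+ k @[k --> \oo] --> (0:R).
    by apply: cvg_expr; rewrite gtr0_norm ?invr_gt0 // invf_lt1 // ltr1n.
  by exists M => k /hM; rewrite /= sub0r normrN gtr0_norm.
have cs : cauchy_in D N s.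
  (* Both distances to [s M] are at most [2 * 2^-1 ^+ M], hence the 4. *)
  split=> // e e0; have [|M hM] := small (e / 4); first by rewrite divr_gt0.
  exists M => k l Mk Ml.
  have -> : s k - s l = (s k - s M) + (s M - s l) by rewrite addrA subrK.
  have B m k' : Mn D (const_mx (s m - s k') : 'M[V]_1).
    by apply: Mn_const; exact: subspaceB.
  rewrite -cstE; apply: le_lt_trans (ruan_triangle rN (B _ _) (B _ _)) _.
  have BB x y : N (const_mx (x - y) : 'M[V]_1) = N (const_mx x - const_mx y : 'M[V]_1).
    by congr N; apply/matrixP => i j; rewrite !mxE.
  rewrite [X in _ + X]BB (ruan_subC rN) -?BB; try exact: Mn_const.
  have := tail2 _ _ Mk; have := tail2 _ _ Ml; have := hM M (leqnn M).
  by rewrite ltr_pdivlMr //; lra.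
have [l Dl sl] := cD _ cs.
exists (P l); first by exists l.
have hN k : 0 <= N (const_mx (s k - l) : 'M[V]_1).
  by apply: (ruan_ge0 rN); apply: Mn_const; exact: subspaceB.
move/(nneg_cvg0P hN): sl => sl.
have SPl : (P @` D) (P l) by exists l.
apply/nneg_cvg0P => [k|e e0].
  by apply: quotient_norm_ge0; apply: Mn_const; exact: subspaceB.
have e20 : 0 < e / 2 by rewrite divr_gt0.
have [M hM] := small _ e20; have [L hL] := sl _ e20.
exists (f M) => k Mk; pose j := maxn M L.
have -> : u k - P l = (u k - u (g j)) + (u (g j) - P l) by rewrite addrA subrK.
have -> : const_mx ((u k - u (g j)) + (u (g j) - P l)) =
    const_mx (u k - u (g j)) + const_mx (u (g j) - P l) :> 'M[W]_1.
  by apply/matrixP => a b; rewrite !mxE.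
apply: le_lt_trans (ruan_triangle rQ _ _) _;
  try by apply: Mn_const; exact: subspaceB.
rewrite [e]splitr; apply: ltrD.
  apply: lt_trans (hM _ (leqnn M)); apply: hf => //.
  apply: leq_trans (fg M) _; rewrite /j.
  elim: (maxn M L) (leq_maxl M L) => [|i IH]; first by rewrite leqn0 => /eqP ->.
  by rewrite leq_eqVlt => /orP[/eqP -> //|]; rewrite ltnS => /IH/leq_trans; apply.
apply: le_lt_trans (hL j _); last exact: leq_maxr.
have -> : const_mx (u (g j) - P l) = map_mx P (const_mx (s j - l)) :> 'M[W]_1.
  by apply/matrixP => a b; rewrite !mxE (linear_onB subD linP) // Ps.
by apply: quotient_norm_le; apply: Mn_const; exact: subspaceB.
Qed.

End QuotientNorm.

(** * Images of completions under pointwise limits *)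

Section LimitMap.
Variables (R : realType) (T : lmodType R[i]) (T0 : set T) (N0 : matrix_norm R T).
Variables (I : Type) (ev : I -> T -> R[i]^o).
Hypotheses (r0 : ruan T0 N0) (lin_ev : forall i, linear_on T0 (ev i)).
Hypothesis bounded_ev : forall i, exists2 M : R, 0 <= M & forall t, T0 t ->
  normc (ev i t) <= M * N0 (const_mx t : 'M[T]_1).

Local Notation C := R[i].
Local Notation PT := (cauchy_in T0 N0).
Local Notation PN := (completion_norm N0).
Let subT := ruan_sub r0.
Let rP := completion_ruan r0.
Let subP : linear_subspace PT := ruan_sub rP.

(** Extends the bounded functionals [ev i] to Cauchy sequences; for the evaluations at points of [A]
    it unfolds to [fourier_map]. *)
Definition limit_map (xi : nat -> T) : I -> C^o :=
  fun i => lim ((fun k => ev i (xi k)) @ \oo).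

Local Notation S := (limit_map @` PT).
Local Notation NS := (quotient_norm PT PN limit_map).

Lemma limit_map_cvg xi i : PT xi ->
  (fun k => ev i (xi k)) @ \oo --> limit_map xi i.
Proof.
move=> [hxi cxi]; apply: complex_cauchy_cvg => e e0.
have [M M0 hM] := bounded_ev i; have M1 : 0 < M + 1 by rewrite ltr_wpDl.
have [|K hK] := cxi (e / (M + 1)); first by rewrite divr_gt0.
exists K => k l Kk Kl; have Tkl := subspaceB subT (hxi k) (hxi l).
rewrite -(linear_onB subT (@lin_ev i)) //; apply: le_lt_trans (hM _ Tkl) _.
apply: (@le_lt_trans _ _ ((M + 1) * N0 (const_mx (xi k - xi l) : 'M[T]_1))).
  by rewrite ler_wpM2r ?lerDl // (ruan_ge0 r0) //; exact: Mn_const.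
by rewrite mulrC -ltr_pdivlMr // hK.
Qed.

Lemma limit_map_eq xi i (l : C^o) :
  (fun k => ev i (xi k)) @ \oo --> l -> limit_map xi i = l.
Proof. by move=> h; apply: cvg_lim h; exact: norm_hausdorff. Qed.

Lemma limit_map_cst t : limit_map (fun=> t) = ev ^~ t.
Proof. by apply/funext => i; apply: limit_map_eq; exact: cvg_cst. Qed.

Lemma limit_map_linear : linear_on PT limit_map.
Proof.
move=> c x y hx hy; apply/funext => i; apply: limit_map_eq.
have -> : (fun k => ev i ((c *: x + y) k)) =
    (fun k => c *: ev i (x k) + ev i (y k)).
  by apply/funext => k; rewrite (lin_ev i) //; [exact: hx.1|exact: hy.1].
apply: cvgD; last exact: limit_map_cvg.
by apply: cvgZl_tmp; exact: limit_map_cvg.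
Qed.

Lemma limit_map_bound i : exists2 M : R, 0 <= M & forall xi, PT xi ->
  normc (limit_map xi i) <= M * PN (const_mx xi : 'M[nat -> T]_1).
Proof.
have [M M0 hM] := bounded_ev i; exists M => // xi hxi.
have h1 := complex_cvg_normc (limit_map_cvg (i := i) hxi).
have h2 : (fun k => M * N0 (const_mx (xi k) : 'M[T]_1)) @ \oo -->
    M * PN (const_mx xi : 'M[nat -> T]_1).
  apply: cvgM; first exact: cvg_cst.
  have := completion_norm_cvg r0 (@Mn_const _ _ 1 _ hxi).
  by under eq_fun do rewrite map_const_mx.
by apply: (ler_cvg_to h1 h2); exists 0 => // k _; apply: hM; exact: hxi.1.
Qed.

Lemma limit_map_ruan : ruan S NS.
Proof. exact: quotient_ruan rP limit_map_linear. Qed.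

Lemma limit_map_operator_space : operator_space S NS.
Proof.
apply: ruan_operator_space; [exact: limit_map_ruan| |]; last first.
  exact: quotient_complete rP limit_map_linear (completion_complete r0).
move=> n phi Sphi phi0; apply/matrixP => i j; rewrite mxE; apply/funext => a.
apply: Normc.eq0_normc; apply/eqP; rewrite eq_le normc_ge0 andbT leNgt.
apply/negP => h; have [M M0 hM] := limit_map_bound a.
have M1 : 0 < M + 1 by rewrite ltr_wpDl.
(* A matrix of norm 0 has lifts of arbitrarily small norm, while every lift bounds the value at [a]
   up to the constant [M]; this lift is chosen too small for that. *)
have [|xi [hxi xiE xil]] := quotient_norm_lt (N := PN) Sphi
  (t := normc (phi i j a) / (M + 1)).
  by rewrite phi0 divr_gt0.
move: xil; rewrite ltr_pdivlMr //; apply/negP; rewrite -leNgt -xiE mxE.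
apply: le_trans (hM _ (hxi i j)) _; rewrite mulrC.
have ent := ruan_entry_le rP i j hxi.
have xi0 : 0 <= PN xi by exact: (ruan_ge0 rP).
by apply: ler_pM => //; rewrite ?lerDl // (ruan_ge0 rP) //; exact: Mn_const (hxi i j).
Qed.

Lemma image_cst t : T0 t -> S (ev ^~ t).
Proof.
by move=> Tt; exists (fun=> t); [exact: cauchy_cst|exact: limit_map_cst].
Qed.

Lemma image_cst_norm n (u : 'M[T]_n) : Mn T0 u ->
  NS (map_mx (fun t => ev ^~ t) u) <= N0 u.
Proof.
move=> Tu; have hu : Mn PT (map_mx (fun t (_ : nat) => t) u).
  by move=> i j; rewrite mxE; exact: cauchy_cst.
apply: le_trans (_ : PN (map_mx (fun t (_ : nat) => t) u) <= _); last first.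
  by rewrite (@completion_norm_cst _ _ T0).
apply: le_trans (quotient_norm_le limit_map rP hu); rewrite le_eqVlt.
apply/orP; left; apply/eqP; congr quotient_norm.
by apply/matrixP => i j; rewrite !mxE limit_map_cst.
Qed.

(** Images of constant sequences are dense in [S] for its own norm, not just pointwise. Bounded
    functionals on [S] are continuous for that norm, so this is the approximation they respect. *)
Lemma image_tail xi e : PT xi -> 0 < e -> exists K, forall k, (K <= k)%N ->
  NS (const_mx ((ev ^~ (xi k)) - limit_map xi) : 'M[I -> C^o]_1) <= e.
Proof.
move=> hxi e0; have [K hK] := completion_norm_tail r0 hxi e0.
exists K => k /hK; apply: le_trans.
have hk : PT (fun=> xi k) by apply: cauchy_cst => //; exact: hxi.1.
have hd : Mn PT (const_mx ((fun=> xi k) - xi) : 'M[nat -> T]_1).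
  by apply: Mn_const; exact: subspaceB.
apply: le_trans (quotient_norm_le limit_map rP hd); rewrite le_eqVlt.
apply/orP; left; apply/eqP; congr quotient_norm; apply/matrixP => i j.
by rewrite !mxE (linear_onB subP limit_map_linear) // limit_map_cst.
Qed.

(** * Families of maps lifted to the completion *)

Section Family.
Variables (m n : nat) (s : 'I_m -> 'I_n) (g : 'I_m -> 'I_m -> T -> T).
Variables (h : 'I_m -> 'I_m -> (I -> C^o) -> (I -> C^o)) (c : R).
Hypothesis gT : forall i j t, T0 t -> T0 (g i j t).
Hypothesis g_lin : forall i j, linear_on T0 (g i j).
Hypothesis g_bounded : forall i j, exists2 M, 0 <= M & forall t, T0 t ->
  N0 (const_mx (g i j t) : 'M[T]_1) <= M * N0 (const_mx t : 'M[T]_1).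
Hypothesis g_norm : forall u : 'M[T]_n, Mn T0 u ->
  N0 (\matrix_(i, j) g i j (u (s i) (s j))) <= c * N0 u.
Hypothesis gh : forall i j xi, PT xi ->
  limit_map (g i j \o xi) = h i j (limit_map xi).
Hypothesis c0 : 0 <= c.

Lemma cauchy_map i j xi : PT xi -> PT (g i j \o xi).
Proof.
move=> [hxi cxi]; split=> [k|e e0]; first exact: gT.
have [M M0 hM] := g_bounded i j; have M1 : 0 < M + 1 by rewrite ltr_wpDl.
have [|K hK] := cxi (e / (M + 1)); first by rewrite divr_gt0.
exists K => k l Kk Kl; have Tkl := subspaceB subT (hxi k) (hxi l).
rewrite /= -(linear_onB subT (@g_lin i j)) //; apply: le_lt_trans (hM _ Tkl) _.
apply: (@le_lt_trans _ _ ((M + 1) * N0 (const_mx (xi k - xi l) : 'M[T]_1))).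
  by rewrite ler_wpM2r ?lerDl // (ruan_ge0 r0) //; exact: Mn_const.
by rewrite mulrC -ltr_pdivlMr // hK.
Qed.

(** One statement for both module structures: amplification applies [h i j] to the entry of [phi]
    selected by one component [s] of the tensor index. The estimate for the lifts [g i j] on [T0]
    passes to Cauchy sequences by limits and to [S] by choosing representatives. *)
Lemma image_family (phi : 'M[I -> C^o]_n) : Mn S phi ->
  Mn S (\matrix_(i, j) h i j (phi (s i) (s j))) /\
  NS (\matrix_(i, j) h i j (phi (s i) (s j))) <= c * NS phi.
Proof.
move=> Sphi; split.
  move=> i j; rewrite mxE; have [xi hxi <-] := Sphi (s i) (s j).
  by rewrite -gh //; exists (g i j \o xi) => //; exact: cauchy_map.
rewrite leNgt; apply/negP; rewrite mulrC => /exists_gt_mul_lt[] // t.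
move=> /(quotient_norm_lt (N := PN) Sphi)[xi [hxi xiE xit]]; apply/negP; rewrite -leNgt.
pose eta := \matrix_(i, j) (g i j \o xi (s i) (s j)).
have heta : Mn PT eta by move=> i j; rewrite mxE; exact: cauchy_map.
have -> : \matrix_(i, j) h i j (phi (s i) (s j)) = map_mx limit_map eta.
  by apply/matrixP => i j; rewrite !mxE gh // -xiE mxE.
apply: le_trans (quotient_norm_le limit_map rP heta) _.
apply: (@le_trans _ _ (c * PN xi)); last first.
  by rewrite mulrC ler_wpM2r // ltW.
have lim : (fun k => c * N0 (map_mx (fun u : nat -> T => u k) xi)) @ \oo -->
    c * PN xi.
  by apply: cvgM; [exact: cvg_cst|exact: (completion_norm_cvg r0 hxi)].
apply: (ler_cvg_to (completion_norm_cvg r0 heta) lim); exists 0 => // k _.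
apply: le_trans (g_norm (Mn_at k hxi)); rewrite le_eqVlt.
by apply/orP; left; apply/eqP; congr N0; apply/matrixP => i j; rewrite !mxE.
Qed.

End Family.

End LimitMap.

(** * Maps between tensor products *)

Lemma linear_on_bimul (R : realType) (V W : lmodType R[i]) (D : set V)
    (f : V -> W) (I J K L : finType) (a : I -> K -> R[i]) (x : K -> L -> V)
    (b : L -> J -> R[i]) i j :
  linear_subspace D -> linear_on D f -> (forall k l, D (x k l)) ->
  f (bimul a x b i j) = bimul a (fun k l => f (x k l)) b i j.
Proof.
move=> subD lf Dx; rewrite /bimul (linear_on_sum subD lf); last first.
  by move=> k; apply: subspace_sum => // l; exact: subspaceZ.
apply: eq_bigr => k _; rewrite (linear_on_sum subD lf).
  by apply: eq_bigr => l _; rewrite (linear_onZ subD lf).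
by move=> l; exact: subspaceZ.
Qed.

Lemma bimul_tens1 (R : realType) (V : lmodType R[i]) (K L S : finType)
    (a : K -> R[i]) (b : L -> R[i]) (x : K * S -> L * S -> V) i j :
  \sum_k \sum_l ((if i == k.2 then a k.1 else 0) *
    (if l.2 == j then b l.1 else 0)) *: x k l =
  \sum_k \sum_l (a k * b l) *: x (k, i) (l, j).
Proof.
rewrite sum_pair; apply: eq_bigr => k _; rewrite (bigD1 i) //= eqxx.
rewrite [X in _ + X]big1 ?addr0 => [|k' ki].
  rewrite sum_pair; apply: eq_bigr => l _; rewrite (bigD1 j) //= eqxx.
  by rewrite big1 ?addr0 // => l' /negbTE ->; rewrite mulr0 scale0r.
by rewrite eq_sym (negbTE ki) big1 // => l _; rewrite mul0r scale0r.
Qed.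

Section TensorMaps.
Variables (R : realType) (U V : lmodType R[i]).
Variables (D : set U) (ND : matrix_norm R U) (E : set V) (NE : matrix_norm R V).
Hypotheses (rD : ruan D ND) (rE : ruan E NE).
Local Notation C := R[i].
Local Notation T := (tensor_ambient U V).
Local Notation elt := (elementary_tensor D E).
Local Notation T0 := (alg_tensor D E).
Local Notation N0 := (alg_proj_norm D ND E NE).
Let rT := alg_proj_ruan rD rE.
Let subT := ruan_sub rT.

Lemma alg_tensor_ext (W : lmodType C) (f g : T -> W) :
  linear_on T0 f -> linear_on T0 g ->
  (forall x y, D x -> E y -> f (elt x y) = g (elt x y)) ->
  forall u, T0 u -> f u = g u.
Proof.
move=> lf lg fg u [n [x [y [Dx Ey ->]]]].
have Telt i : T0 (elt (x i) (y i)) by exact: alg_tensor_elementary.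
rewrite (linear_on_sum subT lf) // (linear_on_sum subT lg) //.
by apply: eq_bigr => i _; exact: fg.
Qed.

(* The tensor product [m (x) q]; it must send non-bilinear [B] to [0] even when
   [B (m f) (q x)] happens to be bilinear. *)
Definition tensor_map (m : U -> U) (q : V -> V) (u : T) : T :=
  fun B => if `[< bilinear_on D E B >] then u (fun f x => B (m f) (q x)) else 0.

Lemma tensor_map_linear m q : linear_on T0 (tensor_map m q).
Proof.
move=> c x y _ _; apply/funext => B; rewrite !fctE /tensor_map.
by case: asboolP => // _; rewrite scaler0 addr0.
Qed.

Lemma bilinear_comp (W : lmodType C) (B : U -> V -> W) (m : U -> U) (q : V -> V) :
  (forall f, D f -> D (m f)) -> linear_on D m ->
  (forall x, E x -> E (q x)) -> linear_on E q ->
  bilinear_on D E B -> bilinear_on D E (fun f x => B (m f) (q x)).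
Proof.
move=> mD lm qE lq [B1 B2]; split=> [y Ey c f g Df Dg|f Df c x y Ex Ey].
  by rewrite lm // (B1 _ (qE _ Ey)) //; exact: mD.
by rewrite lq // (B2 _ (mD _ Df)) //; exact: qE.
Qed.

Lemma tensor_map_elementary m q x y :
  (forall f, D f -> D (m f)) -> linear_on D m ->
  (forall x, E x -> E (q x)) -> linear_on E q ->
  tensor_map m q (elt x y) = elt (m x) (q y).
Proof.
move=> mD lm qE lq; apply/funext => B; rewrite /tensor_map /elementary_tensor.
case: (asboolP (bilinear_on D E B)) => // hB.
by case: asboolP => // -[]; exact: bilinear_comp.
Qed.

Lemma tensor_map_bilinear m q u (B : U -> V -> C^o) : bilinear_on D E B ->
  tensor_map m q u B = u (fun f x => B (m f) (q x)).
Proof. by move=> hB; rewrite /tensor_map; case: asboolP. Qed.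

Lemma tensor_map_alg m q u :
  (forall f, D f -> D (m f)) -> linear_on D m ->
  (forall x, E x -> E (q x)) -> linear_on E q ->
  T0 u -> T0 (tensor_map m q u).
Proof.
move=> mD lm qE lq [n [x [y [Dx Ey ->]]]].
have Telt i : T0 (elt (x i) (y i)) by exact: alg_tensor_elementary.
rewrite (linear_on_sum subT (@tensor_map_linear m q)) //.
apply: subspace_sum => // i; rewrite tensor_map_elementary //.
by apply: alg_tensor_elementary; [exact: mD|exact: qE].
Qed.

Lemma norm_le_tensor_repr n (u : 'M[T]_n) (c s : R) : 0 <= c -> Mn T0 u ->
  (forall t, tensor_repr D ND E NE u t -> s <= t * c) -> s <= N0 u * c.
Proof.
move=> c0 Tu h; rewrite leNgt; apply/negP => /(exists_gt_mul_lt c0)[t ut].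
by apply/negP; rewrite -leNgt; apply: h; exact: alg_proj_norm_lt.
Qed.

Lemma tensor_map_right_norm s (q : 'I_s -> 'I_s -> V -> V) c :
  (forall k l x, E x -> E (q k l x)) -> (forall k l, linear_on E (q k l)) ->
  0 <= c ->
  (forall n (w : 'M[V]_n), Mn E w ->
    NE (amplify (fun x (p : V -> V) => p x) w (\matrix_(k, l) q k l))
    <= c * NE w) ->
  forall r (u : 'M[T]_r), Mn T0 u ->
  N0 (amplify (fun t (p : V -> V) => tensor_map id p t) u (\matrix_(k, l) q k l))
  <= N0 u * c.
Proof.
move=> qE q_lin c0 q_norm r u Tu; apply: norm_le_tensor_repr => // t.
case=> t0 [K [p [n [g [v [w [a [b [[Dv Ew v1 w1 ig] [ca cb uE]]]]]]]]]].
pose w' := amplify (fun x (p : V -> V) => p x) w (\matrix_(k, l) q k l).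
have Ew' : Mn E w' by move=> i j; rewrite !mxE; exact: qE.
(* The index of the operator family joins the index of [w], forming an index of [w']. *)
pose G (x : K * 'I_s) := ((g x.1).1, mxtens_index ((g x.1).2, x.2)).
have iG : injective G.
  move=> [x i] [y j] e; have e1 : (g x).1 = (g y).1 := congr1 fst e.
  have [e2 ->] := @mxtens_index_inj n s _ _ (congr1 snd e); congr (_, _).
  by apply: ig; rewrite [g x]surjective_pairing e1 e2 -surjective_pairing.
have st0 := sqrtr_ge0 t; have v0 := ruan_ge0 rD Dv; have w0 := ruan_ge0 rE Ew'.
have NE' : NE w' <= c by apply: le_trans (q_norm _ _ Ew) _; rewrite ler_piMr.
apply: (@le_trans _ _ (Num.sqrt t * ND v * NE w' * Num.sqrt t)); last first.
  rewrite -[t in leRHS](sqr_sqrtr (ltW t0)) expr2 [leRHS]mulrAC.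
  by rewrite ler_wpM2r // ler_pM ?mulr_ge0 // ler_piMr.
apply: (alg_proj_norm_le rD rE Dv Ew' iG st0 st0
  (op_bound_reindex (@mxtens_unindex_inj r s) (@inj_id _)
     (op_bound_tens1 (K := 'I_s) ca))
  (op_bound_reindex (@inj_id _) (@mxtens_unindex_inj r s)
     (op_bound_tens1 (K := 'I_s) cb))) => i j.
rewrite !mxE uE (linear_on_bimul _ _ _ _ subT (@tensor_map_linear id _)).
  rewrite [RHS](bimul_tens1 (a _) (b ^~ _)
    (fun x y => elt (v (G x).1 (G y).1) (w' (G x).2 (G y).2))).
  apply: eq_bigr => x _; apply: eq_bigr => y _; congr (_ *: _).
  rewrite tensor_map_elementary //; last exact: qE.
  by rewrite /G /w' !mxE !mxtens_indexK.
by move=> x y; exact: alg_tensor_elementary.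
Qed.

Lemma tensor_map_left_norm s (m : 'I_s -> 'I_s -> U -> U) c :
  (forall k l x, D x -> D (m k l x)) -> (forall k l, linear_on D (m k l)) ->
  0 <= c ->
  (forall n (v : 'M[U]_n), Mn D v ->
    ND (amplify (fun p : U -> U => p) (\matrix_(k, l) m k l) v)
    <= c * ND v) ->
  forall r (u : 'M[T]_r), Mn T0 u ->
  N0 (amplify (fun p : U -> U => tensor_map p id) (\matrix_(k, l) m k l) u)
  <= N0 u * c.
Proof.
move=> mD m_lin c0 m_norm r u Tu; apply: norm_le_tensor_repr => // t.
case=> t0 [K [n [q [g [v [w [a [b [[Dv Ew v1 w1 ig] [ca cb uE]]]]]]]]]].
pose v' := amplify (fun p : U -> U => p) (\matrix_(k, l) m k l) v.
have Dv' : Mn D v' by move=> i j; rewrite !mxE; exact: mD.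
pose G (x : K * 'I_s) := (mxtens_index (x.2, (g x.1).1), (g x.1).2).
have iG : injective G.
  move=> [x i] [y j] e; have e1 : (g x).2 = (g y).2 := congr1 snd e.
  have [-> e2] := @mxtens_index_inj s n _ _ (congr1 fst e); congr (_, _).
  by apply: ig; rewrite [g x]surjective_pairing e1 e2 -surjective_pairing.
have st0 := sqrtr_ge0 t; have v0 := ruan_ge0 rD Dv'; have w0 := ruan_ge0 rE Ew.
have ND' : ND v' <= c by apply: le_trans (m_norm _ _ Dv) _; rewrite ler_piMr.
apply: (@le_trans _ _ (Num.sqrt t * ND v' * NE w * Num.sqrt t)); last first.
  rewrite -[t in leRHS](sqr_sqrtr (ltW t0)) expr2 [leRHS]mulrAC.
  rewrite ler_wpM2r // -[leRHS]mulr1 ler_pM ?mulr_ge0 //.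
  by rewrite ler_wpM2l.
(* Here the operator index comes first in the amplification, while [op_bound_tens1] has it
   second. *)
pose f (i : 'I_(s * r)) := ((mxtens_unindex i).2, (mxtens_unindex i).1).
have jf : injective f.
  by move=> i j [e1 e2]; apply: mxtens_unindex_inj; congr (_, _); exact/val_inj.
apply: (alg_proj_norm_le rD rE Dv' Ew iG st0 st0
  (op_bound_reindex jf (@inj_id _) (op_bound_tens1 (K := 'I_s) ca))
  (op_bound_reindex (@inj_id _) jf (op_bound_tens1 (K := 'I_s) cb))) => i j.
rewrite !mxE uE (linear_on_bimul _ _ _ _ subT (@tensor_map_linear _ id)).
  rewrite [RHS](bimul_tens1 (a _) (b ^~ _)
    (fun x y => elt (v' (G x).1 (G y).1) (w (G x).2 (G y).2))).
  apply: eq_bigr => x _; apply: eq_bigr => y _; congr (_ *: _).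
  rewrite tensor_map_elementary //; last exact: mD.
  by rewrite /G /v' !mxE !mxtens_indexK.
by move=> x y; exact: alg_tensor_elementary.
Qed.

End TensorMaps.

(** The trace turns a representation into [a] times the matrix of values of [v] at [w] times [b].
    The middle matrix is a contraction by the definition of the dual matrix norm, and restricting it
    to the indices [g] does not increase its norm. *)
Lemma tensor_trace_bound (R : realType) (V : lmodType R[i]) (E : set V)
    (NE : matrix_norm R V) n
    (u : 'M[tensor_ambient (V -> R[i]^o) V]_n) : ruan E NE ->
  Mn (alg_tensor (dual E NE) E) u ->
  op_bound (alg_proj_norm (dual E NE) (dual_norm E NE) E NE u)
    (fun i j => u i j (fun f x => f x) : R[i]).
Proof.
move=> rE Tu; have rD := dual_ruan rE; have rT := alg_proj_ruan rD rE.
apply: op_bound_inf => [|t ut]; first exact: (ruan_ge0 rT).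
have [t0 [K [p [q [g [v [w [a [b [[Dv Ew v1 w1 ig] [ca cb uE]]]]]]]]]]] :=
  alg_proj_norm_lt rD rE Tu ut.
have bil : bilinear_on (dual E NE) E (fun (f : V -> R[i]^o) x => f x).
  by split=> [x Ex c f f' _ _|f [lf _ _] c x y Ex Ey]; rewrite ?lf.
have vw := op_bound_reindex ig ig (dual_norm_bound rE Dv Ew).
have -> : t = Num.sqrt t * 1 * Num.sqrt t.
  by rewrite mulr1 -expr2 sqr_sqrtr // ltW.
have vw1 : op_bound 1 (fun k l => v (g k).1 (g l).1 (w (g k).2 (g l).2) : R[i]).
  apply: op_bound_le vw; first by rewrite mulr_ge0 ?(ruan_ge0 rE) ?(ruan_ge0 rD).
  by rewrite mulr_ile1 ?(ruan_ge0 rE) ?(ruan_ge0 rD).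
apply: op_bound_eq (op_bound_comp (op_bound_comp ca vw1) cb) => i j.
pose tau (z : tensor_ambient (V -> R[i]^o) V) : R[i]^o := z (fun f x => f x).
have tau_lin : linear_on (alg_tensor (dual E NE) E) tau by [].
rewrite uE -/(tau _) (linear_on_bimul _ _ _ _ (ruan_sub rT) tau_lin).
  rewrite /bimul exchange_big; apply: eq_bigr => l _; rewrite mulr_suml.
  apply: eq_bigr => k _; rewrite /tau /elementary_tensor asboolT // mulrAC.
  by [].
by move=> k l; exact: alg_tensor_elementary.
Qed.

(** * The operator Fourier space *)

Section Fourier.
Variables (R : realType) (A X : lmodType R[i]).
Variables (NA : matrix_norm R A) (mul : A -> A -> A).
Variables (NX : matrix_norm R X) (Q : X -> A -> X).
Hypotheses (osA : operator_space setT NA) (osX : operator_space setT NX).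
Hypothesis mul_cc : cc_bilinear setT NA setT NA setT NA mul.
Hypothesis QA : forall x a b, Q (Q x a) b = Q x (mul a b).
Hypothesis Q_cc : cc_bilinear setT NX setT NA setT NX Q.

Local Notation C := R[i].
Local Notation D := (dual setT NX).
Local Notation ND := (dual_norm setT NX).
Local Notation T := (tensor_ambient (X -> C^o) X).
Local Notation elt := (elementary_tensor D (setT : set X)).
Local Notation T0 := (alg_tensor D (setT : set X)).
Local Notation N0 := (alg_proj_norm D ND setT NX).
Local Notation PT := (cauchy_in T0 N0).
Local Notation S := (fourier_space NX Q).
Local Notation NS := (fourier_norm NX Q).
Let rA := operator_space_ruan osA.
Let rX := operator_space_ruan osX.
Let rD := dual_ruan rX.
Let rT := alg_proj_ruan rD rX.

(** [ev ^~ u] is the image under P of the algebraic tensor [u]. *)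
Definition ev (a : A) (u : T) : C^o := u (fun f x => f (Q x a)).

Lemma Q_linearl a : linear_on setT (Q ^~ a).
Proof. by have [_ [h _] _] := Q_cc; exact: h. Qed.

Lemma Q_linearr x : linear_on setT (Q x).
Proof. by have [_ [_ h] _] := Q_cc; exact: h. Qed.

Lemma ev_bilinear a : bilinear_on D setT (fun f x => f (Q x a) : C^o).
Proof.
split=> [x _ c f g _ _|f [lf _ _] c x y _ _] //.
by rewrite Q_linearl // lf.
Qed.

Lemma ev_elementary a f x : D f -> ev a (elt f x) = f (Q x a).
Proof.
by move=> Df; rewrite /ev /elementary_tensor asboolT //; exact: ev_bilinear.
Qed.

Lemma ev_linear a : linear_on T0 (ev a).
Proof. by []. Qed.

(** Elements of the ambient space are arbitrary functions, so linearity in the point [a] is checked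
    on elementary tensors and extended to their span. *)
Lemma ev_linear_alg u c a b : T0 u -> ev (c *: a + b) u = c *: ev a u + ev b u.
Proof.
apply: (alg_tensor_ext rD rX (f := ev (c *: a + b))
  (g := fun u => c *: ev a u + ev b u)) => // [d x y _ _|f x Df _].
  rewrite -[ev a (d *: x + y)]/(d *: ev a x + ev a y).
  rewrite -[ev b (d *: x + y)]/(d *: ev b x + ev b y).
  by rewrite !scalerDr !scalerA (mulrC d) addrACA.
rewrite !ev_elementary //; have [lf _ _] := Df.
by rewrite Q_linearr // lf.
Qed.

Definition act (a : A) (u : T) : T := tensor_map D setT id (Q ^~ a) u.

(** P intertwines the two actions: substitution into the evaluation form produces [Q (Q x a) b],
    which is [Q x (mul a b)]. *)
Lemma ev_act a b u : ev b (act a u) = ev (mul a b) u.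
Proof.
rewrite /ev /act tensor_map_bilinear; last exact: ev_bilinear.
by congr u; apply/funext => f; apply/funext => x; rewrite QA.
Qed.

Lemma act_alg a u : T0 u -> T0 (act a u).
Proof. by apply: (tensor_map_alg rD rX) => //; exact: Q_linearl. Qed.

Lemma act_norm r s (u : 'M[T]_r) (a : 'M[A]_s) : Mn T0 u ->
  N0 (amplify (fun t a => act a t) u a) <= N0 u * NA a.
Proof.
move=> Tu.
pose q k l x := Q x (a k l).
have -> : amplify (fun t a => act a t) u a =
    amplify (fun t p => tensor_map D setT id p t) u (\matrix_(k, l) q k l).
  by apply/matrixP => i j; rewrite !mxE.
apply: (tensor_map_right_norm rD rX) => //.
- by move=> k l; exact: Q_linearl.
- exact: (ruan_ge0 rA).
move=> n w Ew; have [_ _ hQ] := Q_cc; rewrite mulrC.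
apply: le_trans (hQ _ _ w a Ew _) => //; rewrite le_eqVlt; apply/orP; left.
by apply/eqP; congr (NX _); apply/matrixP => i j; rewrite !mxE.
Qed.

Lemma pairing_bound n r (u : 'M[T]_n) (x : 'M[A]_r) : Mn T0 u ->
  op_bound (N0 u * NA x)
    (fun i j : 'I_n * 'I_r => ev (x i.2 j.2) (u i.1 j.1) : C).
Proof.
move=> Tu; have Tau : Mn T0 (amplify (fun t a => act a t) u x).
  by move=> i j; rewrite mxE; apply: act_alg; exact: Tu.
have h := op_bound_reindex (@mxtens_index_inj n r) (@mxtens_index_inj n r)
  (tensor_trace_bound rX Tau).
apply: op_bound_le (act_norm x Tu) _; first exact: (ruan_ge0 rT).
apply: op_bound_eq h => i j; rewrite mxE !mxtens_indexK /act.
rewrite tensor_map_bilinear //.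
by split=> [y _ c f g _ _|f [lf _ _] c y z _ _]; rewrite ?lf.
Qed.

Lemma ev_bounded a : exists2 M : R, 0 <= M & forall t, T0 t ->
  normc (ev a t) <= M * N0 (const_mx t : 'M[T]_1).
Proof.
have a0 : 0 <= NA (const_mx a : 'M[A]_1) by exact: (ruan_ge0 rA).
exists (NA (const_mx a : 'M[A]_1)) => // t Tt.
have Tt1 : Mn T0 (const_mx t : 'M[T]_1) by exact: Mn_const.
have := pairing_bound (const_mx a : 'M[A]_1) Tt1.
move=> /(@op_bound_normc_entry _ _ _ _ _ (ord0, ord0) (ord0, ord0)).
rewrite !mxE mulrC; apply; rewrite mulr_ge0 //; exact: (ruan_ge0 rT).
Qed.

(** [fourier_space] and [fourier_norm] unfold to the image of [limit_map] for [ev] and its quotient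
    norm, so the general results apply by conversion. *)
Lemma fourier_ruan : ruan S NS.
Proof. exact: (limit_map_ruan rT ev_linear ev_bounded). Qed.

Lemma fourier_operator_space : operator_space S NS.
Proof. exact: (limit_map_operator_space rT ev_linear ev_bounded). Qed.

Lemma fourier_cvg xi a : PT xi ->
  (fun k => ev a (xi k)) @ \oo --> fourier_map Q xi a.
Proof. exact: (@limit_map_cvg _ _ _ _ _ ev rT ev_linear ev_bounded xi a). Qed.

Lemma fourier_pairing n r (xi : 'M[nat -> T]_n) (x : 'M[A]_r) : Mn PT xi ->
  op_bound (completion_norm N0 xi * NA x)
    (fun i j : 'I_n * 'I_r => fourier_map Q (xi i.1 j.1) (x i.2 j.2) : C).
Proof.
move=> hxi.
apply: (@complex_cvg_op_bound R _ _
  (fun k => N0 (map_mx (fun u : nat -> T => u k) xi) * NA x) _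
  (fun k i j => ev (x i.2 j.2) (xi i.1 j.1 k))).
- by apply: cvgM; [exact: (completion_norm_cvg rT hxi)|exact: cvg_cst].
- by move=> i j; apply: fourier_cvg; exact: hxi.
move=> k; apply: op_bound_eq (pairing_bound x (Mn_at k hxi)) => i j.
by rewrite mxE.
Qed.

Lemma fourier_dual_bound n (phi : 'M[A -> C^o]_n) : Mn S phi ->
  dual_bound setT NA (NS phi) phi.
Proof.
move=> Sphi r x _; have x0 : 0 <= NA x by exact: (ruan_ge0 rA).
apply: op_bound_inf => [|d]; first by rewrite mulr_ge0 // (ruan_ge0 fourier_ruan).
move=> /(exists_gt_mul_lt x0)[t phit td].
have [xi [hxi xiE xit]] := quotient_norm_lt (N := completion_norm N0) Sphi phit.
apply: op_bound_le (_ : completion_norm N0 xi * NA x <= d) _.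
- by rewrite mulr_ge0 // (ruan_ge0 (completion_ruan rT)).
- by apply: le_trans (ltW td); rewrite ler_wpM2r // ltW.
apply: op_bound_eq (fourier_pairing x hxi) => i j.
by rewrite -xiE mxE.
Qed.

Lemma fourier_sub_dual : S `<=` dual setT NA.
Proof.
move=> _ [xi hxi <-]; split=> [c a b _ _||a /(_ I)//].
  apply: (limit_map_eq (ev := ev)).
  have -> : (fun k => ev (c *: a + b) (xi k)) =
      (fun k => c *: ev a (xi k) + ev b (xi k)).
    by apply/funext => k; rewrite ev_linear_alg //; exact: hxi.1.
  apply: cvgD; last exact: fourier_cvg.
  by apply: cvgZl_tmp; exact: fourier_cvg.
exists (completion_norm N0 (const_mx xi : 'M[nat -> T]_1)) => a _.
have hxi1 : Mn PT (const_mx xi : 'M[nat -> T]_1) by exact: Mn_const.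
have := fourier_pairing (const_mx a : 'M[A]_1) hxi1.
move=> /(@op_bound_normc_entry _ _ _ _ _ (ord0, ord0) (ord0, ord0)).
rewrite !mxE; apply; rewrite mulr_ge0 ?(ruan_ge0 rA) //.
exact: (ruan_ge0 (completion_ruan rT)).
Qed.

Lemma fourier_inclusion :
  complete_contraction S NS (dual setT NA) (dual_norm setT NA) id.
Proof.
split=> [phi Sphi|//|n phi Sphi]; first exact: fourier_sub_dual.
rewrite map_mx_id //; apply: (dual_norm_le rA).
  exact: (ruan_ge0 fourier_ruan).
exact: fourier_dual_bound.
Qed.

Lemma bounded_of_matrix_bound (g : T -> T) c : 0 <= c ->
  (forall u : 'M[T]_1, Mn T0 u -> N0 (map_mx g u) <= N0 u * c) ->
  exists2 M : R, 0 <= M & forall t, T0 t ->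
    N0 (const_mx (g t) : 'M[T]_1) <= M * N0 (const_mx t : 'M[T]_1).
Proof.
move=> c0 h; exists c => // t Tt.
by rewrite mulrC -map_const_mx; apply: h; exact: Mn_const.
Qed.

Lemma fourier_map_act xi a : fourier_map Q (act a \o xi) =
  fun_act mul (fourier_map Q xi) a.
Proof.
apply/funext => b; rewrite /fun_act /fourier_map.
by congr (lim (_ @ \oo)); apply/funext => k; exact: ev_act.
Qed.

Lemma fourier_action : cc_bilinear S NS setT NA S NS (fun_act mul).
Proof.
have key r s (phi : 'M[A -> C^o]_r) (a : 'M[A]_s) : Mn S phi ->
    Mn S (amplify (fun_act mul) phi a) /\
    NS (amplify (fun_act mul) phi a) <= NS phi * NA a.
  move=> Sphi; have a0 : 0 <= NA a by exact: (ruan_ge0 rA).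
  pose g (i j : 'I_(r * s)) := act (a (mxtens_unindex i).2 (mxtens_unindex j).2).
  pose h (i j : 'I_(r * s)) phi : A -> C^o :=
    fun_act mul phi (a (mxtens_unindex i).2 (mxtens_unindex j).2).
  suff : Mn S (\matrix_(i, j) h i j (phi (mxtens_unindex i).1 (mxtens_unindex j).1)) /\
      NS (\matrix_(i, j) h i j (phi (mxtens_unindex i).1 (mxtens_unindex j).1)) <=
      NA a * NS phi by rewrite mulrC.
  apply: (@image_family _ _ _ _ _ ev rT _ _ _ g h) => //.
  - by move=> i j t; exact: act_alg.
  - by move=> i j; exact: tensor_map_linear.
  - move=> i j; rewrite /g; set x := a _ _.
    have x0 : 0 <= NA (const_mx x : 'M[A]_1) by exact: (ruan_ge0 rA).
    apply: (bounded_of_matrix_bound x0) => u Tu.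
    apply: le_trans (act_norm (const_mx x : 'M[A]_1) Tu); rewrite le_eqVlt.
    apply/orP; left; apply/eqP; congr (N0 _); apply/matrixP => k l.
    by rewrite !mxE !ord1.
  - by move=> u Tu; rewrite mulrC; exact: act_norm.
  - by move=> i j xi hxi; exact: fourier_map_act.
split.
- move=> phi a Sphi _.
  (* Membership is the case of matrices with one entry. *)
  have [h _] := key 1 1 (const_mx phi) (const_mx a) (Mn_const Sphi).
  by have := h ord0 ord0; rewrite !mxE.
- split=> [a _ c phi psi _ _ //|phi Sphi c a b _ _].
  apply/funext => d; have [lphi _ _] := fourier_sub_dual Sphi.
  have [_ [mull _] _] := mul_cc.
  by rewrite /fun_act mull // lphi.
- by move=> r s phi a Sphi _; exact: (key _ _ _ _ Sphi).2.
Qed.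

(** * The action of functionals on the Fourier space *)

Section Introverted.
Variable mu : (A -> C^o) -> C^o.
Hypothesis Smu : dual S NS mu.

(* [<mu . x^*, x> = <mu, x^* . x>], so that
   [mu [] (x^* . x) = (mu . x^* ) . x]. *)
Definition dual_act (m : (A -> C^o) -> C^o) (f : X -> C^o) : X -> C^o :=
  fun x => m (ev ^~ (elt f x)).

Lemma fourier_elementary u : T0 u -> S (ev ^~ u).
Proof. exact: (image_cst ev rT). Qed.

Lemma dual_act_linear : linear_on D (dual_act mu).
Proof.
move=> c f g Df Dg; apply/funext => x; have [lmu _ _] := Smu.
have lelt := @elementary_tensor_linearl _ _ _ D setT x I.
rewrite /dual_act (lelt c f g Df Dg).
by apply: (lmu c (ev ^~ (elt f x)) (ev ^~ (elt g x)));
  apply: fourier_elementary; exact: alg_tensor_elementary.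
Qed.

Lemma dual_act_dual f : D f -> D (dual_act mu f).
Proof.
move=> Df; have [lmu [M muM] _] := Smu.
have Telt x : T0 (elt f x) by exact: alg_tensor_elementary.
split=> [c x y _ _||x /(_ I)//].
  rewrite /dual_act (@elementary_tensor_linearr _ _ _ D setT f Df c x y I I).
  by apply: (lmu c (ev ^~ (elt f x)) (ev ^~ (elt f y)));
    exact: fourier_elementary.
have f0 : 0 <= ND (const_mx f : 'M[X -> C^o]_1).
  by apply: (ruan_ge0 rD); exact: Mn_const.
(* The bound [M] of [mu] comes without a sign, so its absolute value is used. *)
exists (`|M| * ND (const_mx f : 'M[X -> C^o]_1)) => x _.
have Selt : S (ev ^~ (elt f x)) by exact: fourier_elementary.
apply: le_trans (muM _ Selt) _.
have NS0 : 0 <= NS (const_mx (ev ^~ (elt f x)) : 'M[A -> C^o]_1).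
  by apply: (ruan_ge0 fourier_ruan); exact: Mn_const.
apply: (@le_trans _ _ (`|M| * NS (const_mx (ev ^~ (elt f x)) : 'M[A -> C^o]_1))).
  by rewrite ler_wpM2r // ler_norm.
rewrite -mulrA ler_wpM2l // -(map_const_mx (fun t => ev ^~ t)).
apply: le_trans (image_cst_norm ev rT _) _; first exact: Mn_const.
have h := alg_proj_norm_amplify rD rX (v := const_mx f : 'M[X -> C^o]_1)
  (w := const_mx x : 'M[X]_1) (Mn_const Df) (Mn_const I).
apply: le_trans h; rewrite le_eqVlt; apply/orP; left; apply/eqP.
by congr (N0 _); apply/matrixP => i j; rewrite !mxE.
Qed.

(** Both sides are linear in [u] and agree on elementary tensors, where each is [mu] at the image of
    [elt f (Q x a)]. *)
Lemma ev_dual_act a u : T0 u ->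
  ev a (tensor_map D setT (dual_act mu) id u) = mu (ev ^~ (act a u)).
Proof.
have [lmu _ _] := Smu.
apply: (alg_tensor_ext rD rX
  (f := fun u => ev a (tensor_map D setT (dual_act mu) id u))
  (g := fun u => mu (ev ^~ (act a u)))).
- by move=> c y z Ty Tz; rewrite (tensor_map_linear _ _ c Ty Tz).
- move=> c y z Ty Tz; rewrite /act (tensor_map_linear _ _ c Ty Tz).
  by apply: (lmu c (ev ^~ (act a y)) (ev ^~ (act a z)));
    apply: fourier_elementary; exact: act_alg.
move=> f x Df _; rewrite tensor_map_elementary //.
- rewrite ev_elementary; last exact: dual_act_dual.
  rewrite /act tensor_map_elementary //; exact: Q_linearl.
- exact: dual_act_dual.
- exact: dual_act_linear.
Qed.

(** The algebraic identity has to survive a limit through [mu], which is bounded for the Fourier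
    norm. That norm controls the tails of a lift, and the bounded action of [a] keeps them small
    before [mu] is applied. *)
Lemma fourier_map_dual_act xi : PT xi ->
  fourier_map Q (tensor_map D setT (dual_act mu) id \o xi) =
  intro_prod mul mu (fourier_map Q xi).
Proof.
move=> hxi; apply/funext => a.
apply: (@limit_map_eq _ _ _ ev (tensor_map D setT (dual_act mu) id \o xi) a).
have [lmu [M muM] _] := Smu.
rewrite /comp; have Tx k : T0 (xi k) by exact: hxi.1.
have -> : (fun k => ev a (tensor_map D setT (dual_act mu) id (xi k))) =
    (fun k => mu (ev ^~ (act a (xi k)))).
  by apply/funext => k; exact: ev_dual_act.
have [act_S act_lin act_le] := fourier_action.
have Sphi : S (fourier_map Q xi) by exists xi.
have a0 : 0 <= NA (const_mx a : 'M[A]_1) by exact: (ruan_ge0 rA).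
apply/complex_cvgP => e e0.
have B0 : 0 < `|M| * NA (const_mx a : 'M[A]_1) + 1.
  by rewrite ltr_wpDl // mulr_ge0.
(* Half of [e] turns the non-strict tail estimate into a strict one; the added 1 keeps the divisor
   positive. *)
have [|K hK] := image_tail rT ev_linear ev_bounded hxi
  (e := e / 2 / (`|M| * NA (const_mx a : 'M[A]_1) + 1)).
  by rewrite !divr_gt0.
exists K => k /hK {}hK; rewrite /intro_prod.
have Sk : S (ev ^~ (xi k)) by exact: fourier_elementary.
have subS := ruan_sub fourier_ruan.
pose d := ev ^~ (xi k) - fourier_map Q xi.
have Sd : S d by exact: subspaceB.
have -> : ev ^~ (act a (xi k)) = fun_act mul (ev ^~ (xi k)) a.
  by apply/funext => b; exact: ev_act.
rewrite -(linear_onB subS lmu); [|exact: act_S|exact: act_S].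
have -> : fun_act mul (ev ^~ (xi k)) a - fun_act mul (fourier_map Q xi) a =
  fun_act mul d a by [].
have Sda : S (fun_act mul d a) by exact: act_S.
apply: le_lt_trans (muM _ Sda) _.
have NS0 : 0 <= NS (const_mx (fun_act mul d a) : 'M[A -> C^o]_1).
  by apply: (ruan_ge0 fourier_ruan); exact: Mn_const.
have := act_le 1 1 (const_mx d) (const_mx a) (Mn_const Sd) (Mn_const I).
have -> : amplify (fun_act mul) (const_mx d : 'M[_]_1) (const_mx a : 'M[_]_1) =
    const_mx (fun_act mul d a) by apply/matrixP => i j; rewrite !mxE.
move=> hle; set B := `|M| * _ + 1 in B0 hK.
have hd : NS (const_mx d : 'M[A -> C^o]_1) <= e / 2 / B by exact: hK.
have d0 : 0 <= NS (const_mx d : 'M[A -> C^o]_1).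
  by apply: (ruan_ge0 fourier_ruan); exact: Mn_const.
apply: (@le_lt_trans _ _ (B * (e / 2 / B))); last first.
  by rewrite mulrC divfK ?gt_eqF // gtr_pMr ?invf_lt1 // ltr1n.
apply: (@le_trans _ _ (`|M| * (NS (const_mx d : 'M[A -> C^o]_1) *
    NA (const_mx a : 'M[A]_1)))).
  apply: (@le_trans _ _ (`|M| * NS (const_mx (fun_act mul d a) : 'M[A -> C^o]_1))).
    by rewrite ler_wpM2r // ler_norm.
  by rewrite ler_wpM2l.
rewrite mulrCA mulrC; apply: ler_pM => //; first by rewrite mulr_ge0.
by rewrite lerDl.
Qed.

End Introverted.

(** Pairing the amplified functionals with [x] amounts to pairing [mu] with [y], the image under P
    of the amplified elementary tensors of [v] and [x], whose Fourier norm is at most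
    [ND v * NX x]. *)
Lemma dual_act_norm r n (mu : 'M[(A -> C^o) -> C^o]_r) (v : 'M[X -> C^o]_n) :
  Mn (dual S NS) mu -> Mn D v ->
  ND (amplify (fun p => p) (\matrix_(k, l) dual_act (mu k l)) v) <=
  dual_norm S NS mu * ND v.
Proof.
move=> Smu Dv; have mu0 := dual_norm_ge0 fourier_ruan Smu.
have v0 : 0 <= ND v by exact: (ruan_ge0 rD).
apply: (dual_norm_le rX) => [|t x _]; first by rewrite mulr_ge0.
have Ex : Mn (setT : set X) x by [].
have Tvx := Mn_amplify_elementary Dv Ex.
pose y := map_mx (fun t => ev ^~ t) (amplify elt v x).
have Sy : Mn S y by move=> i j; rewrite !mxE; apply: fourier_elementary;
  apply: alg_tensor_elementary => //; exact: Dv.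
have yle : NS y <= ND v * NX x.
  apply: le_trans (image_cst_norm ev rT Tvx) _.
  exact: alg_proj_norm_amplify.
(* [g] regroups the index triple from [((r, n), t)] to [(r, (n, t))]. *)
pose g (i : 'I_(r * n) * 'I_t) :=
  ((mxtens_unindex i.1).1, mxtens_index ((mxtens_unindex i.1).2, i.2)).
have ig : injective g.
  move=> [i k] [j l] e.
  have e1 : (mxtens_unindex i).1 = (mxtens_unindex j).1 := congr1 fst e.
  have [e2 ->] := @mxtens_index_inj n t _ _ (congr1 snd e); congr (_, _).
  by apply: mxtens_unindex_inj; congr (_, _) => //; exact: val_inj.
have h := op_bound_reindex ig ig (dual_norm_bound fourier_ruan Smu Sy).
apply: op_bound_le (_ : dual_norm S NS mu * NS y <= _) _.
- by rewrite mulr_ge0 // (ruan_ge0 fourier_ruan).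
- by rewrite -mulrA ler_wpM2l.
apply: op_bound_eq h => i j; by rewrite /g /y /= !mxE !mxtens_indexK.
Qed.

Lemma dual_act_tensor_norm r n (mu : 'M[(A -> C^o) -> C^o]_r) (u : 'M[T]_n) :
  Mn (dual S NS) mu -> Mn T0 u ->
  N0 (amplify (fun m => tensor_map D setT (dual_act m) id) mu u) <=
  N0 u * dual_norm S NS mu.
Proof.
move=> Smu Tu.
have -> : amplify (fun m => tensor_map D setT (dual_act m) id) mu u =
    amplify (fun p : (X -> C^o) -> (X -> C^o) => tensor_map D setT p id)
      (\matrix_(k, l) dual_act (mu k l)) u.
  by apply/matrixP => i j; rewrite !mxE.
apply: (tensor_map_left_norm rD rX) => //.
- by move=> k l f; apply: dual_act_dual; exact: Smu.
- by move=> k l; apply: dual_act_linear; exact: Smu.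
- exact: (dual_norm_ge0 fourier_ruan).
- by move=> k v Dv; exact: (dual_act_norm Smu Dv).
Qed.

Lemma fourier_introverted :
  cc_bilinear (dual S NS) (dual_norm S NS) S NS S NS (intro_prod mul).
Proof.
have key r s (mu : 'M[(A -> C^o) -> C^o]_r) (phi : 'M[A -> C^o]_s) :
    Mn (dual S NS) mu -> Mn S phi ->
    Mn S (amplify (intro_prod mul) mu phi) /\
    NS (amplify (intro_prod mul) mu phi) <= dual_norm S NS mu * NS phi.
  move=> Smu Sphi; have mu0 := dual_norm_ge0 fourier_ruan Smu.
  pose g (i j : 'I_(r * s)) : T -> T := tensor_map D setT
    (dual_act (mu (mxtens_unindex i).1 (mxtens_unindex j).1)) id.
  pose h (i j : 'I_(r * s)) (phi : A -> C^o) : A -> C^o :=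
    intro_prod mul (mu (mxtens_unindex i).1 (mxtens_unindex j).1) phi.
  suff : Mn S (\matrix_(i, j) h i j (phi (mxtens_unindex i).2 (mxtens_unindex j).2)) /\
      NS (\matrix_(i, j) h i j (phi (mxtens_unindex i).2 (mxtens_unindex j).2)) <=
      dual_norm S NS mu * NS phi by [].
  apply: (@image_family _ _ _ _ _ ev rT _ _ _ g h) => //.
  - move=> i j t; apply: (tensor_map_alg rD rX) => //.
    + by move=> f; apply: dual_act_dual; exact: Smu.
    + by apply: dual_act_linear; exact: Smu.
  - by move=> i j; exact: tensor_map_linear.
  - move=> i j; rewrite /g; set m := mu _ _.
    have Sm : Mn (dual S NS) (const_mx m : 'M[(A -> C^o) -> C^o]_1).
      exact: Mn_const (Smu _ _).
    apply: (bounded_of_matrix_bound (dual_norm_ge0 fourier_ruan Sm)) => u Tu.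
    apply: le_trans (dual_act_tensor_norm Sm Tu); rewrite le_eqVlt.
    apply/orP; left; apply/eqP; congr (N0 _); apply/matrixP => k l.
    by rewrite !mxE !ord1.
  - by move=> u Tu; rewrite mulrC; exact: dual_act_tensor_norm.
  - by move=> i j xi hxi; apply: fourier_map_dual_act => //; exact: Smu.
split.
- move=> mu phi Smu Sphi.
  have [h _] := key 1 1 (const_mx mu) (const_mx phi) (Mn_const Smu) (Mn_const Sphi).
  by have := h ord0 ord0; rewrite !mxE.
- split=> [phi _ c mu nu _ _ //|mu [lmu _ _] c phi psi Sphi Spsi].
  have [act_S _ _] := fourier_action.
  apply/funext => a.
  exact: (lmu c (fun_act mul phi a) (fun_act mul psi a) (act_S _ _ Sphi I)
    (act_S _ _ Spsi I)).
- by move=> r s mu phi Smu Sphi; exact: (key _ _ _ _ Smu Sphi).2.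
Qed.

End Fourier.

Theorem theorem4p1 (R : realType) (A X : lmodType R[i])
    (NA : matrix_norm R A) (mul : A -> A -> A)
    (NX : matrix_norm R X) (Q : X -> A -> X) :
  cc_banach_algebra NA mul ->
  cc_right_module NA mul NX Q ->
  left_introverted_homogeneous NA mul (fourier_space NX Q) (fourier_norm NX Q).
Proof.
move=> [osA _ mul_cc] [osX QA Q_cc]; split.
- exact: fourier_sub_dual osA osX Q_cc.
- exact: fourier_operator_space osA osX Q_cc.
- exact: fourier_inclusion osA osX Q_cc.
- exact: fourier_action osA osX mul_cc QA Q_cc.
- exact: fourier_introverted osA osX mul_cc QA Q_cc.
Qed.
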